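(* Let $A_0,A_1,A_2,\ldots$ be complex valued random variables (not necessarily independent nor identically distributed), and let $P_n(z)=\sum_{k=0}^n A_k z^k$ for $n\in\mathbb{N}$. Fix $t>0$, and suppose that the coefficients of $P_n$ satisfy: 1. $\mathbb{E}[|A_k|^t]<\infty$ for $k=0,\ldots,n$; 2. $\mathbb{E}[\log|A_0|]>-\infty$ and $\mathbb{E}[\log|A_n|]>-\infty$. Let $0<r<1$ and $0\le\alpha<\beta<2\pi$. Then for all large $n\in\mathbb{N}$ we have $$\mathbb{E}\left[\left|\tau_n(A_r(\alpha,\beta))-\frac{\beta-\alpha}{2\pi}\right|\right]\le C_r\left[\frac1n\left(\frac1t\log\sum_{k=0}^n\mathbb{E}[|A_k|^t]-\frac12\mathbb{E}[\log|A_0A_n|]\right)\right]^{1/2},$$ where $$C_r:=\sqrt{\frac{2\pi}{\mathbf{k}}}+\frac{2}{1-r}\quad\text{with}\quad\mathbf{k}:=\sum_{k=0}^{\infty}\frac{(-1)^k}{(2k+1)^2}$$ being Catalan's constant.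
   Context: For a polynomial $P_n$ of degree $n$ with complex zeros $Z_1,\ldots,Z_n$ (listed with multiplicity), the zero counting measure is $\tau_n=\frac1n\sum_{k=1}^n\delta_{Z_k}$, a random unit Borel measure on $\mathbb{C}$. (The hypotheses imply $A_0A_n\ne0$ almost surely, so $P_n$ has degree $n$ almost surely.) The annular sector is $A_r(\alpha,\beta)=\{z\in\mathbb{C}: r<|z|<1/r,\ \alpha\le\arg z<\beta\}$, where $0<r<1$ and $\arg z\in[0,2\pi)$. *)

(* Defs.v *)
From HB Require Import structures.
From mathcomp Require Import all_boot all_order all_algebra.
From mathcomp Require Import all_classical all_reals all_analysis.
From mathcomp Require Import complex.

Set Implicit Arguments.
Unset Strict Implicit.
Unset Printing Implicit Defensive.

Import Order.TTheory GRing.Theory Num.Theory.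
Import numFieldNormedType.Exports.

Local Open Scope classical_set_scope.
Local Open Scope ring_scope.
Local Open Scope complex_scope.

(* The R-valued modulus; [`|z|] is the same number embedded in [R[i]]. *)
Definition cmod (R : realType) (z : R[i]) : R := Normc.normc z.

(* The complex plane with its Borel sigma-algebra; [R[i]^o] provides the
   topology of the modulus. *)
Notation borelC R := (g_sigma_algebraType (@open (R[i]^o))).

(* The argument in [[0, 2 * pi[]; its value at [0] is irrelevant. *)
Definition carg (R : realType) (z : R[i]) : R :=
  let theta := acos (complex.Re z / cmod z) in
  if 0 <= complex.Im z then theta else 2 * pi - theta.

Lemma cargP (R : realType) (z : R[i]) : z != 0 ->
  [/\ 0 <= carg z, carg z < 2 * pi
    & z = (cmod z * cos (carg z)) +i* (cmod z * sin (carg z))].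
Proof.
case: z => a b z0; rewrite /carg /=.
set m := cmod (a +i* b).
have mE : m ^+ 2 = a ^+ 2 + b ^+ 2.
  by rewrite /m /cmod /Normc.normc sqr_sqrtr// addr_ge0 ?sqr_ge0.
have m0 : 0 < m.
  rewrite lt_neqAle eq_sym sqrtr_ge0 andbT.
  by apply: contra z0 => /eqP /Normc.eq0_normc ->.
have mn0 : m != 0 by rewrite gt_eqF.
have c2 : (a / m) ^+ 2 = 1 - (b / m) ^+ 2.
  by rewrite !expr_div_n; apply/(canRL (addrK _));
     rewrite -mulrDl -mE divff// expf_neq0.
have c1 : `|a / m| <= 1.
  by rewrite -sqr_norm_le1 || rewrite -(ler_pXn2r (n:=2)) ?nnegrE// expr1n
     real_normK ?num_real// c2 lerBlDr lerDl sqr_ge0.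
have /andP[cN1 cP1] : -1 <= a / m <= 1 by rewrite -ler_norml.
have cosE : cos (acos (a / m)) = a / m by rewrite acosK// in_itv/= cN1.
have sinE : sin (acos (a / m)) = `|b| / m.
  by rewrite sin_acos ?cN1// c2 opprB addrCA subrr addr0 sqrtr_sqr normrM
     [X in _ * X]ger0_norm// invr_ge0 ltW.
have pi0 := pi_gt0 R.
have aC : a = m * (a / m) by rewrite mulrC divfK.
have acge0 : 0 <= acos (a / m) by rewrite acos_ge0// cN1.
have acpi : acos (a / m) <= pi by rewrite acos_lepi// cN1.
case: ifPn => [b0|].
  split => //.
    by rewrite (le_lt_trans acpi)// mulr2n mulrDl mul1r ltrDl.
  by rewrite cosE sinE -aC ger0_norm// mulrC divfK.
rewrite -ltNge => b0; split.
- by rewrite subr_ge0 (le_trans acpi)// mulr2n mulrDl mul1r lerDl ltW.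
- rewrite ltrBlDr ltrDl acos_gt0// cN1/= lt_neqAle cP1 andbT.
  apply/eqP => c1e; move: c2; rewrite c1e expr1n => /esym/eqP.
  rewrite -subr_eq0 addrAC subrr sub0r oppr_eq0 expf_eq0/= mulf_eq0 invr_eq0.
  by rewrite (lt_eqF b0) (negbTE mn0).
- have -> : 2 * pi - acos (a / m) = - acos (a / m) + pi *+ 2.
    by rewrite addrC -[2]/(1 *+ 2) mulrnAl mul1r.
  rewrite cosD2pi sinD2pi cosN sinN cosE sinE -aC ltr0_norm//.
  by rewrite mulNr opprK mulrC divfK.
Qed.

Definition annular_sector (R : realType) (r alpha beta : R) :
    set (borelC R) :=
  [set z | r < cmod z < r^-1 /\ alpha <= carg z < beta].

(* The list of the zeros of [p != 0], repeated according to multiplicity. *)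
Definition zeros (R : realType) (p : {poly R[i]}) : seq R[i] :=
  sval (closed_field_poly_normal p).

Lemma zerosE (R : realType) (p : {poly R[i]}) :
  p = lead_coef p *: \prod_(z <- zeros p) ('X - z%:P).
Proof. exact: (svalP (closed_field_poly_normal p)). Qed.

Lemma size_zeros (R : realType) (p : {poly R[i]}) :
  p != 0 -> size (zeros p) = (size p).-1.
Proof.
move=> p0; rewrite {2}(zerosE p) size_scale ?lead_coef_eq0//.
by rewrite size_prod_XsubC.
Qed.

(* [(size p).-1] is the degree of [p]; on constants this is the zero measure. *)
Definition zero_counting_measure (R : realType) (p : {poly R[i]}) :
    {measure set (borelC R) -> \bar R} :=
  mscale ((size p).-1%:R^-1)%:nng
    (msum (fun k => dirac ((zeros p)`_k : borelC R)) (size p).-1).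

Definition random_poly (R : realType) d (T : measurableType d)
    (P : probability T R) (A : nat -> {RV P >-> borelC R}) (n : nat) (w : T) :
    {poly R[i]} :=
  \poly_(k < n.+1) (A k w : R[i]).

Definition catalan (R : realType) : R :=
  limn (series (fun k => (-1) ^+ k / (2 * k + 1)%:R ^+ 2 : R)).

(* [lne 0 = -oo], whereas the real-valued [ln] of the library has [ln 0 = 0]. *)
Definition elogmod (R : realType) (z : R[i]) : \bar R := lne (cmod z)%:E.

Definition sector_const (R : realType) (r : R) : R :=
  Num.sqrt (2 * pi / catalan R) + 2 / (1 - r).

(* Main.v *)
Require Import Defs.
From mathcomp Require Import all_boot all_order all_algebra.
From mathcomp Require Import all_classical all_reals all_analysis.
From mathcomp Require Import measurable_realfun.
From mathcomp Require Import complex ring lra zify.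

Set Implicit Arguments.
Unset Strict Implicit.
Unset Printing Implicit Defensive.

Import Order.TTheory GRing.Theory Num.Theory.
Import numFieldNormedType.Exports.

Local Open Scope classical_set_scope.
Local Open Scope ring_scope.

(** Let [K = 23 / 10 + 2 / (1 - r)], which is smaller than [sector_const r] by at
    least [1 / 10] ([sector_const_ge]). The theorem is the mean of a
    deterministic inequality of Erdos-Turan type ([poly_equidistribution]): if
    all coefficients of [p] have modulus at most [H], then the discrepancy of
    its [n] zeros in the sector is at most [K * sqrt ((L + c) / n)], where
    [L = ln H - (ln |p_0| + ln |p_n|) / 2] and [c] depends on [r] only.

    One may take [H ^ t] to be the sum of the [|A_k| ^ t]. Replacing the square
    root and the logarithm by tangents at the mean values
    ([discrepancy_le_linear]) gives a bound that is affine in this sum, in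
    [ln |A_0|] and in [ln |A_n|]; by linearity its expectation is
    [K * (1 + c / (2 * B)) * sqrt (B / n)], where [B] is the mean height in the
    theorem. Finally [B] tends to infinity ([height_diverges]): either
    the sums of the moments do, or the moment of [A_n] tends to [0], and with it
    [E ln |A_n|] to [-oo]. So the constant [c] is absorbed by the difference
    between [K] and [sector_const r], and this is why [n] has to be large.

    The deterministic inequality uses of [p] only the growth [H / (1 - |z|)]
    of [p] and of its reversed polynomial in the unit disc. To turn this into a
    uniform bound without losing a factor [ln n], the unit disc is replaced by a
    disc internally tangent to it at [1], where [1 - |z|] dominates
    [|1 - z| ^ 2], and the product of the two polynomials is multiplied by
    [(1 - z) ^ 4] ([tangent_disc]).

    For the zeros of a function bounded on the unit disc, positivity of
    [1 + Re (a w ^ k)], averaged over roots of unity, bounds all power sums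
    ([power_sum_bound]), zeros inside the disc being reflected
    ([reflected_power_sum_bound]). Summing the logarithmic series, one controls
    the sum of the arguments of the linear factors at any interior point ([reflected_parg_bound]). A combination of two such points
    majorizes [pi - carg w] for every zero [w] taken together with its mirror
    image ([pair_lower]). Thus the sum of [pi - carg w] over the zeros is small
    ([sum_carg_bound]); rotating the polynomial and subtracting, one counts the
    zeros with argument between [alpha] and [beta] ([sector_count_bound]).
    Jensen's inequality counts those outside the annulus
    ([count_small_zeros]). *)

(** * Moduli, arguments and the logarithmic series *)

Section ComplexModulus.
Variable R : realType.
Implicit Types z w : R[i].
Local Notation Re := complex.Re.
Local Notation Im := complex.Im.

Lemma cmodE z : cmod z = Num.sqrt (Re z ^+ 2 + Im z ^+ 2).
Proof. by case: z. Qed.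

Lemma sqr_cmod z : cmod z ^+ 2 = Re z ^+ 2 + Im z ^+ 2.
Proof. by rewrite cmodE sqr_sqrtr// addr_ge0 ?sqr_ge0. Qed.

Lemma cmod_ge0 z : 0 <= cmod z.
Proof. by rewrite cmodE sqrtr_ge0. Qed.

Lemma cmodM z w : cmod (z * w) = cmod z * cmod w.
Proof. exact: Normc.normcM. Qed.

Lemma cmodV z : cmod z^-1 = (cmod z)^-1.
Proof. exact: Normc.normcV. Qed.

Lemma cmod1 : cmod (1 : R[i]) = 1.
Proof. exact: Normc.normc1. Qed.

Lemma cmod0 : cmod (0 : R[i]) = 0.
Proof. exact: Normc.normc0. Qed.

Lemma cmodX z n : cmod (z ^+ n) = cmod z ^+ n.
Proof. by elim: n => [|n ih]; rewrite ?expr0 ?cmod1// !exprS cmodM ih. Qed.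

Lemma cmodN z : cmod (- z) = cmod z.
Proof. by case: z => a b; rewrite !cmodE/= !sqrrN. Qed.

Lemma cmodJ z : cmod (conjc z) = cmod z.
Proof. by case: z => a b; rewrite !cmodE/= !sqrrN. Qed.

Lemma cmod_real (x : R) : cmod x%:C%C = `|x|.
Proof. by rewrite cmodE/= expr0n addr0 sqrtr_sqr. Qed.

Lemma cmodD_le z w : cmod (z + w) <= cmod z + cmod w.
Proof. exact: le_normcD. Qed.

Lemma cmodB_le z w : cmod (z - w) <= cmod z + cmod w.
Proof. by rewrite (le_trans (cmodD_le _ _))// cmodN. Qed.

Lemma cmodB_ge z w : cmod z - cmod w <= cmod (z - w).
Proof. by rewrite lerBlDr (le_trans _ (cmodD_le _ _))// subrK. Qed.

Lemma cmod_eq0 z : (cmod z == 0) = (z == 0).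
Proof.
by apply/eqP/eqP => [/Normc.eq0_normc|->]//; rewrite cmod0.
Qed.

Lemma cmod_gt0 z : (0 < cmod z) = (z != 0).
Proof. by rewrite lt_neqAle eq_sym cmod_ge0 andbT cmod_eq0. Qed.

Lemma Re_le_cmod z : `|Re z| <= cmod z.
Proof.
rewrite -(ler_pXn2r (n := 2)) ?nnegrE ?cmod_ge0//.
by rewrite real_normK ?num_real// sqr_cmod lerDl sqr_ge0.
Qed.

Lemma Im_le_cmod z : `|Im z| <= cmod z.
Proof.
rewrite -(ler_pXn2r (n := 2)) ?nnegrE ?cmod_ge0//.
by rewrite real_normK ?num_real// sqr_cmod lerDr sqr_ge0.
Qed.

Lemma cmod_sum (I : Type) (s : seq I) (P : pred I) (F : I -> R[i]) :
  cmod (\sum_(i <- s | P i) F i) <= \sum_(i <- s | P i) cmod (F i).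
Proof.
elim/big_rec2: _ => [|i x y _ ih]; first by rewrite cmod0.
by rewrite (le_trans (cmodD_le _ _))// lerD2l.
Qed.

Lemma cmod_prod (I : Type) (s : seq I) (P : pred I) (F : I -> R[i]) :
  cmod (\prod_(i <- s | P i) F i) = \prod_(i <- s | P i) cmod (F i).
Proof.
by elim/big_rec2: _ => [|i x y _ <-]; rewrite ?cmod1 ?cmodM.
Qed.

Lemma Re_add z w : Re (z + w) = Re z + Re w. Proof. by case: z; case: w. Qed.
Lemma Im_add z w : Im (z + w) = Im z + Im w. Proof. by case: z; case: w. Qed.
Lemma Re_opp z : Re (- z) = - Re z. Proof. by case: z. Qed.
Lemma Im_opp z : Im (- z) = - Im z. Proof. by case: z. Qed.
Lemma Re_mul z w : Re (z * w) = Re z * Re w - Im z * Im w.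
Proof. by case: z; case: w. Qed.
Lemma Im_mul z w : Im (z * w) = Re z * Im w + Im z * Re w.
Proof. by case: z => a b; case: w => c d /=; rewrite [b * c]mulrC. Qed.

Lemma Re_sum (I : Type) (s : seq I) (P : pred I) (F : I -> R[i]) :
  Re (\sum_(i <- s | P i) F i) = \sum_(i <- s | P i) Re (F i).
Proof. by elim/big_rec2: _ => [|i x y _ <-]; rewrite ?Re_add. Qed.

Lemma Im_sum (I : Type) (s : seq I) (P : pred I) (F : I -> R[i]) :
  Im (\sum_(i <- s | P i) F i) = \sum_(i <- s | P i) Im (F i).
Proof. by elim/big_rec2: _ => [|i x y _ <-]; rewrite ?Im_add. Qed.

(** The principal argument when [0 < Re z]; every use is at such a point, so
    that no branch cut is met. *)
Definition parg z : R := atan (Im z / Re z).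

Lemma parg_lt z : `|parg z| < pi / 2.
Proof. by rewrite ltr_norml atan_gtNpi2 atan_ltpi2. Qed.

End ComplexModulus.

Section LogSeries.
Variable R : realType.
Local Notation Re := complex.Re.
Local Notation Im := complex.Im.

Lemma mvt_unit_bound (f df : R -> R) (M : R) :
  (forall x : R, 0 <= x <= 1 -> is_derive x 1 f (df x)) ->
  (forall x : R, 0 <= x <= 1 -> `|df x| <= M) -> `|f 1 - f 0| <= M.
Proof.
move=> fd dM.
have [||c] := @MVT R f df 0 1 ltr01.
- by move=> x /[!in_itv]/= /andP[x0 x1]; apply: fd; rewrite !ltW.
- apply: derivable_within_continuous => x /[!in_itv]/= x01.
  by have [] := fd _ x01.
rewrite in_itv/= => /andP[c0 c1] ->.
by rewrite subr0 mulr1; apply: dM; rewrite !ltW.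
Qed.

(** Both estimates below come from one computation: the [r]-derivative of
    [log (1 - r v)] plus its Taylor polynomial is
    [- v ^+ K.+1 * r ^+ K / (1 - r v)]. *)
Lemma log_series_remainder (v : R[i]) (K : nat) (r : R) :
    0 <= r <= 1 -> cmod v < 1 ->
  cmod (- (v / (1 - r%:C%C * v)) + \sum_(i < K) v ^+ i.+1 * (r ^+ i)%:C%C)
    <= cmod v ^+ K.+1 / (1 - cmod v).
Proof.
move=> /andP[r0 r1] v1.
have rv : cmod (r%:C%C * v) <= cmod v.
  by rewrite cmodM cmod_real ger0_norm// ler_piMl// cmod_ge0.
have dgt : 1 - cmod v <= cmod (1 - r%:C%C * v).
  by rewrite (le_trans _ (cmodB_ge _ _))// cmod1 lerB.
have vgt : 0 < 1 - cmod v by rewrite subr_gt0.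
have d0 : 1 - r%:C%C * v != 0 by rewrite -cmod_gt0 (lt_le_trans vgt).
have -> : - (v / (1 - r%:C%C * v)) + \sum_(i < K) v ^+ i.+1 * (r ^+ i)%:C%C =
    - (v ^+ K.+1 * (r ^+ K)%:C%C / (1 - r%:C%C * v)).
  apply: (mulIf d0); rewrite mulrDl !mulNr !divfK//.
  elim: K => [|K ih].
    by rewrite big_ord0 mul0r addr0 expr0 expr1 -[1%:C%C]/(1 : R[i]) mulr1.
  rewrite big_ord_recr/= mulrDl addrA ih !rmorphXn/= !exprS; ring.
rewrite cmodN !cmodM cmodV cmodX cmod_real ger0_norm ?exprn_ge0//.
rewrite ler_pM ?invr_ge0 ?mulr_ge0 ?exprn_ge0 ?cmod_ge0//.
  by rewrite ler_piMr ?exprn_ge0 ?cmod_ge0// exprn_ile1.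
by rewrite lef_pV2 ?posrE// (lt_le_trans vgt).
Qed.

Lemma is_derive_sumX (c : nat -> R) (K : nat) (x : R) :
  is_derive x 1 (fun r : R => \sum_(i < K) c i / i.+1%:R * r ^+ i.+1)
    (\sum_(i < K) c i * x ^+ i).
Proof.
elim: K => [|K ih].
  rewrite big_ord0; under eq_fun do rewrite big_ord0; exact: is_derive_cst.
have dX : is_derive x 1 (fun y : R => y ^+ K.+1) (K.+1%:R * x ^+ K).
  elim: (K) => [|k dk]; first by rewrite expr0 mulr1; exact: is_derive_id.
  under eq_fun do rewrite exprS; apply: is_derive_eq.
  by rewrite /GRing.scale/= -[k.+2%:R]natr1 mulrDl mul1r exprS; ring.
rewrite big_ord_recr/=; under eq_fun do rewrite big_ord_recr/=.
apply: is_deriveD; have := is_deriveZ (c K / K.+1%:R) dX.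
by rewrite /GRing.scale/= mulrA divfK ?pnatr_eq0.
Qed.

Lemma one_sub_sqr_gt0 (a b x : R) : a ^+ 2 + b ^+ 2 < 1 -> 0 <= x <= 1 ->
  0 < 1 - x * a /\ 0 < (1 - x * a) ^+ 2 + (x * b) ^+ 2.
Proof.
move=> ab /andP[x0 x1].
have a1 : `|a| < 1.
  rewrite -(ltr_pXn2r (n := 2)) ?nnegrE// expr1n real_normK ?num_real//.
  by rewrite (le_lt_trans _ ab)// lerDl sqr_ge0.
have xa : 0 < 1 - x * a.
  rewrite subr_gt0 (le_lt_trans (ler_norm _))// normrM ger0_norm//.
  by rewrite (le_lt_trans _ a1)// ler_piMl.
by split=> //; rewrite ltr_pwDl ?sqr_ge0// exprn_gt0.
Qed.

Lemma ln_cmod_series (v : R[i]) (K : nat) : cmod v < 1 ->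
  `|ln (cmod (1 - v)) + \sum_(i < K) Re (v ^+ i.+1) / i.+1%:R|
    <= cmod v ^+ K.+1 / (1 - cmod v).
Proof.
move=> v1; set a := Re v; set b := Im v.
have ab1 : a ^+ 2 + b ^+ 2 < 1.
  by rewrite -sqr_cmod -(expr1n _ 2) ltr_pXn2r ?nnegrE ?cmod_ge0.
pose q (x : R) : R := (1 - x * a) ^+ 2 + (x * b) ^+ 2.
pose f x := 2^-1 * ln (q x) + \sum_(i < K) Re (v ^+ i.+1) / i.+1%:R * x ^+ i.+1.
pose df x := Re (- (v / (1 - x%:C%C * v)) +
                 \sum_(i < K) v ^+ i.+1 * (x ^+ i)%:C%C).
have fd (x : R) : 0 <= x <= 1 -> is_derive x 1 f (df x).
  move=> x01; have [xa qx] := one_sub_sqr_gt0 ab1 x01.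
  have dq : is_derive x 1 q (- (2 * a * (1 - x * a)) + 2 * b * (x * b)).
    rewrite /q; apply: is_derive_eq; rewrite /GRing.scale/=; ring.
  have dl : is_derive x 1 (fun x => ln (q x))
      ((q x)^-1 * (- (2 * a * (1 - x * a)) + 2 * b * (x * b))).
    by have := is_derive1_ln qx; move=> h; apply: is_derive1_comp.
  have ds := is_derive_sumX (fun i => Re (v ^+ i.+1)) K x.
  apply: is_derive_eq; rewrite /df Re_add Re_sum.
  congr (_ + _); last first.
    by apply: eq_bigr => i _; rewrite Re_mul/= mulr0 subr0.
  rewrite /GRing.scale/= Re_opp Re_mul.
  have -> : v = (a +i* b)%C by rewrite /a /b; case: (v).
  rewrite /=; move: qx; rewrite /q => qx.
  have e1 : 1 - (x * a - 0 * b) = 1 - x * a by ring.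
  have e2 : 0 - (x * b + 0 * a) = - (x * b) by ring.
  rewrite e1 e2 sqrrN.
  by field; rewrite gt_eqF.
have := mvt_unit_bound fd (M := cmod v ^+ K.+1 / (1 - cmod v)).
have -> : f 1 - f 0 = ln (cmod (1 - v)) + \sum_(i < K) Re (v ^+ i.+1) / i.+1%:R.
  have [_ q1] : 0 < 1 - 1 * a /\ 0 < q 1 by apply: one_sub_sqr_gt0; rewrite ?ler01 ?lexx.
  have -> : f 0 = 0.
    rewrite /f /q !mul0r subr0 expr1n expr0n addr0 ln1 mulr0 add0r big1// => i _.
    by rewrite expr0n mulr0.
  rewrite subr0 /f; congr (_ + _).
    have -> : q 1 = cmod (1 - v) ^+ 2.
      rewrite sqr_cmod /q /a /b; case: (v) => c d /=; ring.
    have c0 : 0 < cmod (1 - v).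
      rewrite cmod_gt0; apply: contraTneq v1 => /subr0_eq <-.
      by rewrite cmod1 ltxx.
    by rewrite lnXn//; field.
  by apply: eq_bigr => i _; rewrite expr1n mulr1.
apply => x x01.
by rewrite (le_trans (Re_le_cmod _))// log_series_remainder.
Qed.

Lemma parg_series (v : R[i]) (K : nat) : cmod v < 1 ->
  `|parg (1 - v) + \sum_(i < K) Im (v ^+ i.+1) / i.+1%:R|
    <= cmod v ^+ K.+1 / (1 - cmod v).
Proof.
move=> v1; set a := Re v; set b := Im v.
have ab1 : a ^+ 2 + b ^+ 2 < 1.
  by rewrite -sqr_cmod -(expr1n _ 2) ltr_pXn2r ?nnegrE ?cmod_ge0.
pose q (x : R) : R := - (x * b) / (1 - x * a).
pose f x := atan (q x) + \sum_(i < K) Im (v ^+ i.+1) / i.+1%:R * x ^+ i.+1.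
pose df x := Im (- (v / (1 - x%:C%C * v)) +
                 \sum_(i < K) v ^+ i.+1 * (x ^+ i)%:C%C).
have fd (x : R) : 0 <= x <= 1 -> is_derive x 1 f (df x).
  move=> x01; have [xa qx] := one_sub_sqr_gt0 ab1 x01.
  have xa0 : 1 - x * a != 0 by rewrite gt_eqF.
  have di : is_derive x 1 (fun x => (1 - x * a)^-1)
      (- (1 - x * a) ^- 2 * (- a)).
    have h : is_derive x 1 (fun x : R => 1 - x * a) (- a).
      by apply: is_derive_eq; rewrite /GRing.scale/=; ring.
    exact: (@is_deriveV R (fun x : R => 1 - x * a) x _ 1 xa0 h).
  have dq : is_derive x 1 q (- b * (1 - x * a) ^- 2).
    rewrite /q; apply: is_derive_eq; rewrite /GRing.scale/=; field.
    exact: xa0.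
  have dl : is_derive x 1 (fun x => atan (q x))
      ((1 + q x ^+ 2)^-1 * (- b * (1 - x * a) ^- 2)).
    exact: is_derive1_comp.
  have ds := is_derive_sumX (fun i => Im (v ^+ i.+1)) K x.
  apply: is_derive_eq; rewrite /df Im_add Im_sum.
  congr (_ + _); last first.
    by apply: eq_bigr => i _; rewrite Im_mul/= mulr0 add0r.
  rewrite Im_opp Im_mul.
  have -> : v = (a +i* b)%C by rewrite /a /b; case: (v).
  rewrite /=; rewrite /q.
  have e1 : 1 - (x * a - 0 * b) = 1 - x * a by ring.
  have e2 : 0 - (x * b + 0 * a) = - (x * b) by ring.
  rewrite e1 e2 sqrrN.
  by field; apply/andP; split; [exact: lt0r_neq0 qx | exact: xa0].
have := mvt_unit_bound fd (M := cmod v ^+ K.+1 / (1 - cmod v)).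
have -> : f 1 - f 0 = parg (1 - v) + \sum_(i < K) Im (v ^+ i.+1) / i.+1%:R.
  have -> : f 0 = 0.
    rewrite /f /q !mul0r oppr0 mul0r atan0 add0r big1// => i _.
    by rewrite expr0n mulr0.
  rewrite subr0 /f; congr (_ + _).
    by rewrite /parg /q /a /b; case: (v) => c d /=; rewrite !mul1r sub0r.
  by apply: eq_bigr => i _; rewrite expr1n mulr1.
apply => x x01.
by rewrite (le_trans (Im_le_cmod _))// log_series_remainder.
Qed.

End LogSeries.

(** * Power sums of the zeros of a function bounded on the unit circle *)

Section RootsOfUnity.
Variable R : realType.
Local Notation C := R[i].

(** A root of [1 + 'X + ... + 'X^(N-1)] is a primitive [N]-th root of unity
    because [N] is prime. *)
Lemma exists_prime_root_of_unity (M : nat) :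
  exists N : nat, exists w : C, [/\ (M < N)%N & N.-primitive_root w].
Proof.
have [N MN Np] := prime_above M.
have N1 := prime_gt1 Np.
pose p : {poly C} := \poly_(i < N) 1.
have sp : size p = N.
  by rewrite size_poly_eq//= oner_eq0.
have [w rw] : exists w, root p w.
  by apply/closed_rootP; rewrite sp neq_ltn N1 orbT.
have hw : \sum_(i < N) w ^+ i = 0.
  move/rootP: rw; rewrite horner_poly => {2}<-.
  by apply: eq_bigr => i _; rewrite mul1r.
have wN : w ^+ N = 1.
  by apply/eqP; rewrite -subr_eq0 subrX1 hw mulr0.
have [m wm mN] := prim_order_exists (prime_gt0 Np) wN.
have [m1|m1] := eqVneq m 1%N.
  move: wm; rewrite m1 => /prim_expr_order; rewrite expr1 => w1.
  have : \sum_(i < N) w ^+ i = N%:R.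
    rewrite w1 (eq_bigr (fun=> 1)) ?sumr_const ?card_ord// => i _.
    by rewrite expr1n.
  by rewrite hw => /esym/eqP; rewrite pnatr_eq0 -leqn0 leqNgt prime_gt0.
exists N, w; split=> //.
by move/(prime_nt_dvdP Np m1): mN => <-.
Qed.

Lemma sum_prim_root (N : nat) (w : C) (e : nat) : N.-primitive_root w ->
  \sum_(l < N) w ^+ (e * l) = if (N %| e)%N then N%:R else 0.
Proof.
move=> pw; case: ifPn => [/dvdnP[q ->]|ne].
  rewrite (eq_bigr (fun=> 1)) ?sumr_const ?card_ord// => i _.
  by rewrite -mulnA mulnCA exprM (prim_expr_order pw) expr1n.
have we : w ^+ e - 1 != 0.
  by rewrite subr_eq0 -(prim_order_dvd pw).
apply: (mulfI we); rewrite mulr0.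
under eq_bigr do rewrite exprM.
by rewrite -subrX1 exprAC (prim_expr_order pw) expr1n subrr.
Qed.

Lemma cmod_prim_root (N : nat) (w : C) : N.-primitive_root w -> cmod w = 1.
Proof.
move=> pw; have N0 := prim_order_gt0 pw.
have /(congr1 (@cmod R)) := prim_expr_order pw.
rewrite cmodX cmod1 => /eqP; rewrite pexpr_eq1// ?cmod_ge0//.
by move=> /eqP.
Qed.

Lemma conj_prim_root (N : nat) (w : C) : N.-primitive_root w ->
  conjc w = w ^+ N.-1.
Proof.
move=> pw; have N0 := prim_order_gt0 pw; have w1 := cmod_prim_root pw.
have w0 : w != 0 by rewrite -cmod_gt0 w1.
apply: (mulfI w0); rewrite -exprS prednK// prim_expr_order//.
case: (w) w1 => a b /(congr1 (fun x => x ^+ 2)).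
rewrite sqr_cmod/= expr1n => ab; apply/eqP; rewrite eq_complex/=.
by apply/andP; split; apply/eqP; [rewrite -ab|]; ring.
Qed.

Lemma Re_mul_Re (x y : C) :
  complex.Re x * complex.Re y =
  (complex.Re (x * y) + complex.Re (x * conjc y)) / 2.
Proof. by case: x => a b; case: y => c d /=; field. Qed.

(** The average of [Re (a w ^ k) * log |1 - u w|] over the [N]-th roots of
    unity: only the [k]-th term of the logarithmic series survives, the others
    below the [N - k]-th being orthogonal to [w ^ k]. *)
Lemma mean_ln_cmod (N k : nat) (w u a : C) :
    N.-primitive_root w -> (2 * k < N)%N -> cmod u < 1 ->
  `| \sum_(l < N) complex.Re (a * w ^+ (k * l)) * ln (cmod (1 - u * w ^+ l))
     + N%:R * complex.Re (a * conjc u ^+ k) / (2 * k%:R) |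
  <= N%:R * (cmod a * (cmod u ^+ (N - k) / (1 - cmod u))).
Proof.
move=> pw kN u1; set K := (N - k).-1.
have w1 := cmod_prim_root pw.
have KE : K.+1 = (N - k)%N by rewrite prednK// subn_gt0; lia.
pose T (l : 'I_N) :=
  \sum_(i < K) complex.Re ((u * w ^+ l) ^+ i.+1) / i.+1%:R.
have TE : \sum_(l < N) complex.Re (a * w ^+ (k * l)) * T l =
    N%:R * complex.Re (a * conjc u ^+ k) / (2 * k%:R).
  under eq_bigr do rewrite big_distrr/=.
  rewrite exchange_big/=.
  transitivity (\sum_(i < K) (if i.+1 == k then
      N%:R * complex.Re (a * conjc u ^+ k) / (2 * k%:R) else 0)).
    apply: eq_bigr => i _.
    transitivity (\sum_(l < N) (complex.Re (a * u ^+ i.+1 * w ^+ ((k + i.+1) * l))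
       + complex.Re (a * conjc u ^+ i.+1 * w ^+ ((k + N.-1 * i.+1) * l)))
       * (2 * i.+1%:R)^-1).
      apply: eq_bigr => l _; rewrite mulrA Re_mul_Re -mulrA -invfM.
      congr ((complex.Re _ + complex.Re _) * _).
        by rewrite mulnDl exprD exprMn -exprM [(l * _)%N]mulnC; ring.
      rewrite rmorphXn rmorphM/= rmorphXn/= (conj_prim_root pw) exprMn.
      rewrite mulnDl exprD -!exprM -[(N.-1 * i.+1 * l)%N]mulnA [(i.+1 * l)%N]mulnC; ring.
    rewrite -mulr_suml big_split/= -!Re_sum -!mulr_sumr.
    rewrite !(sum_prim_root _ pw).
    have iK : (i.+1 <= K)%N by [].
    have -> : (N %| k + i.+1)%N = false.
      by apply/negbTE; rewrite gtnNdvd//; lia.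
    rewrite mulr0 /= add0r.
    have -> : (N %| k + N.-1 * i.+1)%N = (i.+1 == k).
      have N0 : (0 < N)%N by lia.
      have -> : (k + N.-1 * i.+1 = k + (N * i.+1 - i.+1))%N.
        by rewrite -{2}(prednK N0) mulSn addKn.
      have [->|ik] := eqVneq i.+1 k.
        by rewrite subnKC ?dvdn_mulr// leq_pmull.
      apply/negbTE; apply/negP => /dvdnP[q hq].
      have h2 : (k + N * i.+1 = q * N + i.+1)%N.
        have : (i.+1 <= N * i.+1)%N by rewrite leq_pmull.
        lia.
      have /(congr1 (modn^~ N)) := h2.
      rewrite mulnC modnMDl addnC modnMDl !modn_small; lia.
    case: eqP => [->|_]; last by rewrite mulr0 mul0r.
    have -> : (N%:R : C) = (N%:R : R)%:C%C by rewrite rmorph_nat.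
    by rewrite Re_mul/= mulr0 subr0 [complex.Re _ * _]mulrC.
  case: k kN @K KE T => [|k] kN K KE T.
    by rewrite mulr0 invr0 mulr0 big1.
  have kK : (k < K)%N by lia.
  rewrite (bigD1 (Ordinal kK))//= eqxx big1 ?addr0// => i ik.
  case: eqP => // -[ik']; move: ik.
  by rewrite -val_eqE/= ik' eqxx.
rewrite -TE -big_split/= (le_trans (ler_norm_sum _ _ _))//.
have -> : N%:R * (cmod a * (cmod u ^+ (N - k) / (1 - cmod u))) =
    \sum_(l < N) (cmod a * (cmod u ^+ (N - k) / (1 - cmod u))).
  by rewrite sumr_const card_ord mulr_natl.
apply: ler_sum => l _; rewrite -mulrDr normrM.
have wl1 : cmod (w ^+ l) = 1 by rewrite cmodX w1 expr1n.
apply: ler_pM => //.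
  by rewrite (le_trans (Re_le_cmod _))// cmodM cmodX w1 expr1n mulr1.
have ul : cmod (u * w ^+ l) = cmod u by rewrite cmodM wl1 mulr1.
have := @ln_cmod_series R (u * w ^+ l) K; rewrite ul KE; exact.
Qed.

End RootsOfUnity.

Section PowerSums.
Variable R : realType.
Local Notation C := R[i].

Lemma uniform_lt1 (s : seq (R * C)) :
  (forall p, p \in s -> cmod p.2 < 1) ->
  exists q : R, [/\ 0 <= q, q < 1 & forall p, p \in s -> cmod p.2 <= q].
Proof.
elim: s => [|p s ih] h; first by exists 0; split.
have [|q [q0 q1 hq]] := ih.
  by move=> x xs; apply: h; rewrite inE xs orbT.
exists (Num.max q (cmod p.2)); split.
- by rewrite le_max q0.
- by rewrite gt_max q1 h// inE eqxx.
- move=> x; rewrite inE => /predU1P[->|/hq xq].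
    by rewrite le_max lexx orbT.
  by rewrite le_max xq.
Qed.

Lemma expr_small (q e : R) : 0 <= q -> q < 1 -> 0 < e ->
  exists M : nat, forall n, (M <= n)%N -> q ^+ n <= e.
Proof.
move=> q0 q1 e0.
have /cvgrPdist_le/(_ e e0)[M _ hM] : (fun n => q ^+ n) @ \oo --> (0 : R).
  by apply: cvg_expr; rewrite ger0_norm.
exists M => n Mn; have := hM n Mn.
by rewrite sub0r normrN ger0_norm// exprn_ge0.
Qed.

(** Averaging the nonnegative function [Lam - g] against the nonnegative
    kernel [1 + Re (a w ^ k)], [|a| <= 1], gives
    [Lam + Re (a * conj p_k) / (2 k) >= 0], [p_k] being the [k]-th power
    sum. *)
Lemma power_sum_bound (s : seq (R * C)) (Lam : R) :
    (forall p, p \in s -> cmod p.2 < 1) ->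
    (forall z, cmod z = 1 ->
       \sum_(p <- s) p.1 * ln (cmod (1 - p.2 * z)) <= Lam) ->
  0 <= Lam /\ forall k, (0 < k)%N ->
    cmod (\sum_(p <- s) p.1%:C%C * p.2 ^+ k) <= 2 * k%:R * Lam.
Proof.
move=> s1 bnd.
have [q [q0 q1 sq]] := uniform_lt1 s1.
pose S (k : nat) := \sum_(p <- s) p.1%:C%C * p.2 ^+ k.
have main k (a : C) : (0 < k)%N -> cmod a <= 1 ->
    0 <= Lam + complex.Re (a * conjc (S k)) / (2 * k%:R).
  move=> k0 a1; apply/ler_addgt0Pr => e e0.
  pose W := 2 * \sum_(p <- s) `|p.1| / (1 - q).
  have W0 : 0 <= W.
    rewrite mulr_ge0// sumr_ge0// => p _.
    by rewrite divr_ge0// subr_ge0 ltW.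
  have [M hM] := @expr_small q (e / (W + 1)) q0 q1 (divr_gt0 e0 (ltr_pwDr ltr01 W0)).
  have [N [w [MN pw]]] := exists_prime_root_of_unity R (M + 2 * k + 2).
  have w1 := cmod_prim_root pw.
  have kN : (k < N)%N by clear - MN; lia.
  have jN j : (j <= k)%N -> (2 * j < N)%N by clear - MN; lia.
  have MNj j : (j <= k)%N -> (M <= N - j)%N /\ (0 < N - j)%N by clear - MN; lia.
  have wl1 l : cmod (w ^+ l) = 1 by rewrite cmodX w1 expr1n.
  pose g z := \sum_(p <- s) p.1 * ln (cmod (1 - p.2 * z)).
  have N0 : 0 < N%:R :> R by rewrite ltr0n (leq_ltn_trans _ kN).
  have pos : 0 <= \sum_(l < N)
      (1 + complex.Re (a * w ^+ (k * l))) * (Lam - g (w ^+ l)).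
    apply: sumr_ge0 => l _; apply: mulr_ge0; last by rewrite subr_ge0 bnd.
    rewrite -lerBlDl sub0r.
    have := Re_le_cmod (a * w ^+ (k * l)).
    rewrite cmodM wl1 mulr1 => /le_trans/(_ a1).
    by rewrite ler_norml => /andP[].
  have mean j b : (j <= k)%N -> cmod b <= 1 ->
    - (\sum_(l < N) complex.Re (b * w ^+ (j * l)) * g (w ^+ l)) <=
      N%:R * (complex.Re (b * conjc (S j)) / (2 * j%:R) + e / 2).
    move=> jk b1.
    have -> : \sum_(l < N) complex.Re (b * w ^+ (j * l)) * g (w ^+ l) =
        \sum_(p <- s) p.1 * \sum_(l < N) complex.Re (b * w ^+ (j * l)) *
           ln (cmod (1 - p.2 * w ^+ l)).
      under eq_bigr do rewrite big_distrr/=.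
      rewrite exchange_big/=; apply: eq_bigr => p _.
      by rewrite big_distrr/=; apply: eq_bigr => l _; rewrite mulrCA.
    have -> : complex.Re (b * conjc (S j)) =
        \sum_(p <- s) p.1 * complex.Re (b * conjc p.2 ^+ j).
      rewrite /S rmorph_sum big_distrr/= Re_sum; apply: eq_bigr => p _.
      by rewrite rmorphM rmorphXn/= oppr0 mulrCA Re_mul/= mul0r subr0.
    have : `|\sum_(p <- s) p.1 * (\sum_(l < N) complex.Re (b * w ^+ (j * l)) *
           ln (cmod (1 - p.2 * w ^+ l)) +
           N%:R * complex.Re (b * conjc p.2 ^+ j) / (2 * j%:R))| <=
         N%:R * (e / 2).
      rewrite (le_trans (ler_norm_sum _ _ _))//.
      apply: (@le_trans _ _ (\sum_(p <- s) N%:R * (`|p.1| / (1 - q) * (e / (W + 1))))).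
        rewrite big_seq [leRHS]big_seq; apply: ler_sum => p ps.
        rewrite normrM; have d1 : 0 < 1 - cmod p.2 by rewrite subr_gt0 s1.
        have [Mj j0] := MNj _ jk.
        have := @mean_ln_cmod R N j w p.2 b pw (jN _ jk) (s1 _ ps).
        move=> /(ler_wpM2l (normr_ge0 p.1)) /le_trans; apply.
        rewrite mulrCA ler_pM2l// -[leRHS]mulrA ler_wpM2l//.
        rewrite -[leRHS]mul1r ler_pM ?cmod_ge0//.
          by rewrite divr_ge0 ?exprn_ge0 ?cmod_ge0// subr_ge0 ltW// s1.
        rewrite mulrC ler_pM ?invr_ge0 ?exprn_ge0 ?cmod_ge0//.
        - by rewrite ltW.
        - have dq : 0 < 1 - q by rewrite subr_gt0.
          by rewrite lef_pV2 ?posrE// lerD2l lerN2 sq.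
        - apply: (@le_trans _ _ (q ^+ (N - j))); last exact: hM.
          by rewrite ler_pXn2r ?nnegrE ?cmod_ge0 ?sq.
      rewrite -big_distrr/= ler_pM2l// -big_distrl/=.
      have -> : \sum_(p <- s) `|p.1| / (1 - q) = W / 2 by rewrite /W; field.
      have -> : W / 2 * (e / (W + 1)) = e / 2 * (W / (W + 1)).
        by field; rewrite gt_eqF// ltr_pwDr.
      rewrite ler_piMr ?divr_ge0 ?(ltW e0)// ler_pdivrMr ?ltr_pwDr//.
      by rewrite mul1r lerDl.
    rewrite ler_norml => /andP[h _]; move: h.
    under eq_bigr do rewrite mulrDr.
    rewrite big_split/= -lerBlDr => h.
    rewrite lerNl (le_trans _ h)// mulrDr opprD addrC lerD2l lerN2.
    rewrite mulr_suml mulr_sumr le_eqVlt; apply/orP; left; apply/eqP.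
    by apply: eq_bigr => p _; rewrite !mulrA [p.1 * _]mulrC.
  have m0 := @mean 0%N 1 (leq0n _); rewrite cmod1 lexx in m0.
  have {}m0 := m0 isT.
  have m1 := @mean k a (leqnn _) a1.
  have E : \sum_(l < N) (1 + complex.Re (a * w ^+ (k * l))) * (Lam - g (w ^+ l))
      = N%:R * Lam - \sum_(l < N) complex.Re (1 * w ^+ (0 * l)) * g (w ^+ l)
        - \sum_(l < N) complex.Re (a * w ^+ (k * l)) * g (w ^+ l).
    have z : \sum_(l < N) complex.Re (a * w ^+ (k * l)) = 0.
      rewrite -Re_sum -big_distrr/= sum_prim_root// gtnNdvd//.
      by rewrite mulr0.
    have -> : N%:R * Lam = \sum_(l < N) Lam +
         \sum_(l < N) complex.Re (a * w ^+ (k * l)) * Lam.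
      by rewrite -mulr_suml z mul0r addr0 sumr_const card_ord mulr_natl.
    rewrite -!sumrN -!big_split/=; apply: eq_bigr => l _.
    by ring.
  rewrite E in pos.
  rewrite mulr0 invr0 mulr0 add0r in m0.
  have : 0 <= N%:R * (Lam + complex.Re (a * conjc (S k)) / (2 * k%:R) + e).
    rewrite (le_trans pos)//.
    have -> : N%:R * (Lam + complex.Re (a * conjc (S k)) / (2 * k%:R) + e) =
      N%:R * Lam + N%:R * (e / 2) +
      N%:R * (complex.Re (a * conjc (S k)) / (2 * k%:R) + e / 2).
      by rewrite -!mulrDr; congr (_ * _); field; rewrite pnatr_eq0 -lt0n.
    by rewrite lerD// lerD.
  by rewrite pmulr_rge0.
split.
  by have := @main 1%N 0 isT; rewrite cmod0 mul0r/= mul0r addr0; apply.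
move=> k k0; rewrite -/(S k).
have [->|Sk] := eqVneq (S k) 0.
  rewrite cmod0 !mulr_ge0//.
  by have := @main 1%N 0 isT; rewrite cmod0 mul0r/= mul0r addr0; apply.
have c0 : 0 < cmod (S k) by rewrite cmod_gt0.
have := @main k (- (S k / (cmod (S k))%:C%C)) k0.
rewrite cmodN cmodM cmodV cmod_real ger0_norm ?cmod_ge0// divff ?gt_eqF// lexx.
move/(_ isT).
have -> : - (S k / (cmod (S k))%:C%C) * conjc (S k) = (- cmod (S k))%:C%C.
  rewrite rmorphN/= mulNr; congr (- _).
  apply: (@mulIf _ (cmod (S k))%:C%C).
    by rewrite -cmod_gt0 cmod_real ger0_norm// ltW.
  rewrite mulrAC divfK; last by rewrite -cmod_gt0 cmod_real ger0_norm// ltW.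
  rewrite -rmorphM/= -expr2 sqr_cmod; case: (S k) => x y /=.
  by apply/eqP; rewrite eq_complex/=; apply/andP; split; apply/eqP; ring.
rewrite /= mulNr subr_ge0 ler_pdivrMr ?mulr_gt0 ?ltr0n//.
by rewrite mulrC.
Qed.

End PowerSums.

(** * Reflecting the zeros of a function bounded on the unit disc *)

Section Reflection.
Variable R : realType.
Local Notation C := R[i].

Definition reflect_out (u : C) : C := if cmod u <= 1 then u else (conjc u)^-1.

Lemma ln_prod_seq (I : eqType) (s : seq I) (F : I -> R) :
  (forall i, i \in s -> 0 < F i) ->
  ln (\prod_(i <- s) F i) = \sum_(i <- s) ln (F i).
Proof.
elim: s => [|i s ih] h; first by rewrite !big_nil ln1.
rewrite !big_cons lnM ?posrE ?ih//.
- by move=> j js; apply: h; rewrite inE js orbT.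
- by apply: h; rewrite inE eqxx.
- rewrite big_seq prodr_gt0// => j js.
  by apply: h; rewrite inE js orbT.
Qed.

Lemma left_limit_ge (h : R -> R) (c r0 : R) : {for 1, continuous h} ->
  r0 < 1 -> (forall r, r0 < r -> r < 1 -> c <= h r) -> c <= h 1.
Proof.
move=> hc r01 H.
have h1 : h r @[r --> 1^'-] --> h 1 by apply: cvg_at_left_filter.
rewrite -(cvg_lim _ h1)//; apply: limr_ge; first by apply/cvg_ex; exists (h 1).
near=> r; apply: H; near: r; [exact: nbhs_left_gt|exact: nbhs_left_lt].
Unshelve. all: by end_near. Qed.

(** On [|z| = 1] a factor [1 - v z] with [|v| > 1] has the modulus of
    [|v| (1 - z / conj v)]: a zero inside the disc can be moved outside it. *)
Lemma cmod_reflect (v z : C) : cmod z = 1 -> v != 0 ->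
  cmod (1 - v * z) = cmod v * cmod (1 - (conjc v)^-1 * z).
Proof.
move=> z1 v0.
have z0 : z != 0 by rewrite -cmod_gt0 z1.
have zz : conjc z = z^-1.
  apply: (mulfI z0); rewrite divff//; case: (z) z1 => a b.
  move=> /(congr1 (fun x => x ^+ 2)); rewrite sqr_cmod/= expr1n => ab.
  by apply/eqP; rewrite eq_complex/=; apply/andP; split; apply/eqP;
    [rewrite -ab|]; ring.
have -> : cmod (1 - (conjc v)^-1 * z) = cmod (1 - v^-1 * z^-1).
  by rewrite -cmodJ rmorphB rmorph1 rmorphM fmorphV/= conjcK zz.
rewrite -cmodM mulrBr mulr1 mulrA divff// mul1r.
have -> : 1 - v * z = - z * (v - z^-1).
  by rewrite mulrBr !mulNr divff// opprK addrC mulrC.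
by rewrite cmodM cmodN z1 mul1r.
Qed.

(** The bound on [us], which may have zeros [u^-1] inside the disc, becomes on
    the circle of radius [r < 1] a bound on a function without zeros there,
    to which [power_sum_bound] applies; then [r] tends to [1]. What the
    reflection gains, [ln |u|] for each zero inside, is kept. *)
Theorem reflected_power_sum_bound (us : seq C) (kap : C) (m : nat) (Lam : R) :
    cmod kap < 1 ->
    (forall z, cmod z < 1 -> \prod_(u <- us) cmod (1 - u * z) <=
        expR Lam * cmod (1 - kap * z) ^+ m) ->
  let Lam' := Lam - \sum_(u <- us | 1 < cmod u) ln (cmod u) in
  0 <= Lam' /\ forall k, (0 < k)%N ->
    cmod (\sum_(u <- us) reflect_out u ^+ k - m%:R * kap ^+ k)
      <= 2 * k%:R * Lam'.
Proof.
move=> kap1 bnd Lam'.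
pose out (r : R) (u : C) : C :=
  if cmod u <= 1 then r%:C%C * u else (conjc (r%:C%C * u))^-1.
pose lst (r : R) : seq (R * C) := [seq (1, out r u) | u <- us] ++ [:: (- m%:R, r%:C%C * kap)].
pose nin := (\sum_(u <- us | 1 < cmod u) 1 : R).
have [r0 [r00 r01 hr0]] : exists r0 : R, [/\ 0 < r0, r0 < 1 &
    forall u, u \in us -> 1 < cmod u -> forall r, r0 < r -> 1 < r * cmod u].
  elim: (us) => [|u s [r [r0 r1 hr]]].
    by exists 2^-1; split => //; rewrite ?invf_lt1 ?ltr1n ?invr_gt0.
  exists (if 1 < cmod u then Num.max r (cmod u)^-1 else r).
  case: ifPn => u1; split=> //.
  - by rewrite lt_max r0.
  - by rewrite gt_max r1/= invf_lt1// (lt_trans ltr01).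
  - move=> x; rewrite inE => /predU1P[-> _|xs x1] t.
      rewrite gt_max => /andP[_]; rewrite -ltr_pdivrMr ?(lt_trans ltr01)//.
      by rewrite mul1r.
    by rewrite gt_max => /andP[rt _]; apply: hr.
  - move=> x; rewrite inE => /predU1P[-> /(negP u1)//|xs x1] t.
    exact: hr.
have main r : r0 < r -> r < 1 ->
    0 <= Lam' - nin * ln r /\ forall k, (0 < k)%N ->
    cmod (\sum_(u <- us) out r u ^+ k - m%:R * (r%:C%C * kap) ^+ k) <=
      2 * k%:R * (Lam' - nin * ln r).
  move=> rr0 r1; have rpos : 0 < r by rewrite (lt_trans r00).
  have rk1 : cmod (r%:C%C * kap) < 1.
    rewrite cmodM cmod_real gtr0_norm// (le_lt_trans _ kap1)//.
    by rewrite ler_piMl ?cmod_ge0// ltW.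
  have out1 u : u \in us -> cmod (out r u) < 1.
    move=> uus; rewrite /out; case: ifPn => [u1|].
      rewrite cmodM cmod_real gtr0_norm// (le_lt_trans _ r1)//.
      by rewrite ler_piMr// ltW.
    rewrite -ltNge => u1; rewrite cmodV cmodJ cmodM cmod_real gtr0_norm//.
    by rewrite invf_lt1 ?hr0// (lt_trans ltr01)// hr0.
  have sub1 (v z : C) : cmod z = 1 -> cmod v < 1 -> 0 < cmod (1 - v * z).
    move=> z1 v1; rewrite (lt_le_trans _ (cmodB_ge _ _))//.
    by rewrite cmod1 cmodM z1 mulr1 subr_gt0.
  have lst1 p : p \in lst r -> cmod p.2 < 1.
    rewrite mem_cat => /orP[/mapP[u uus ->]|]; first exact: out1.
    by rewrite inE => /eqP ->.
  have lstb z : cmod z = 1 ->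
      \sum_(p <- lst r) p.1 * ln (cmod (1 - p.2 * z)) <= Lam' - nin * ln r.
    move=> z1; rewrite big_cat/= big_map big_cons big_nil addr0/=.
    have rz1 : cmod (r%:C%C * z) < 1.
      by rewrite cmodM cmod_real gtr0_norm// z1 mulr1.
    have fac u : u \in us -> cmod (1 - u * (r%:C%C * z)) =
        cmod (1 - out r u * z) * (if 1 < cmod u then r * cmod u else 1).
      move=> uus; rewrite /out leNgt; case: (ltP 1 (cmod u)) => u1 /=; last first.
        by rewrite mulr1 mulrCA mulrA.
      have ru : r * cmod u = cmod (r%:C%C * u).
        by rewrite cmodM cmod_real gtr0_norm.
      rewrite mulrCA mulrA [LHS]cmod_reflect//; first by rewrite ru mulrC.
      by rewrite -cmod_gt0 -ru (lt_trans ltr01)// hr0.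
    have fac0 u : u \in us -> 0 < (if 1 < cmod u then r * cmod u else 1).
      by move=> uus; case: ifPn => // u1; rewrite (lt_trans ltr01)// hr0.
    have := bnd _ rz1.
    rewrite -ler_ln ?posrE; last 2 first.
      - rewrite big_seq prodr_gt0// => u uus; rewrite fac// mulr_gt0 ?fac0//.
        by rewrite sub1// out1.
      - rewrite mulr_gt0 ?expR_gt0// exprn_gt0//.
        by rewrite mulrCA mulrA sub1.
    rewrite ln_prod_seq; last first.
      move=> u uus; rewrite fac// mulr_gt0 ?fac0//.
      by rewrite sub1// out1.
    rewrite lnM ?posrE ?expR_gt0 ?exprn_gt0 ?(mulrCA kap) ?(mulrA r%:C%C) ?sub1//.
    rewrite expRK lnXn ?sub1//.
    have -> : \sum_(u <- us) ln (cmod (1 - u * (r%:C%C * z))) =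
        \sum_(u <- us) 1 * ln (cmod (1 - out r u * z)) +
        (\sum_(u <- us | 1 < cmod u) ln (cmod u) + nin * ln r).
      rewrite [X in _ + (_ + X)]mulr_suml -big_split/=.
      rewrite [X in _ + X]big_mkcond -big_split/= big_seq [RHS]big_seq.
      apply: eq_bigr => u uus; rewrite fac// mul1r.
      rewrite lnM ?posrE ?fac0 ?sub1 ?out1//; congr (_ + _).
      case: ifPn => u1; last by rewrite ln1.
      by rewrite lnM ?posrE ?(lt_trans ltr01 u1)// mul1r addrC.
    by rewrite /Lam' -mulr_natl mulNr; lra.
  have [h0 h1] := power_sum_bound lst1 lstb; split=> // k k0.
  have := h1 k k0; rewrite big_cat/= big_map big_cons big_nil addr0/=.
  rewrite rmorphN/= rmorph_nat mulNr.
  by under eq_bigr do rewrite mul1r.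
have lnc : {for 1, continuous (@ln R)} by apply: continuous_ln.
split.
  pose h (r : R) := Lam' - nin * ln r.
  have -> : Lam' = h 1 by rewrite /h ln1 mulr0 subr0.
  apply: (@left_limit_ge h _ r0) => //.
    apply: cvgB; first exact: cvg_cst.
    by apply: cvgM; [exact: cvg_cst|exact: lnc].
  by move=> r rr0 r1; have [] := main r rr0 r1.
move=> k k0.
pose A := \sum_(u <- us | cmod u <= 1) u ^+ k - m%:R * kap ^+ k.
pose B := \sum_(u <- us | ~~ (cmod u <= 1)) (conjc u)^-1 ^+ k.
pose h (r : R) := 2 * k%:R * (Lam' - nin * ln r) + (1 - r ^+ k) * cmod A +
  ((r ^+ k)^-1 - 1) * cmod B.
have -> : 2 * k%:R * Lam' = h 1.
  by rewrite /h ln1 mulr0 subr0 expr1n invr1 !subrr !mul0r !addr0.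
apply: (@left_limit_ge h _ r0) => //.
  have c1 : {for 1, continuous (fun r : R => r ^+ k)} by exact: exprn_continuous.
  apply: cvgD; first apply: cvgD.
  - apply: cvgM; first exact: cvg_cst.
    apply: cvgB; first exact: cvg_cst.
    by apply: cvgM; [exact: cvg_cst|exact: lnc].
  - apply: cvgM; last exact: cvg_cst.
    by apply: cvgB; [exact: cvg_cst|exact: c1].
  - apply: cvgM; last exact: cvg_cst.
    apply: cvgB; last exact: cvg_cst.
    by apply: cvgV; [rewrite expr1n oner_eq0|exact: c1].
move=> r rr0 r1; have rpos : 0 < r by rewrite (lt_trans r00).
have [_ /(_ k k0) hk] := main r rr0 r1.
have rk0 : 0 < r ^+ k by rewrite exprn_gt0.
have rk1 : r ^+ k <= 1 by rewrite exprn_ile1// ltW.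
have SE : \sum_(u <- us) reflect_out u ^+ k - m%:R * kap ^+ k = A + B.
  rewrite (bigID (fun u : C => cmod u <= 1))/= /A /B addrAC.
  congr (_ - _ + _).
    by apply: eq_bigr => u u1; rewrite /reflect_out u1.
  by apply: eq_bigr => u u1; rewrite /reflect_out (negbTE u1).
have TE : \sum_(u <- us) out r u ^+ k - m%:R * (r%:C%C * kap) ^+ k =
    (r ^+ k)%:C%C * A + ((r ^+ k)^-1)%:C%C * B.
  rewrite (bigID (fun u : C => cmod u <= 1))/= /A /B mulrBr.
  rewrite exprMn mulrCA -rmorphXn/= addrAC; congr (_ - _ + _).
    rewrite mulr_sumr; apply: eq_bigr => u u1.
    by rewrite /out u1 exprMn rmorphXn.
  rewrite mulr_sumr; apply: eq_bigr => u u1.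
  rewrite /out (negbTE u1) rmorphM/= oppr0 invfM exprMn; congr (_ * _).
  by rewrite -[(r +i* 0)%C]/(r%:C%C) -fmorphV -rmorphXn exprVn.
rewrite SE; rewrite TE in hk.
have -> : A + B = ((r ^+ k)%:C%C * A + ((r ^+ k)^-1)%:C%C * B)
   + (1 - r ^+ k)%:C%C * A - ((r ^+ k)^-1 - 1)%:C%C * B.
  by rewrite !rmorphB/= !rmorph1; ring.
rewrite (le_trans (cmodB_le _ _))// lerD//; last first.
  by rewrite cmodM cmod_real ger0_norm// subr_ge0 invf_ge1.
rewrite (le_trans (cmodD_le _ _))// lerD//.
by rewrite cmodM cmod_real ger0_norm// subr_ge0.
Qed.

End Reflection.

(** * Bounding the arguments of a function bounded on the unit disc *)

Section ArgumentBound.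
Variable R : realType.
Local Notation C := R[i].

Lemma cmod_reflect_out (u : C) : cmod (reflect_out u) <= 1.
Proof.
rewrite /reflect_out; case: ifPn => //; rewrite -ltNge => u1.
by rewrite cmodV cmodJ invf_le1 ?ltW// (lt_trans ltr01).
Qed.

Lemma geometric_sum_le (x : R) (n : nat) : 0 <= x -> x < 1 ->
  \sum_(i < n) x ^+ i <= (1 - x)^-1.
Proof.
move=> x0 x1; have d : 0 < 1 - x by rewrite subr_gt0.
rewrite -[leRHS]mul1r ler_pdivlMr// mulrC -opprB mulNr -subrX1 opprB.
by rewrite gerBl exprn_ge0.
Qed.

(** A Borel-Caratheodory estimate: the power series of the logarithm at [z]
    has coefficients controlled by [reflected_power_sum_bound], and is cut off
    at an order that makes the tail at most [e]. *)
Theorem reflected_parg_bound (us : seq C) (kap : C) (m : nat) (Lam : R) :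
    cmod kap < 1 ->
    (forall z, cmod z < 1 -> \prod_(u <- us) cmod (1 - u * z) <=
        expR Lam * cmod (1 - kap * z) ^+ m) ->
  let Lam' := Lam - \sum_(u <- us | 1 < cmod u) ln (cmod u) in
  forall z, cmod z < 1 ->
    `|\sum_(u <- us) parg (1 - reflect_out u * z) - m%:R * parg (1 - kap * z)|
      <= 2 * Lam' * (cmod z / (1 - cmod z)).
Proof.
move=> kap1 bnd Lam' z z1.
have [L0 Lk] := reflected_power_sum_bound kap1 bnd.
rewrite -/Lam' in L0 Lk; set r := cmod z in z1 *.
have r0 : 0 <= r := cmod_ge0 z.
have d0 : 0 < 1 - r by rewrite subr_gt0.
apply/ler_addgt0Pr => e e0.
set n := ((size us)%:R + m%:R : R).
have n0 : 0 <= n by rewrite addr_ge0.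
have e'0 : 0 < e * (1 - r) / (n + 1).
  by rewrite divr_gt0 ?mulr_gt0// ltr_wpDl.
have [K0 hK] := expr_small r0 z1 e'0.
have {hK} rK : n * (r ^+ K0.+1 / (1 - r)) <= e.
  have h := hK _ (leqnSn K0).
  apply: (@le_trans _ _ ((n + 1) * (e * (1 - r) / (n + 1) / (1 - r)))).
    apply: ler_pM => //; first by rewrite divr_ge0 ?exprn_ge0// ltW.
      by rewrite lerDl.
    by rewrite ler_pM2r// invr_gt0.
  by rewrite le_eqVlt; apply/orP; left; apply/eqP; field;
     rewrite !gt_eqF// ltr_wpDl.
have ser v : cmod v <= 1 ->
    `|parg (1 - v * z) +
      \sum_(i < K0) complex.Im ((v * z) ^+ i.+1) / i.+1%:R| <=
    r ^+ K0.+1 / (1 - r).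
  move=> v1; have vz : cmod (v * z) <= r by rewrite cmodM ler_piMl.
  have vz1 : cmod (v * z) < 1 by rewrite (le_lt_trans vz).
  rewrite (le_trans (parg_series K0 vz1))// ler_pM ?exprn_ge0 ?cmod_ge0//.
  - by rewrite invr_ge0 subr_ge0 ltW.
  - by rewrite ler_pXn2r ?nnegrE ?cmod_ge0.
  - by rewrite lef_pV2 ?posrE ?subr_gt0// lerD2l lerN2.
pose S k := \sum_(u <- us) reflect_out u ^+ k - m%:R * kap ^+ k.
pose T := \sum_(i < K0) complex.Im (S i.+1 * z ^+ i.+1) / i.+1%:R.
have TE : T = \sum_(u <- us)
     \sum_(i < K0) complex.Im ((reflect_out u * z) ^+ i.+1) / i.+1%:R
   - m%:R * \sum_(i < K0) complex.Im ((kap * z) ^+ i.+1) / i.+1%:R.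
  rewrite exchange_big/= mulr_sumr -sumrB; apply: eq_bigr => i _.
  rewrite /S mulrBl Im_add Im_opp mulr_suml Im_sum mulrBl mulr_suml.
  congr (_ - _); first by apply: eq_bigr => u _; rewrite exprMn.
  have -> : (m%:R : C) = (m%:R : R)%:C%C by rewrite rmorph_nat.
  by rewrite -mulrA -exprMn Im_mul/= mul0r addr0 mulrA.
have Tle : `|T| <= 2 * Lam' * (r / (1 - r)).
  apply: (@le_trans _ _ (\sum_(i < K0) 2 * Lam' * r ^+ i.+1)); last first.
    rewrite -mulr_sumr ler_wpM2l ?mulr_ge0//.
    under eq_bigr do rewrite exprS.
    by rewrite -mulr_sumr ler_wpM2l// geometric_sum_le.
  rewrite (le_trans (ler_norm_sum _ _ _))//; apply: ler_sum => i _.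
  rewrite normrM [X in _ * X]ger0_norm ?invr_ge0 ?ler0n// ler_pdivrMr ?ltr0n//.
  rewrite (le_trans (Im_le_cmod _))// cmodM cmodX -/r.
  have := Lk i.+1 isT; rewrite -/(S i.+1) => h.
  rewrite (le_trans (ler_wpM2r _ h)) ?exprn_ge0//.
  by rewrite le_eqVlt; apply/orP; left; apply/eqP; ring.
have -> : \sum_(u <- us) parg (1 - reflect_out u * z) -
    m%:R * parg (1 - kap * z) =
   (\sum_(u <- us) (parg (1 - reflect_out u * z) +
      \sum_(i < K0) complex.Im ((reflect_out u * z) ^+ i.+1) / i.+1%:R)
    - m%:R * (parg (1 - kap * z) +
      \sum_(i < K0) complex.Im ((kap * z) ^+ i.+1) / i.+1%:R)) - T.
  by rewrite TE big_split/=; ring.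
rewrite (le_trans (ler_normB _ _))// addrC lerD//.
apply: le_trans rK; rewrite (le_trans (ler_normB _ _))// mulrDl lerD//.
  rewrite (le_trans (ler_norm_sum _ _ _))//.
  apply: (@le_trans _ _ (\sum_(u <- us) r ^+ K0.+1 / (1 - r))).
    by apply: ler_sum => u _; apply: ser; exact: cmod_reflect_out.
  by rewrite big_const_seq count_predT iter_addr_0 mulr_natl.
rewrite normrM ger0_norm ?ler0n// ler_wpM2l ?ler0n// ser//.
exact: ltW.
Qed.

End ArgumentBound.

(** * Polar forms *)

Section Polar.
Variable R : realType.
Local Notation C := R[i].

Definition expi (a : R) : C := (cos a +i* sin a)%C.

(** An argument as a relation: no branch has to be fixed in products and
    inverses, and [polar_inj] compares the results at the end. *)
Definition polar (z : C) (a : R) : Prop :=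
  exists2 r : R, 0 < r & z = r%:C%C * expi a.

Lemma expiD a b : expi (a + b) = expi a * expi b.
Proof.
apply/eqP; rewrite eq_complex/= cosD sinD eqxx/=.
by apply/eqP; ring.
Qed.

Lemma expi0 : expi 0 = 1.
Proof. by rewrite /expi cos0 sin0. Qed.

Lemma polar_inj z a b : polar z a -> polar z b -> `|a - b| < 2 * pi -> a = b.
Proof.
move=> [r r0 ->] [s s0 /eqP]; rewrite eq_complex/= !mul0r !subr0 !addr0.
move=> /andP[/eqP hc /eqP hs] ab.
have rs : r = s.
  have h : r ^+ 2 = s ^+ 2.
    have := cos2Dsin2 a; have := cos2Dsin2 b => hb ha.
    by rewrite -[r ^+ 2]mulr1 -ha -[s ^+ 2]mulr1 -hb !mulrDr -!exprMn hc hs.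
  by apply/eqP; rewrite -(eqrXn2 (n := 2)) ?ltW// h.
have {}hc : cos a = cos b by apply: (mulfI (lt0r_neq0 r0)); rewrite hc rs.
have {}hs : sin a = sin b by apply: (mulfI (lt0r_neq0 r0)); rewrite hs rs.
have c1 : cos (a - b) = 1.
  by rewrite cosB hc hs -!expr2 cos2Dsin2.
apply/eqP; rewrite -subr_eq0; set x := a - b in ab c1 *.
wlog x0 : x ab c1 / 0 <= x.
  move=> h; have [x0|x0] := leP 0 x; first exact: h.
  have := h (- x); rewrite normrN cosN oppr_eq0 oppr_ge0 ltW//; exact.
move: ab; rewrite ger0_norm// => xpi.
have [xp|xp] := leP x pi.
  apply/eqP; apply: cos_inj; rewrite ?in_itv/= ?x0 ?xp ?lexx ?pi_ge0//.
  by rewrite c1 cos0.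
have : 2 * pi - x = 0.
  apply: cos_inj; rewrite ?in_itv/= ?lexx ?pi_ge0//.
    by apply/andP; split; lra.
  by rewrite cosB mulr_natl cos2pi sin2pi c1 cos0 mul0r addr0 mulr1.
lra.
Qed.

Lemma polar_parg z : 0 < complex.Re z -> polar z (parg z).
Proof.
case: z => x y /= x0; rewrite /parg/=.
set q := Num.sqrt (1 + (y / x) ^+ 2).
have q0 : 0 < q by rewrite sqrtr_gt0 ltr_pwDl ?sqr_ge0.
have ca : cos (atan (y / x)) = q^-1 by rewrite cos_atan.
have sa : sin (atan (y / x)) = y / x * q^-1.
  rewrite -ca -[X in _ = X * _](@atanK R) /tan mulfVK//.
  by rewrite ca invr_eq0 gt_eqF.
exists (x * q); first by rewrite mulr_gt0.
apply/eqP; rewrite eq_complex/= ca sa !mul0r subr0 addr0.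
by apply/andP; split; apply/eqP; field; rewrite !gt_eqF.
Qed.

Lemma polarM z w a b : polar z a -> polar w b -> polar (z * w) (a + b).
Proof.
move=> [r r0 ->] [s s0 ->]; exists (r * s); first by rewrite mulr_gt0.
by rewrite expiD rmorphM/=; ring.
Qed.

Lemma expiN a : expi (- a) = (expi a)^-1.
Proof.
have h : expi (- a) * expi a = 1 by rewrite -expiD addNr expi0.
have e0 : expi a != 0.
  by apply/eqP => e; move: h; rewrite e mulr0 => /esym/eqP; rewrite oner_eq0.
by apply: (mulIf e0); rewrite h mulVf.
Qed.

Lemma polarV z a : polar z a -> polar z^-1 (- a).
Proof.
move=> [r r0 ->]; exists r^-1; first by rewrite invr_gt0.
by rewrite expiN invfM fmorphV.
Qed.

Lemma polar_real (x : R) : 0 < x -> polar x%:C%C 0.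
Proof. by move=> x0; exists x => //; rewrite expi0 mulr1. Qed.

End Polar.

(** * Inequalities between arctangents *)

Section Arctan.
Variable R : realType.
Local Notation C := R[i].
Implicit Types x y D q n s : R.

Lemma pi_lt4 : pi < 4 :> R.
Proof. by have := pihalf_lt2 R; lra. Qed.

Lemma atan_sub_le x y : 0 <= y <= x -> atan x - atan y <= (x - y) / (1 + y ^+ 2).
Proof.
move=> /andP[y0]; rewrite le_eqVlt => /predU1P[->|yx].
  by rewrite !subrr mul0r.
have datan z : z \in `]y, x[ -> is_derive z 1 (@atan R) (1 + z ^+ 2)^-1.
  by move=> _; exact: is_derive1_atan.
have catan : {within `[y, x], continuous (@atan R)}.
  by apply: derivable_within_continuous => z _; exact: ex_derive.
have [c /[!in_itv]/= /andP[yc cx] ->] := MVT yx datan catan.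
rewrite mulrC ler_wpM2l ?subr_ge0 ?(ltW yx)// lef_pV2 ?posrE ?ltr_pwDl ?sqr_ge0//.
by rewrite lerD2l ler_pXn2r ?nnegrE ?(ltW yc)// (le_trans y0)// ltW.
Qed.

Lemma atan_le_id x : 0 <= x -> atan x <= x.
Proof.
move=> x0; have := @atan_sub_le x 0; rewrite lexx x0 atan0 !subr0 expr0n addr0.
by rewrite divr1; exact.
Qed.

Lemma atan_ge0 x : 0 <= x -> 0 <= atan x.
Proof. by move=> x0; rewrite -(atan0 R) le_atan. Qed.

Lemma atan_le0 x : x <= 0 -> atan x <= 0.
Proof. by move=> x0; rewrite -(atan0 R) le_atan. Qed.

Lemma atan_lt2 x : atan x < 2.
Proof. by rewrite (lt_trans (atan_ltpi2 _))// pihalf_lt2. Qed.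

Lemma polar_upper x y : 0 < y -> polar (x +i* y)%C (pi / 2 - atan (x / y)).
Proof.
move=> y0; have -> : (x +i* y)%C = (0 +i* 1)%C * (y -i* x)%C.
  by apply/eqP; rewrite eq_complex/=; apply/andP; split; apply/eqP; ring.
apply: polarM.
  by exists 1 => //; rewrite /expi cos_pihalf sin_pihalf mul1r.
have := @polar_parg R (y -i* x)%C y0.
by rewrite /parg/= mulNr atanN.
Qed.

Lemma atan_inv x y : 0 < x -> 0 < y -> atan (y / x) = pi / 2 - atan (x / y).
Proof.
move=> x0 y0; apply: (@polar_inj R (x +i* y)%C).
- exact: (@polar_parg R (x +i* y)%C).
- exact: polar_upper.
- have := atan_ltpi2 (x / y); have := atan_ltpi2 (y / x).
  have : 0 <= atan (x / y) by rewrite atan_ge0// divr_ge0// ltW.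
  have : 0 <= atan (y / x) by rewrite atan_ge0// divr_ge0// ltW.
  by move=> *; rewrite ltr_norml; apply/andP; split; lra.
Qed.

Lemma polar_Im_ge0 (z : C) a : polar z a -> 0 <= complex.Im z ->
  - pi < a -> 0 <= a.
Proof.
move=> [r r0 ->] /=; rewrite mul0r addr0 pmulr_rge0// => sa pa.
rewrite leNgt; apply/negP => a0.
by move: sa; rewrite leNgt -oppr_gt0 -sinN sin_gt0_pi// oppr_gt0 a0/= ltrNl.
Qed.

Lemma polar_Re_ge0 (z : C) a : polar z a -> 0 <= complex.Re z ->
  `|a| < pi + pi / 2 -> `|a| <= pi / 2.
Proof.
move=> [r r0 ->] /=; rewrite mul0r subr0 pmulr_rge0// => ca pa.
have {}ca : 0 <= cos `|a| by case: (ger0P a) => // _; rewrite cosN.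
rewrite leNgt; apply/negP => a0; move: ca.
rewrite leNgt -[X in cos X](subrK pi) cosDpi oppr_lt0 cos_gt0_pihalf//.
by apply/andP; split; lra.
Qed.

(** The quantity that the two sample points attach to a zero at
    imaginary height [n]; [q] is its horizontal distance to them. *)
Definition step_excess (D q n : R) : R :=
  pi / 2 - 2 * atan ((n + D) / q) + atan (n / q).

Lemma step_polar D q n : 0 < q ->
  polar (((q ^+ 2 - (n + D) ^+ 2) * q + 2 * q * (n + D) * n)
     +i* (2 * q ^+ 2 * (n + D) - (q ^+ 2 - (n + D) ^+ 2) * n))%C
    (2 * atan ((n + D) / q) - atan (n / q)).
Proof.
move=> q0.
have -> : (((q ^+ 2 - (n + D) ^+ 2) * q + 2 * q * (n + D) * n)
     +i* (2 * q ^+ 2 * (n + D) - (q ^+ 2 - (n + D) ^+ 2) * n))%C =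
   (q +i* (n + D))%C * (q +i* (n + D))%C * (q -i* n)%C.
  by apply/eqP; rewrite eq_complex/=; apply/andP; split; apply/eqP; ring.
have -> : 2 * atan ((n + D) / q) - atan (n / q) =
  parg (q +i* (n + D))%C + parg (q +i* (n + D))%C + parg (q -i* n)%C.
  by rewrite /parg/= mulNr atanN; ring.
by apply: polarM; [apply: polarM|]; exact: polar_parg.
Qed.

(** When [D <= q] the product of [step_polar] has a nonnegative real part, and
    its argument cannot have left [[- pi / 2, pi / 2]]. *)
Lemma step_excess_ge0 D q n : 0 < D -> D <= q -> 0 <= step_excess D q n.
Proof.
move=> D0 Dq; have q0 : 0 < q by rewrite (lt_le_trans D0).
have h1 := atan_gtNpi2 ((n + D) / q); have h2 := atan_ltpi2 ((n + D) / q).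
have h3 := atan_gtNpi2 (n / q); have h4 := atan_ltpi2 (n / q).
rewrite /step_excess; have [h|h] := leP (n + D) 0.
  have : atan ((n + D) / q) <= 0.
    by rewrite atan_le0// mulr_le0_ge0// invr_ge0 ltW.
  lra.
have a0 : 0 <= atan ((n + D) / q) by rewrite atan_ge0// divr_ge0 ?ltW.
have := polar_Re_ge0 (step_polar D n q0) => /=.
have -> : (q ^+ 2 - (n + D) ^+ 2) * q + 2 * q * (n + D) * n =
   q * (n ^+ 2 + (q ^+ 2 - D ^+ 2)) by ring.
have hq : 0 <= q ^+ 2 - D ^+ 2.
  by rewrite subr_ge0 ler_pXn2r ?nnegrE ?(ltW D0) ?(ltW q0).
have -> : 0 <= q * (n ^+ 2 + (q ^+ 2 - D ^+ 2)).
  by apply: mulr_ge0; [exact: ltW|apply: addr_ge0 => //; exact: sqr_ge0].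
move=> /(_ isT) H.
have {H} : `|2 * atan ((n + D) / q) - atan (n / q)| <= pi / 2.
  by apply: H; rewrite ltr_norml; apply/andP; split; lra.
by rewrite ler_norml => /andP[_]; lra.
Qed.

(** The loss [pi / 2 - atan (n / s)] of a reflected zero is paid by the excess
    and by a term that is comparable, at a distance from the pole, to the Green
    function of the half-plane. All arctangents together are the argument of
    one point [z] of the right half-plane, and [atan x <= x] reduces the claim
    to a polynomial inequality. *)
Lemma step_excess_far D q s n : 0 < D -> 0 < s -> 0 <= n -> D + s <= q ->
  pi / 2 - atan (n / s) <= step_excess D q n + 2 * D * s / (s ^+ 2 + n ^+ 2).
Proof.
move=> D0 s0 n0 Dsq; have q0 : 0 < q by rewrite (lt_le_trans _ Dsq)// addr_gt0.
set T := 2 * atan ((n + D) / q) - atan (n / q) - atan (n / s).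
set x := 2 * D * s / (s ^+ 2 + n ^+ 2).
suff : T <= x by rewrite /T /step_excess; lra.
pose Rr := q * (q ^+ 2 + n ^+ 2 - D ^+ 2).
pose M := q ^+ 2 * (n + 2 * D) + n * (n + D) ^+ 2.
have nD : 0 < n + D by rewrite ltr_wpDl.
have M0 : 0 < M by rewrite ltr_pwDl// ?mulr_gt0 ?exprn_gt0 ?mulr_ge0 ?sqr_ge0//; lra.
have Dq : D < q by lra.
have qD : 0 < q ^+ 2 - D ^+ 2.
  by rewrite subr_gt0 ltr_pXn2r ?nnegrE ?ltW.
have Rr0 : 0 < Rr.
  by rewrite mulr_gt0// addrAC ltr_pwDl ?sqr_ge0.
have den : 0 < Rr * s + M * n.
  by apply: ltr_pwDl; [exact: mulr_gt0|apply: mulr_ge0 => //; exact: ltW].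
have u2 : 0 < s ^+ 2 + n ^+ 2 by rewrite ltr_pwDl ?exprn_gt0 ?sqr_ge0.
pose z := ((Rr * s + M * n) +i* (M * s - Rr * n))%C.
have pz : polar z T.
  have -> : z = (((q ^+ 2 - (n + D) ^+ 2) * q + 2 * q * (n + D) * n)
     +i* (2 * q ^+ 2 * (n + D) - (q ^+ 2 - (n + D) ^+ 2) * n))%C * (s -i* n)%C.
    by apply/eqP; rewrite eq_complex/= /Rr /M; apply/andP; split; apply/eqP; ring.
  apply: polarM; first exact: step_polar.
  have := @polar_parg R (s -i* n)%C s0.
  by rewrite /parg/= mulNr atanN.
have -> : T = parg z.
  apply: polar_inj pz _ _; first exact: polar_parg.
  have := parg_lt z; rewrite ltr_norml => /andP[z1 z2].
  have h2 := atan_ltpi2 ((n + D) / q).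
  have h4 := atan_ltpi2 (n / q); have h6 := atan_ltpi2 (n / s).
  have a1 : 0 <= atan ((n + D) / q) by rewrite atan_ge0// divr_ge0// ltW.
  have a2 : 0 <= atan (n / q) by rewrite atan_ge0// divr_ge0// ltW.
  have a3 : 0 <= atan (n / s) by rewrite atan_ge0// divr_ge0// ltW.
  by rewrite /T ltr_norml; apply/andP; split; lra.
have x0 : 0 <= x by rewrite !mulr_ge0 ?invr_ge0 ?ltW//.
rewrite (le_trans _ (atan_le_id x0))// le_atan//=.
rewrite ler_pdivrMr// /x [leRHS]mulrAC ler_pdivlMr//.
rewrite -subr_ge0 /Rr /M.
have [t t0 ->] : exists2 t, 0 <= t & q = D + s + t.
  by exists (q - (D + s)); rewrite ?subr_ge0// addrC subrK.
have [{}D0 {}s0] := (ltW D0, ltW s0).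
(* With [t = q - (D + s)] all coefficients of the expansion are nonnegative. *)
rewrite [leRHS](_ : _ =
    n ^+ 3 * t ^+ 3 + n ^+ 5 * t + 2 * s * n ^+ 3 * t ^+ 2 +
    s ^+ 2 * n * t ^+ 3 + 2 * s ^+ 2 * n ^+ 3 * t + 2 * s ^+ 3 * n * t ^+ 2 +
    s ^+ 4 * n * t + 3 * D * n ^+ 3 * t ^+ 2 + D * n ^+ 5 +
    4 * D * s * n ^+ 3 * t + 2 * D * s ^+ 2 * t ^+ 3 +
    3 * D * s ^+ 2 * n * t ^+ 2 + 2 * D * s ^+ 2 * n ^+ 2 * t +
    2 * D * s ^+ 2 * n ^+ 3 + 4 * D * s ^+ 3 * t ^+ 2 +
    4 * D * s ^+ 3 * n * t + 2 * D * s ^+ 4 * t + D * s ^+ 4 * n +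
    2 * D ^+ 2 * n ^+ 3 * t + 4 * D ^+ 2 * s * n * t ^+ 2 +
    4 * D ^+ 2 * s * n ^+ 3 + 6 * D ^+ 2 * s ^+ 2 * t ^+ 2 +
    10 * D ^+ 2 * s ^+ 2 * n * t + 2 * D ^+ 2 * s ^+ 2 * n ^+ 2 +
    8 * D ^+ 2 * s ^+ 3 * t + 4 * D ^+ 2 * s ^+ 3 * n + 2 * D ^+ 2 * s ^+ 4 +
    8 * D ^+ 3 * s * n * t + 2 * D ^+ 3 * s * n ^+ 2 +
    4 * D ^+ 3 * s ^+ 2 * t + 8 * D ^+ 3 * s ^+ 2 * n + 2 * D ^+ 3 * s ^+ 3 +
    4 * D ^+ 4 * s * n); last by ring.
by rewrite !(addr_ge0, mulr_ge0, exprn_ge0).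
Qed.

End Arctan.

(** * The loss of a reflected zero *)

Section NearZeros.
Variable R : realType.
Implicit Types s n D : R.

Let b : R := 9 / 10.

(** Near the pole [b] of the Green function the penalty alone is large
    enough. *)
Lemma reflection_loss_near D s n : 7 / 4 <= D -> 0 < s -> 0 < n ->
    s ^+ 2 + n ^+ 2 < 2 * b ^+ 2 ->
  atan ((b + s) / n) - atan ((b - s) / n)
    <= 12 * D * s / ((b + s) ^+ 2 + n ^+ 2).
Proof.
move=> D74 s0 n0; rewrite /b => near.
have Ds : 7 / 4 * s <= D * s by rewrite ler_wpM2r// ltW.
have q0 : 0 < (9 / 10 + s) ^+ 2 + n ^+ 2 by rewrite ltr_pwDl ?exprn_gt0 ?sqr_ge0//; lra.
have qE : (9 / 10 + s) ^+ 2 + n ^+ 2 <= 243 / 100 + 9 / 5 * s.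
  have -> : (9 / 10 + s) ^+ 2 + n ^+ 2 =
    81 / 100 + 9 / 5 * s + (s ^+ 2 + n ^+ 2) by field.
  lra.
have h1 := atan_lt2 ((9 / 10 + s) / n).
have h2 : - 2 < atan ((9 / 10 - s) / n) by rewrite ltrNl -atanN atan_lt2.
have [sb|sb] := leP s (9 / 20).
  have y0 : 0 <= (9 / 10 - s) / n by rewrite divr_ge0 ?ltW//; lra.
  have yx : (9 / 10 - s) / n <= (9 / 10 + s) / n.
    by rewrite ler_pM2r ?invr_gt0//; lra.
  have := @atan_sub_le R ((9 / 10 + s) / n) ((9 / 10 - s) / n).
  rewrite y0 yx => /(_ isT) /le_trans; apply.
  have -> : ((9 / 10 + s) / n - (9 / 10 - s) / n) / (1 + ((9 / 10 - s) / n) ^+ 2)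
     = 2 * s * n / (n ^+ 2 + (9 / 10 - s) ^+ 2).
    by field; rewrite !gt_eqF//= ltr_pwDl ?mulr_gt0 ?exprn_gt0 ?sqr_ge0.
  apply: (@le_trans _ _ (s * (20 / 9))).
    rewrite ler_pdivrMr ?ltr_pwDl ?exprn_gt0 ?sqr_ge0//.
    have : 0 <= (n - (9 / 10 - s)) ^+ 2 by exact: sqr_ge0.
    move=> sq; rewrite -[2 * s * n]mulrA mulrCA -mulrA ler_pM2l//.
    nra.
  rewrite ler_pdivlMr//.
  have q4 : (9 / 10 + s) ^+ 2 + n ^+ 2 <= 4 by lra.
  have : s * ((9 / 10 + s) ^+ 2 + n ^+ 2) <= s * 4 by rewrite ler_pM2l.
  lra.
have [sb2|sb2] := leP s (9 / 10).
  have y0 : 0 <= atan ((9 / 10 - s) / n).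
    by rewrite atan_ge0// divr_ge0 ?(ltW n0)//; lra.
  apply: (@le_trans _ _ 2); first lra.
  by rewrite ler_pdivlMr//; lra.
apply: (@le_trans _ _ 4); first lra.
by rewrite ler_pdivlMr//; lra.
Qed.

(** An angle at most twice another one: the product that has their difference
    as its argument has imaginary part [2 * n * s * b ^+ 2 >= 0]. *)
Lemma reflection_loss_le s n : 0 < s -> 0 < n ->
  atan ((b + s) / n) - atan ((b - s) / n) <= 2 * (pi / 2 - atan (n / s)).
Proof.
move=> s0 n0; rewrite (@atan_inv R s n)// opprB addrCA subrr addr0.
have bE : b = 9 / 10 by [].
set A := atan (s / n); set B := atan ((b + s) / n); set B' := atan ((b - s) / n).
rewrite -subr_ge0.
apply: (@polar_Im_ge0 R
  ((n +i* s)%C * (n +i* s)%C * (n -i* (b + s))%C * (n +i* (b - s))%C)).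
- have -> : 2 * A - (B - B') = A + A + (- B) + B' by ring.
  apply: polarM; first apply: polarM; first apply: polarM.
  + by rewrite /A; exact: (@polar_parg R (n +i* s)%C).
  + by rewrite /A; exact: (@polar_parg R (n +i* s)%C).
  + rewrite /B -atanN -mulNr; exact: (@polar_parg R (n -i* (b + s))%C).
  + exact: (@polar_parg R (n +i* (b - s))%C).
- have -> : complex.Im ((n +i* s)%C * (n +i* s)%C * (n -i* (b + s))%C *
     (n +i* (b - s))%C) = 2 * n * s * b ^+ 2 by rewrite /=; ring.
  by rewrite !mulr_ge0 ?sqr_ge0 ?ltW.
- have A0 : 0 <= A by rewrite atan_ge0// divr_ge0// ltW.
  have : B < pi / 2 := atan_ltpi2 _.
  have : - (pi / 2) < B' := atan_gtNpi2 _.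
  lra.
Qed.

(** Moving a zero from the abscissa [s] to [- s] changes the sum of arguments
    by the left-hand side. Away from the pole one copy of
    [pi / 2 - atan (n / s)] is charged to each of the two excesses, that of the
    zero and that of its mirror image. *)
Lemma reflection_loss D s n : 7 / 4 <= D -> 0 < s -> 0 < n ->
  atan ((b + s) / n) - atan ((b - s) / n) <=
    step_excess D (D + s) n + step_excess D (D + s + 2 / 10) n
    + 12 * D * s / ((b + s) ^+ 2 + n ^+ 2).
Proof.
move=> D74 s0 n0; have D0 : 0 < D by lra.
have [near|far] := ltP (s ^+ 2 + n ^+ 2) (2 * b ^+ 2).
  have e1 : 0 <= step_excess D (D + s) n by apply: step_excess_ge0 => //; lra.
  have e2 : 0 <= step_excess D (D + s + 2 / 10) n.
    by apply: step_excess_ge0 => //; lra.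
  have := reflection_loss_near D74 s0 n0 near; lra.
have e1 := @step_excess_far R D (D + s) s n D0 s0 (ltW n0) (lexx _).
have e2 := @step_excess_far R D (D + s + 2 / 10) s n D0 s0 (ltW n0) ltac:(lra).
have h := reflection_loss_le s0 n0.
have u0 : 0 < s ^+ 2 + n ^+ 2 by rewrite ltr_pwDl ?exprn_gt0 ?sqr_ge0.
have : 2 * (2 * D * s / (s ^+ 2 + n ^+ 2)) <=
    12 * D * s / ((b + s) ^+ 2 + n ^+ 2).
  rewrite mulrA ler_pdivrMr// [leRHS]mulrAC ler_pdivlMr; last first.
    by rewrite ltr_pwDl ?exprn_gt0 ?sqr_ge0// /b; lra.
  have -> : 2 * (2 * D * s) = 4 * (D * s) by ring.
  have -> : 12 * D * s * (s ^+ 2 + n ^+ 2) = 4 * (D * s) * (3 * (s ^+ 2 + n ^+ 2)) by ring.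
  rewrite ler_pM2l ?mulr_gt0//.
  have : 0 <= (b - s) ^+ 2 by exact: sqr_ge0.
  nra.
lra.
Qed.

(** The limit of [reflection_loss] for [n] tending to [0] from above, where the
    two arctangents become [pi / 2] and [- pi / 2] as [b < s]. *)
Lemma reflection_loss_real D s : 7 / 4 <= D -> b < s ->
  pi <= step_excess D (D + s) 0 + step_excess D (D + s + 2 / 10) 0
    + 12 * D * s / ((b + s) ^+ 2 + 0 ^+ 2).
Proof.
move=> D74; rewrite /b => sb; have D0 : 0 < D by lra.
have s0 : 0 < s by lra.
have q0 : 0 < (9 / 10 + s) ^+ 2 by rewrite exprn_gt0//; lra.
rewrite expr0n/= addr0.
have [near|far] := ltP (s ^+ 2) (2 * (9 / 10) ^+ 2).
  have e1 : 0 <= step_excess D (D + s) 0 by apply: step_excess_ge0 => //; lra.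
  have e2 : 0 <= step_excess D (D + s + 2 / 10) 0.
    by apply: step_excess_ge0 => //; lra.
  have Ds : 7 / 4 * s <= D * s by rewrite ler_wpM2r// ltW.
  have : 4 <= 12 * D * s / (9 / 10 + s) ^+ 2 by rewrite ler_pdivlMr//; nra.
  have := pi_lt4 R; lra.
have e1 := @step_excess_far R D (D + s) s 0 D0 s0 (lexx _) (lexx _).
have e2 := @step_excess_far R D (D + s + 2 / 10) s 0 D0 s0 (lexx _) ltac:(lra).
rewrite mul0r atan0 expr0n/= addr0 in e1 e2.
have : 2 * (2 * D * s / s ^+ 2) <= 12 * D * s / (9 / 10 + s) ^+ 2.
  rewrite mulrA ler_pdivrMr ?exprn_gt0// [leRHS]mulrAC ler_pdivlMr//.
  have -> : 2 * (2 * D * s) = 4 * (D * s) by ring.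
  have -> : 12 * D * s * s ^+ 2 = 4 * (D * s) * (3 * s ^+ 2) by ring.
  rewrite ler_pM2l ?mulr_gt0//; nra.
lra.
Qed.

End NearZeros.

(** * The contribution of one zero *)

Section Contribution.
Variable R : realType.
Local Notation C := R[i].
Local Notation Re := complex.Re.
Local Notation Im := complex.Im.
Implicit Types (u w Y : C) (D s n y : R).

(* The disc of radius [b = 1 - k] internally tangent to the unit circle at [1]
   replaces the unit disc; a smaller [k] makes [b] larger and the constants
   better, and [1 / 10] is small enough. *)
Let k : R := 1 / 10.
Let b : R := 9 / 10.

(** The Cayley transform sending the right half-plane to the unit disc and
    [9 / 10] to [0]. *)
Definition cayley Y : C := (Y - b%:C%C) / (Y + b%:C%C).

(** Twice the argument at the sample point [D - i D] minus the argument at [D],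
    each relative to the factor [1 - k z]. Up to the offset it majorizes an
    angle attached to the zero ([contributionE], [step_excess_ge0]); the angles
    of a zero and of its mirror image add up to [pi - carg w] ([carg_left]
    below). *)
Definition contribution D u : R :=
  2 * (parg (1 - u * cayley (D -i* D)%C) - parg (1 - k%:C%C * cayley (D -i* D)%C))
  - (parg (1 - u * cayley D%:C%C) - parg (1 - k%:C%C * cayley D%:C%C)).

Definition offset D : R := pi - 4 * atan (D / (D + 11 / 10)).

Lemma Re_gt0_neq0 Y : 0 < Re Y -> Y != 0.
Proof. by move=> h; apply/eqP => e; move: h; rewrite e ltxx. Qed.

Lemma cmod_lt_shift Y : 0 < Re Y -> cmod (Y - b%:C%C) < cmod (Y + b%:C%C).
Proof.
move=> x0; rewrite -(ltr_pXn2r (n := 2)) ?nnegrE ?cmod_ge0//.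
move: x0; rewrite !sqr_cmod; case: Y => x y /= x0.
rewrite oppr0 addr0 ltrD2r -subr_gt0.
have -> : (x + b) ^+ 2 - (x - b) ^+ 2 = x * (36 / 10) by rewrite /b; field.
by rewrite mulr_gt0.
Qed.

Lemma cmod_cayley_lt1 Y : 0 < Re Y -> cmod (cayley Y) < 1.
Proof.
move=> Y0; rewrite cmodM cmodV ltr_pdivrMr ?mul1r ?cmod_lt_shift//.
by rewrite (le_lt_trans (cmod_ge0 _) (cmod_lt_shift Y0)).
Qed.

(** The factor [r / (1 - r)] of [reflected_parg_bound] in the half-plane
    coordinate; it is of order [D] at the two sample points. *)
Lemma cayley_ratio Y : 0 < Re Y ->
  2 * (cmod (cayley Y) / (1 - cmod (cayley Y))) <= (cmod Y ^+ 2 + b ^+ 2) / (b * Re Y).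
Proof.
move=> Y0; set r := cmod (cayley Y).
have r1 : r < 1 := cmod_cayley_lt1 Y0.
have r0 : 0 <= r := cmod_ge0 _.
have bE : b = 9 / 10 by [].
set p := cmod (Y - b%:C%C) ^+ 2; set q := cmod (Y + b%:C%C) ^+ 2.
have cq : 0 < cmod (Y + b%:C%C).
  by rewrite (le_lt_trans (cmod_ge0 _) (cmod_lt_shift Y0)).
have q0 : 0 < q by rewrite exprn_gt0.
have rq : r ^+ 2 * q = p.
  by rewrite /r /cayley cmodM cmodV exprMn exprVn divfK// gt_eqF.
have pqD : p + q = 2 * (cmod Y ^+ 2 + b ^+ 2).
  by rewrite /p /q !sqr_cmod; case: (Y) => x y /=; ring.
have pqB : q - p = 4 * (b * Re Y).
  by rewrite /p /q !sqr_cmod; case: (Y) => x y /=; ring.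
have bY : 0 < b * Re Y by rewrite mulr_gt0//; lra.
rewrite mulrA ler_pdivrMr ?subr_gt0// mulrAC ler_pdivlMr//.
have sq : 0 <= (1 - r) ^+ 2 * q by rewrite mulr_ge0 ?sqr_ge0// ltW.
have d0 : 0 < 1 - r by rewrite subr_gt0.
nra.
Qed.

Lemma cmod_ratio_le1 Y : Re Y <= 0 ->
  cmod ((Y + b%:C%C) / (Y - b%:C%C)) <= 1.
Proof.
move=> Y0; have n2 : Y - b%:C%C != 0.
  by apply/eqP => /(congr1 (fun x => Re x)); rewrite Re_add Re_opp/= /b; lra.
rewrite cmodM cmodV ler_pdivrMr ?cmod_gt0// mul1r.
rewrite -(ler_pXn2r (n := 2)) ?nnegrE ?cmod_ge0// !sqr_cmod.
move: Y0; case: (Y) => x y /= Y0; rewrite oppr0 !addr0 lerD2r -subr_ge0.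
have -> : (x - b) ^+ 2 - (x + b) ^+ 2 = - x * (36 / 10) by rewrite /b; field.
by rewrite mulr_ge0// oppr_ge0.
Qed.

(** In the half-plane coordinate the argument of [1 - u z], for [|u| <= 1],
    splits into arguments of three points of the right half-plane. *)
Lemma parg_cayley Y Yp : Re Y <= 0 -> 0 < Re Yp ->
  parg (1 - ((Y + b%:C%C) / (Y - b%:C%C)) * cayley Yp) =
  parg (Yp - Y) - parg (b%:C%C - Y) - parg (Yp + b%:C%C).
Proof.
move=> Y0 Yp0; have b0 : 0 < b by rewrite /b; lra.
have h1 : 0 < Re (Yp - Y) by rewrite Re_add Re_opp; lra.
have h2 : 0 < Re (b%:C%C - Y) by rewrite Re_add Re_opp/=; lra.
have h3 : 0 < Re (Yp + b%:C%C) by rewrite Re_add/=; lra.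
have n2 : Y - b%:C%C != 0 by rewrite -oppr_eq0 opprB Re_gt0_neq0.
have n3 := Re_gt0_neq0 h3.
set z := 1 - _.
have zE : z = (2 * b)%:C%C * (Yp - Y) * (b%:C%C - Y)^-1 * (Yp + b%:C%C)^-1.
  have -> : (2 * b)%:C%C = 2 * b%:C%C :> C by rewrite rmorphM/= rmorph_nat.
  rewrite -[b%:C%C - Y]opprB invrN /z /cayley; field.
  by rewrite n2 n3.
have u1 := cmod_ratio_le1 Y0.
have z0 : 0 < Re z.
  rewrite /z Re_add Re_opp/= subr_gt0 (le_lt_trans (ler_norm _))//.
  rewrite (le_lt_trans (Re_le_cmod _))// cmodM.
  by rewrite (le_lt_trans _ (cmod_cayley_lt1 Yp0))// ler_piMl ?cmod_ge0.
apply: (@polar_inj R z); first exact: polar_parg.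
  rewrite zE -[parg (Yp - Y)]add0r.
  apply: polarM; last exact/polarV/polar_parg.
  apply: polarM; last exact/polarV/polar_parg.
  apply: polarM; last exact: polar_parg.
  by apply: polar_real; rewrite mulr_gt0.
have := parg_lt z; have := parg_lt (Yp - Y); have := parg_lt (b%:C%C - Y).
have := parg_lt (Yp + b%:C%C); rewrite !ltr_norml.
move=> /andP[? ?] /andP[? ?] /andP[? ?] /andP[? ?].
by apply/andP; split; lra.
Qed.

Lemma parg_cayley_base Yp : 0 < Re Yp ->
  parg (1 - k%:C%C * cayley Yp) =
  parg (Yp + (11 / 10)%:C%C) - parg (Yp + b%:C%C).
Proof.
move=> Yp0; have := @parg_cayley (- (11 / 10)%:C%C) Yp.
rewrite Re_opp/= => /(_ ltac:(lra) Yp0).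
have -> : (- (11 / 10)%:C%C + b%:C%C) / (- (11 / 10)%:C%C - b%:C%C) = k%:C%C :> C.
  rewrite -rmorphN -rmorphD -rmorphB -fmorphV -rmorphM/=; congr (_%:C)%C.
  by rewrite /k /b; field.
have -> : parg (b%:C%C - - (11 / 10)%:C%C) = 0.
  by rewrite /parg/= oppr0 subr0 mul0r atan0.
by rewrite opprK subr0 => ->.
Qed.

Lemma contributionE D y n : 0 < D -> y <= 0 ->
  contribution D (((y +i* n)%C + b%:C%C) / ((y +i* n)%C - b%:C%C)) =
  step_excess D (D - y) n + atan (n / (b - y)) - offset D / 2.
Proof.
move=> D0 y0; rewrite /contribution !parg_cayley ?parg_cayley_base//.
rewrite /step_excess /offset /parg/= !(add0r, addr0, oppr0, subr0, mulNr, atanN).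
rewrite mul0r atan0.
have -> : (- D - n) / (D - y) = - ((n + D) / (D - y)).
  by rewrite -mulNr opprD addrC.
by rewrite mul0r atan0 atanN; field.
Qed.

(** The parameter [1] is the point at infinity of the half-plane, which
    [contributionE] does not reach. *)
Lemma contribution1 D : 0 < D ->
  contribution D 1 = 2 * atan (D / (D + 11 / 10)).
Proof.
move=> D0; rewrite /contribution !mul1r !parg_cayley_base//.
have h Yp : 0 < Re Yp -> parg (1 - cayley Yp) = - parg (Yp + b%:C%C).
  move=> Yp0; have b0 : 0 < b by rewrite /b; lra.
  have h3 : 0 < Re (Yp + b%:C%C) by rewrite Re_add/=; lra.
  have zE : 1 - cayley Yp = (2 * b)%:C%C * (Yp + b%:C%C)^-1.
    rewrite rmorphM/= rmorph_nat /cayley; field.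
    exact: Re_gt0_neq0.
  have z0 : 0 < Re (1 - cayley Yp).
    rewrite Re_add Re_opp/= subr_gt0 (le_lt_trans (ler_norm _))//.
    by rewrite (le_lt_trans (Re_le_cmod _))// cmod_cayley_lt1.
  apply: (@polar_inj R (1 - cayley Yp)); first exact: polar_parg.
    rewrite zE -[- parg _]add0r; apply: polarM; last exact/polarV/polar_parg.
    by apply: polar_real; rewrite mulr_gt0.
  have := parg_lt (1 - cayley Yp); have := parg_lt (Yp + b%:C%C).
  rewrite !ltr_norml => /andP[? ?] /andP[? ?].
  by apply/andP; split; lra.
rewrite !h// /parg/= !(add0r, addr0, oppr0, subr0, mul0r, atan0).
by rewrite !mulNr !atanN; field.
Qed.

Lemma offset_bounds D : 0 < D -> 0 <= offset D /\ offset D <= 11 / 5 / D.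
Proof.
move=> D0; set x := D / (D + 11 / 10).
have p0 : 0 < D + 11 / 10 by lra.
have x1 : x <= 1 by rewrite ler_pdivrMr// mul1r; lra.
have x0 : 0 <= x by rewrite divr_ge0// ltW.
have d0 : 0 <= atan 1 - atan x by rewrite subr_ge0 le_atan.
have a1 : 4 * atan 1 = pi :> R by rewrite atan1; field.
split; first by rewrite /offset -/x; lra.
have := @atan_sub_le R 1 x; rewrite x0 x1 => /(_ isT) h.
have : (1 - x) / (1 + x ^+ 2) <= 11 / 20 / D.
  rewrite ler_pdivrMr ?ltr_pwDl ?sqr_ge0//.
  have E : (1 - x) * D = 11 / 10 * x.
    by rewrite /x; field; rewrite gt_eqF//; lra.
  rewrite [leRHS]mulrAC ler_pdivlMr// E.
  have : 0 <= (1 - x) ^+ 2 by exact: sqr_ge0.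
  nra.
have -> : 11 / 5 / D = 4 * (11 / 20 / D) by field; rewrite gt_eqF.
by rewrite /offset -/x; lra.
Qed.

End Contribution.

(** * A zero and its mirror image *)

Section Pair.
Variable R : realType.
Local Notation C := R[i].
Local Notation Re := complex.Re.
Local Notation Im := complex.Im.
Implicit Types (u w Y U : C) (D s n y : R).

Let k : R := 1 / 10.
Let b : R := 9 / 10.

(** [1 - z / w] equals [(1 - param w * t) / (1 - k t)] under the change of
    variable [z = (1 - k) t / (1 - k t)], which maps the unit disc onto a
    disc internally tangent to it at [1]. *)
Definition param w : C := k%:C%C + b%:C%C / w.

(** What is gained in [reflected_power_sum_bound] when [u] is reflected. *)
Definition penalty u : R := if 1 < cmod u then ln (cmod u) else 0.

(** The arguments at the two sample points cost at most
    [(5 * D ^+ 2 + 3 * b ^+ 2) / (b * D)] times the reflected bound, which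
    [6 * D / b] covers. *)
Lemma contribution_sum (us : seq C) (Lam D : R) : 7 / 4 <= D ->
    (forall z, cmod z < 1 -> \prod_(u <- us) cmod (1 - u * z) <=
        expR Lam * cmod (1 - k%:C%C * z) ^+ size us) ->
  \sum_(u <- us) (contribution D (reflect_out u) + 6 * D / b * penalty u)
    <= 6 * D / b * Lam.
Proof.
move=> D74 bnd; have D0 : 0 < D by lra.
have bE : b = 9 / 10 by [].
have k1 : cmod (k%:C%C : C) < 1 by rewrite cmod_real /k ger0_norm; lra.
have [L0 _] := reflected_power_sum_bound k1 bnd.
have H := reflected_parg_bound k1 bnd; move: L0 H.
set Lam' := Lam - _ => L0 H.
have LE : Lam' = Lam - \sum_(u <- us) penalty u.
  by rewrite /Lam' big_mkcond.
have Y1 : 0 < Re (D -i* D)%C by [].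
have Y2 : 0 < Re (D%:C%C : C) by [].
have h1 := H _ (cmod_cayley_lt1 Y1); have h2 := H _ (cmod_cayley_lt1 Y2).
have c1 := cayley_ratio Y1; have c2 := cayley_ratio Y2.
move: h1 h2 c1 c2; rewrite !ler_norml.
set q1 := cmod _ / (1 - cmod (cayley (D -i* D)%C)).
set q2 := cmod _ / (1 - cmod (cayley D%:C%C)) => /andP[_ h1] /andP[h2 _].
have -> : cmod (D -i* D)%C ^+ 2 = D ^+ 2 + D ^+ 2 by rewrite sqr_cmod/= sqrrN.
rewrite cmod_real ger0_norm ?(ltW D0)// -/b.
rewrite -[Re (D -i* D)%C]/D -[Re D%:C%C]/D => c1 c2.
rewrite big_split/= -mulr_sumr -lerBrDr -mulrBr -LE.
have -> : \sum_(u <- us) contribution D (reflect_out u) =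
   2 * (\sum_(u <- us) parg (1 - reflect_out u * cayley (D -i* D)%C)
     - (size us)%:R * parg (1 - k%:C%C * cayley (D -i* D)%C))
   - (\sum_(u <- us) parg (1 - reflect_out u * cayley D%:C%C)
     - (size us)%:R * parg (1 - k%:C%C * cayley D%:C%C)).
  have sz x : (size us)%:R * x = \sum_(u <- us) x :> R.
    by rewrite big_const_seq count_predT iter_addr_0 mulr_natl.
  by rewrite !sz -!sumrB mulr_sumr -sumrB.
have d1 := ler_wpM2l L0 c1; have d2 := ler_wpM2l L0 c2.
apply: (@le_trans _ _ (2 * (Lam' * ((D ^+ 2 + D ^+ 2 + b ^+ 2) / (b * D)))
   + Lam' * ((D ^+ 2 + b ^+ 2) / (b * D)))); first lra.
have -> : 2 * (Lam' * ((D ^+ 2 + D ^+ 2 + b ^+ 2) / (b * D)))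
   + Lam' * ((D ^+ 2 + b ^+ 2) / (b * D)) =
   (5 * D ^+ 2 + 3 * b ^+ 2) / (b * D) * Lam'.
  by field; rewrite /b !gt_eqF//; lra.
have bD : 0 < b * D by rewrite mulr_gt0//; lra.
apply: ler_wpM2r => //; rewrite ler_pdivrMr//.
have -> : 6 * D / b * (b * D) = 6 * D ^+ 2 by field; lra.
rewrite bE; nra.
Qed.

Lemma polar_carg w : w != 0 -> polar w (carg w).
Proof.
move=> w0; have [_ _ e] := cargP w0.
exists (cmod w); first by rewrite cmod_gt0.
by rewrite {1}e /expi; apply/eqP; rewrite eq_complex/= !mul0r subr0 addr0 !eqxx.
Qed.

Lemma polar_minus1 (z : C) a : polar z a -> polar (- z) (pi + a).
Proof.
move=> pz; rewrite -mulN1r; apply: polarM => //.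
exists 1 => //; rewrite /expi cospi sinpi mul1r.
by apply/eqP; rewrite eq_complex/= oppr0 !eqxx.
Qed.

(** Here and in the next two lemmas [U = (1 + w) / (1 - w)] is the half-plane
    coordinate of [w]. The cases differ in the position of [1 - U], whose
    argument has to be followed past the imaginary axis. *)
Lemma carg_left w U : w != 0 -> w = - ((1 - U) / (1 + U)) -> -1 < Re U -> Re U < 1 ->
  pi - carg w = atan (Im U / (1 - Re U)) + atan (Im U / (1 + Re U)).
Proof.
move=> w0 wE U0 U1; have [c0 c2 _] := cargP w0.
have := polar_carg w0; rewrite {1}wE => pw.
have p1 : polar (1 - U) (- atan (Im U / (1 - Re U))).
  have := @polar_parg R (1 - U); rewrite /parg Re_add Im_add Re_opp Im_opp/=.
  by rewrite add0r mulNr atanN; apply; lra.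
have p2 : polar (1 + U) (atan (Im U / (1 + Re U))).
  have := @polar_parg R (1 + U); rewrite /parg Re_add Im_add/= add0r; apply; lra.
have p3 := polar_minus1 (polarM p1 (polarV p2)).
have := polar_inj pw p3.
have := atan_ltpi2 (Im U / (1 - Re U)); have := atan_gtNpi2 (Im U / (1 - Re U)).
have := atan_ltpi2 (Im U / (1 + Re U)); have := atan_gtNpi2 (Im U / (1 + Re U)).
move=> ? ? ? ? -> //; first lra.
by rewrite ltr_norml; apply/andP; split; lra.
Qed.

Lemma carg_upper w U : w != 0 -> w = - ((1 - U) / (1 + U)) -> 0 <= Re U -> 0 < Im U ->
  pi - carg w = pi / 2 - atan ((1 - Re U) / Im U) + atan (Im U / (1 + Re U)).
Proof.
move=> w0 wE U0 n0; have [c0 c2 _] := cargP w0.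
have := polar_carg w0; rewrite {1}wE => pw.
have p1 : polar (1 - U) (- (pi / 2 - atan ((1 - Re U) / Im U))).
  have := polarV (polar_upper (1 - Re U) n0).
  move=> [r r0 e]; exists (r * cmod (1 - U) ^+ 2).
    rewrite mulr_gt0// exprn_gt0// cmod_gt0; apply/eqP => /subr0_eq e'.
    by move: n0; rewrite -e' ltxx.
  have -> : expi (- (pi / 2 - atan ((1 - Re U) / Im U))) =
      r^-1%:C%C * ((1 - Re U) +i* Im U)%C^-1.
    by rewrite e mulrA -rmorphM mulVf ?gt_eqF// rmorph1 mul1r.
  rewrite mulrA -rmorphM mulrAC divff ?gt_eqF// mul1r.
  have h : ((1 - Re U) +i* Im U)%C = conjc (1 - U).
    by case: (U) => x y; apply/eqP; rewrite eq_complex/= sub0r opprK !eqxx.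
  have nz : conjc (1 - U) != 0.
    rewrite conjc_eq0; apply/eqP => /subr0_eq e'.
    by move: n0; rewrite -e' ltxx.
  rewrite h; apply: (mulIf nz); rewrite divfK//.
  rewrite sqr_cmod; case: (1 - U) => x y.
  by apply/eqP; rewrite eq_complex/=; apply/andP; split; apply/eqP; ring.
have p2 : polar (1 + U) (atan (Im U / (1 + Re U))).
  have := @polar_parg R (1 + U); rewrite /parg Re_add Im_add/= add0r; apply; lra.
have p3 := polar_minus1 (polarM p1 (polarV p2)).
have := polar_inj pw p3.
have U1 : 0 < 1 + Re U by lra.
have := atan_inv U1 n0.
have : atan (- ((1 + Re U) / Im U)) <= atan ((1 - Re U) / Im U).
  rewrite le_atan// -mulNr ler_pM2r ?invr_gt0//; lra.
rewrite atanN.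
have := atan_ltpi2 ((1 - Re U) / Im U).
have := atan_ltpi2 ((1 + Re U) / Im U).
move=> ? ? ? ? -> //; first lra.
by rewrite ltr_norml; apply/andP; split; lra.
Qed.

Lemma carg_lower w U : w != 0 -> w = - ((1 - U) / (1 + U)) -> 1 <= Re U -> Im U < 0 ->
  pi - carg w <= - (pi / 2) + atan (Im U / (1 + Re U)).
Proof.
move=> w0 wE U0 n0; have [c0 c2 _] := cargP w0.
have := polar_carg w0; rewrite {1}wE => pw.
have m0 : 0 < - Im U by rewrite oppr_gt0.
have p1 : polar (1 - U) (pi / 2 - atan ((1 - Re U) / - Im U)).
  have := polar_upper (1 - Re U) m0.
  by case: (U) => x y; rewrite /= -[X in (_ +i* X)%C]sub0r.
have p2 : polar (1 + U) (atan (Im U / (1 + Re U))).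
  have := @polar_parg R (1 + U); rewrite /parg Re_add Im_add/= add0r; apply; lra.
have p3 := polar_minus1 (polarM p1 (polarV p2)).
have := polar_inj pw p3.
have U1 : 0 < 1 + Re U by lra.
have e1 := atan_inv U1 m0.
have e2 : atan (Im U / (1 + Re U)) = - atan (- Im U / (1 + Re U)).
  by rewrite mulNr atanN opprK.
have e3 : atan ((1 - Re U) / - Im U) = - atan ((Re U - 1) / - Im U).
  by rewrite -atanN -mulNr opprB.
have e4 : 0 <= atan ((Re U - 1) / - Im U).
  by rewrite atan_ge0// divr_ge0 ?(ltW m0)//; lra.
have e5 : atan ((Re U - 1) / - Im U) < atan ((1 + Re U) / - Im U).
  by rewrite lt_atan// ltr_pM2r ?invr_gt0//; lra.
have e6 := atan_ltpi2 ((Re U - 1) / - Im U).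
have e7 := atan_ltpi2 ((1 + Re U) / - Im U).
move=> -> //; first lra.
by rewrite ltr_norml; apply/andP; split; lra.
Qed.

(** [ln (A / B) >= 1 - B / A], where [A / B] is the square of the modulus. *)
Lemma penalty_lower s n : 0 < s -> (s != b) || (n != 0) ->
  2 * b * s / ((b + s) ^+ 2 + n ^+ 2) <=
  penalty (((s +i* n)%C + b%:C%C) / ((s +i* n)%C - b%:C%C)) /\
  1 < cmod (((s +i* n)%C + b%:C%C) / ((s +i* n)%C - b%:C%C)).
Proof.
move=> s0 sn; set u := (X in penalty X); have b0 : 0 < b by rewrite /b; lra.
set A := (b + s) ^+ 2 + n ^+ 2; set B := (b - s) ^+ 2 + n ^+ 2.
have A0 : 0 < A by rewrite ltr_pwDl ?exprn_gt0 ?sqr_ge0// addr_gt0.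
have B0 : 0 < B.
  rewrite lt_neqAle eq_sym paddr_eq0 ?sqr_ge0// !sqrf_eq0 subr_eq0.
  by rewrite negb_and eq_sym sn addr_ge0 ?sqr_ge0.
have cu : cmod u ^+ 2 = A / B.
  rewrite /u cmodM cmodV exprMn exprVn !sqr_cmod/= oppr0 !addr0 /A /B.
  by congr (_ / _); ring.
have AB : A - B = 4 * b * s by rewrite /A /B; ring.
have AB1 : 1 < A / B by rewrite ltr_pdivlMr// mul1r -subr_gt0 AB !mulr_gt0.
have u1 : 1 < cmod u.
  by rewrite -(ltr_pXn2r (n := 2)) ?nnegrE ?cmod_ge0// expr1n cu.
split=> //; rewrite /penalty u1.
have -> : ln (cmod u) = ln (A / B) / 2.
  by rewrite -cu lnXn ?(lt_trans ltr01)//; field.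
have h : ln (B / A) <= B / A - 1.
  have := @le_ln1Dx R (B / A - 1); rewrite addrCA subrr addr0; apply.
  by rewrite ltrBrDl subrr divr_gt0.
have -> : ln (A / B) = - ln (B / A).
  by rewrite -lnV ?posrE ?divr_gt0// invf_div.
have : 2 * b * s / A = (1 - B / A) / 2.
  have -> : 2 * b * s = (A - B) / 2 by rewrite AB; field.
  by field; rewrite gt_eqF.
lra.
Qed.

(** The key inequality: a zero [w] and its mirror image together contribute at
    least [pi - carg w], up to the offset. The mirror image always has a
    parameter of modulus at most [1]. So has [w] if [s <= 0], that is, outside
    the tangent disc; otherwise it is reflected, and the penalty pays for the
    loss. *)
Lemma pair_lower_inside w D : 7 / 4 <= D -> w != 0 -> cmod w <= 1 ->
  pi - carg w - offset D <=
   (contribution D (reflect_out (param w)) + 6 * D / b * penalty (param w)) +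
   (contribution D (reflect_out (param (conjc w)^-1)) +
      6 * D / b * penalty (param (conjc w)^-1)).
Proof.
move=> D74 w0 w1; have D0 : 0 < D by lra.
have bE : b = 9 / 10 by [].
have kb1 : k%:C%C + b%:C%C = 1 :> C.
  by rewrite -rmorphD/=; congr (_%:C)%C; rewrite /k /b; field.
have [-> | wn1] := eqVneq w 1.
  have -> : param 1 = 1 by rewrite /param divr1.
  have -> : param (conjc 1)^-1 = 1 by rewrite /param rmorph1 invr1 divr1.
  rewrite /reflect_out /penalty cmod1 lexx ltxx mulr0 addr0 contribution1//.
  have [c0 _ _] := cargP (oner_neq0 C).
  by rewrite /offset; lra.
have nw : 1 - w != 0 by rewrite subr_eq0 eq_sym.
pose U := (1 + w) / (1 - w); pose Y := U - k%:C%C.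
have U1 : 1 + U = 2 / (1 - w) by rewrite /U; field.
have U1' : 1 + U != 0 by rewrite U1 mulf_neq0 ?invr_eq0// pnatr_eq0.
have wE : w = - ((1 - U) / (1 + U)).
  apply: (mulIf U1'); rewrite mulNr divfK//.
  by rewrite /U; field.
have bkE : b%:C%C = 1 - k%:C%C :> C by rewrite -kb1 addrAC subrr add0r.
have two0 : 2 != 0 :> C by rewrite pnatr_eq0.
have YbE : Y - b%:C%C = 2 * w / (1 - w) by rewrite /Y bkE /U; field.
have Yb0 : Y - b%:C%C != 0 by rewrite YbE !mulf_neq0 ?invr_eq0.
have uE : param w = (Y + b%:C%C) / (Y - b%:C%C).
  have -> : Y + b%:C%C = 2 * (1 - k%:C%C + k%:C%C * w) / (1 - w).
    by rewrite /Y bkE /U; field.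
  by rewrite YbE /param bkE; field; rewrite w0 nw.
set s := Re U - k; set n := Im U.
have YE : Y = (s +i* n)%C.
  rewrite /Y /s /n; case: (U) => x y; apply/eqP; rewrite eq_complex/=.
  by apply/andP; split; apply/eqP; ring.
pose Y' := ((- s - 2 / 10) +i* n)%C.
have Y'E : Y' = - conjc U - k%:C%C.
  by rewrite /Y' /s /n /k; case: (U) => x y; apply/eqP; rewrite eq_complex/=;
     apply/andP; split; apply/eqP; field.
have u'E : param (conjc w)^-1 = (Y' + b%:C%C) / (Y' - b%:C%C).
  have nW : 1 - conjc w != 0.
    by rewrite -(rmorph1 (@conjc R)) -rmorphB conjc_eq0.
  have cU : conjc U = (1 + conjc w) / (1 - conjc w).
    by rewrite /U rmorphM fmorphV rmorphD rmorphB rmorph1.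
  have -> : Y' + b%:C%C =
      - 2 * (k%:C%C + conjc w - k%:C%C * conjc w) / (1 - conjc w).
    by rewrite Y'E cU bkE; field.
  have -> : Y' - b%:C%C = - 2 / (1 - conjc w).
    by rewrite Y'E cU bkE; field.
  by rewrite /param invrK bkE; field.
have xi0 : 0 <= Re U.
  have : cmod (1 - U) <= cmod (1 + U).
    have -> : 1 - U = - w * (1 + U) by rewrite wE opprK divfK.
    by rewrite cmodM cmodN ler_piMl ?cmod_ge0.
  rewrite -(ler_pXn2r (n := 2)) ?nnegrE ?cmod_ge0// !sqr_cmod.
  by case: (U) => x y /=; nra.
have n1 : (s != b) || (n != 0).
  rewrite -negb_and; apply: contra Yb0 => /andP[/eqP sE /eqP nE].
  rewrite YE eq_complex/= sE nE subrr oppr0 addr0 eqxx //.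
have xiE : Re U = s + 1 / 10 by rewrite /s /k subrK.
have u'1 : cmod (param (conjc w)^-1) <= 1.
  by rewrite u'E cmod_ratio_le1//=; lra.
have -> : reflect_out (param (conjc w)^-1) = param (conjc w)^-1.
  by rewrite /reflect_out u'1.
have -> : penalty (param (conjc w)^-1) = 0.
  by rewrite /penalty ltNge u'1.
rewrite mulr0 addr0 u'E contributionE//; last lra.
have -> : b - (- s - 2 / 10) = 1 + Re U by rewrite xiE /b; field.
have -> : D - (- s - 2 / 10) = D + s + 2 / 10 by ring.
have e2 : 0 <= step_excess D (D + s + 2 / 10) n by apply: step_excess_ge0 => //; lra.
clear Y'E u'E u'1 bkE two0 U1 U1' YbE Yb0 nw wn1 kb1.
have [s0|s0] := leP s 0.
  have u1 : cmod (param w) <= 1 by rewrite uE cmod_ratio_le1// YE.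
  rewrite /reflect_out u1 /penalty ltNge u1 mulr0 addr0 uE YE contributionE//.
  have -> : b - s = 1 - Re U by rewrite xiE /b; field.
  rewrite (carg_left w0 wE); [|lra|lra].
  have e1 : 0 <= step_excess D (D - s) n by apply: step_excess_ge0 => //; lra.
  by rewrite -/n; lra.
have [pen u1] := penalty_lower s0 n1; rewrite -YE -uE in pen u1.
have -> : reflect_out (param w) =
    ((- s +i* n)%C + b%:C%C) / ((- s +i* n)%C - b%:C%C).
  rewrite /reflect_out leNgt u1/= uE rmorphM/= fmorphV invf_div/= YE.
  by rewrite -[LHS]mulrNN -invrN; congr (_ / _);
     apply/eqP; rewrite eq_complex/=; apply/andP; split; apply/eqP; ring.
rewrite contributionE//; last by rewrite oppr_le0 ltW.
rewrite !opprK.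
have e1 : 0 <= step_excess D (D + s) n by apply: step_excess_ge0 => //; lra.
have {}pen : 12 * D * s / ((b + s) ^+ 2 + n ^+ 2) <= 6 * D / b * penalty (param w).
  apply: (@le_trans _ _ (6 * D / b * (2 * b * s / ((b + s) ^+ 2 + n ^+ 2)))).
    rewrite le_eqVlt; apply/orP; left; apply/eqP; field.
    rewrite !gt_eqF//=; first lra.
    by rewrite ltr_pwDl ?exprn_gt0 ?sqr_ge0//; lra.
  by rewrite ler_wpM2l// divr_ge0// ?mulr_ge0//; lra.
have penp : 0 <= 12 * D * s / ((b + s) ^+ 2 + n ^+ 2).
  by rewrite divr_ge0 ?addr_ge0 ?sqr_ge0// !mulr_ge0//; lra.
have bs0 : 0 < b + s by lra.
have [n0|n0|n0] := ltrgtP n 0.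
- have [x1|x1] := ltP (Re U) 1.
    rewrite (carg_left w0 wE); [|lra|lra].
    have : atan (n / (1 - Re U)) <= atan (n / (b + s)).
      rewrite le_atan// ler_nM2l// lef_pV2 ?posrE; lra.
    by rewrite -/n; lra.
  have := carg_lower w0 wE x1 n0; have := atan_gtNpi2 (n / (b + s)).
  by rewrite -/n; lra.
- rewrite (carg_upper w0 wE xi0 n0) -/n.
  have := reflection_loss D74 s0 n0; rewrite -/b.
  have -> : 1 - Re U = b - s by rewrite xiE /b; field.
  have := atan_inv bs0 n0; lra.
- have [x1|x1] := ltP (Re U) 1.
    rewrite (carg_left w0 wE); [|lra|lra].
    by move: e1 e2 penp pen; rewrite -/n n0 !mul0r atan0; lra.
  have sb : b < s.
    rewrite lt_neqAle; move: n1; rewrite n0 eqxx orbF eq_sym => ->/=; lra.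
  have := reflection_loss_real D74 sb; rewrite -/b.
  have [c0 _ _] := cargP w0.
  by move: pen; rewrite n0 !mul0r atan0; lra.
Qed.

Lemma carg_conjV w : w != 0 -> carg (conjc w)^-1 = carg w.
Proof.
move=> w0; have cw0 : conjc w != 0 by rewrite conjc_eq0.
have iw0 : (conjc w)^-1 != 0 by rewrite invr_eq0.
have [a0 a2 _] := cargP w0; have [b0 b2 _] := cargP iw0.
have := polar_carg iw0.
have [r r0 e] := polar_carg w0.
have p : polar (conjc w)^-1 (carg w).
  rewrite -[carg w]opprK; apply: polarV; exists r => //.
  rewrite {1}e rmorphM/= oppr0; congr (_ * _).
  by apply/eqP; rewrite eq_complex/= cosN sinN !eqxx.
move=> p'; apply: polar_inj p' p _.
by rewrite ltr_norml; apply/andP; split; lra.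
Qed.

(** The inequality is symmetric in [w] and its mirror image, which have the same
    argument. *)
Lemma pair_lower w D : 7 / 4 <= D -> w != 0 ->
  pi - carg w - offset D <=
   (contribution D (reflect_out (param w)) + 6 * D / b * penalty (param w)) +
   (contribution D (reflect_out (param (conjc w)^-1)) +
      6 * D / b * penalty (param (conjc w)^-1)).
Proof.
move=> D74 w0; have [w1|w1] := leP (cmod w) 1; first exact: pair_lower_inside.
have cw0 : conjc w != 0 by rewrite conjc_eq0.
have iw0 : (conjc w)^-1 != 0 by rewrite invr_eq0.
have iw1 : cmod (conjc w)^-1 <= 1.
  by rewrite cmodV cmodJ invf_le1 ?ltW// (lt_trans ltr01).
have := pair_lower_inside D74 iw0 iw1.
have E : (conjc (conjc w)^-1)^-1 = w by rewrite -conjc_inv invrK conjcK.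
by rewrite carg_conjV// E [X in _ <= X -> _]addrC.
Qed.

End Pair.

(** * From the growth of a polynomial to its zeros *)

Section Growth.
Variable R : realType.
Local Notation C := R[i].
Local Notation Re := complex.Re.
Local Notation Im := complex.Im.
Implicit Types (zs : seq C) (M D : R) (w z t : C).

Let k : R := 1 / 10.
Let b : R := 9 / 10.

(** All that is used of a polynomial with zeros [zs] is this bound inside the
    unit disc, and the same bound for the mirror images of its zeros. *)
Definition growth zs M : Prop :=
  forall z, cmod z < 1 -> \prod_(w <- zs) cmod (1 - z / w) <= M / (1 - cmod z).

Definition mirror w : C := (conjc w)^-1.

Lemma growth_ge1 zs M : growth zs M -> 1 <= M.
Proof.
move=> /(_ 0); rewrite cmod0 ltr01 subr0 divr1 => /(_ isT).
by rewrite big1// => i _; rewrite mul0r subr0 cmod1.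
Qed.

(** The tangent disc: there [1 - |z|] dominates [|1 - z| ^ 2], so that the
    bound of [growth] becomes uniform after multiplication by [(1 - z) ^ 2]. *)
Lemma tangent_disc t : cmod t < 1 ->
  let z := b%:C%C * t / (1 - k%:C%C * t) in
  cmod z < 1 /\ k * cmod (1 - z) ^+ 2 <= 2 * (1 - cmod z).
Proof.
move=> t1 z; have k0 : 0 < k by rewrite /k; lra.
have d0 : 0 < cmod (1 - k%:C%C * t).
  rewrite (lt_le_trans _ (cmodB_ge _ _))// cmod1 cmodM cmod_real subr_gt0.
  by rewrite ger0_norm ?(ltW k0)//; have := cmod_ge0 t; rewrite /k; nra.
have dn : 1 - k%:C%C * t != 0 by rewrite -cmod_gt0.
have t2 : cmod t ^+ 2 < 1 by rewrite expr_lt1 ?cmod_ge0.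
have E1 : cmod z ^+ 2 * cmod (1 - k%:C%C * t) ^+ 2 = b ^+ 2 * cmod t ^+ 2.
  by rewrite -exprMn -cmodM /z divfK// cmodM exprMn cmod_real real_normK ?num_real.
have E2 : cmod (1 - z) ^+ 2 * cmod (1 - k%:C%C * t) ^+ 2 = cmod (1 - t) ^+ 2.
  rewrite -exprMn -cmodM mulrBl /z divfK//; congr (cmod _ ^+ 2).
  have kb1 : b%:C%C = 1 - k%:C%C :> C.
    by rewrite -(rmorph1 (real_complex R)) -rmorphB/=; congr (_%:C)%C; rewrite /k /b; field.
  by rewrite kb1; ring.
have E3 : cmod (1 - k%:C%C * t) ^+ 2 - b ^+ 2 * cmod t ^+ 2 - k * cmod (1 - t) ^+ 2
    = b * (1 - cmod t ^+ 2).
  by rewrite !sqr_cmod /k /b; case: (t) => x y /=; field.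
have d2 : 0 < cmod (1 - k%:C%C * t) ^+ 2 by rewrite exprn_gt0.
have h : k * cmod (1 - z) ^+ 2 < 1 - cmod z ^+ 2.
  rewrite -(ltr_pM2r d2) mulrBl mul1r E1 -mulrA E2 -subr_gt0.
  have -> : cmod (1 - k%:C%C * t) ^+ 2 - b ^+ 2 * cmod t ^+ 2 -
    k * cmod (1 - t) ^+ 2 = b * (1 - cmod t ^+ 2) by [].
  by rewrite mulr_gt0 ?subr_gt0// /b; lra.
have z1 : cmod z < 1.
  rewrite -(ltr_pXn2r (n := 2)) ?nnegrE ?cmod_ge0// expr1n -subr_gt0.
  by rewrite (le_lt_trans _ h)// mulr_ge0 ?sqr_ge0// ltW.
split=> //; rewrite ltW// (lt_le_trans h)//.
have : 0 <= (1 - cmod z) ^+ 2 by exact: sqr_ge0.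
lra.
Qed.

Lemma one_sub_param w t : w != 0 -> 1 - k%:C%C * t != 0 ->
  1 - param w * t =
  (1 - (b%:C%C * t / (1 - k%:C%C * t)) / w) * (1 - k%:C%C * t).
Proof.
move=> w0 d0; rewrite /param -/k -/b; set kc := k%:C%C in d0 *; set bc := b%:C%C.
by move: kc bc d0 => kc bc d0; field; rewrite w0 d0.
Qed.

(** The four extra parameters [1] come from the factor [(1 - z) ^ 4] that
    compensates the two poles of [growth]; their contributions are
    nonnegative. *)
Theorem sum_carg_le zs M M' D : 7 / 4 <= D -> (forall w, w \in zs -> w != 0) ->
    growth zs M -> growth [seq mirror w | w <- zs] M' ->
  \sum_(w <- zs) (pi - carg w) <=
    (size zs)%:R * (11 / 5 / D) + 20 / 3 * D * (ln M + ln M' + 2 * ln 20).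
Proof.
move=> D74 zs0 gM gM'; have D0 : 0 < D by lra.
have M0 : 0 < M by rewrite (lt_le_trans ltr01)// (growth_ge1 gM).
have M'0 : 0 < M' by rewrite (lt_le_trans ltr01)// (growth_ge1 gM').
pose us := [seq param w | w <- zs] ++ [seq param (mirror w) | w <- zs] ++ nseq 4 1.
set Lam := ln M + ln M' + 2 * ln 20.
have eL : expR Lam = M * M' * 400.
  rewrite /Lam !expRD !lnK ?posrE//; congr (_ * _).
  by rewrite expRM_natl lnK ?posrE//; ring.
have H := @contribution_sum R us Lam D D74.
have {}H : \sum_(u <- us) (contribution D (reflect_out u) + 6 * D / b * penalty u)
   <= 6 * D / b * Lam.
  apply: H => t t1.
  have [z1 hz] := tangent_disc t1; move: z1 hz; set z := b%:C%C * t / _ => z1 hz.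
  have d0 : 1 - k%:C%C * t != 0.
    rewrite -cmod_gt0 (lt_le_trans _ (cmodB_ge _ _))// cmod1 cmodM cmod_real.
    rewrite subr_gt0 ger0_norm; last by rewrite /k; lra.
    by have := cmod_ge0 t; rewrite /k; nra.
  rewrite !big_cat/= !big_map.
  have fac (s : seq C) : (forall w, w \in s -> w != 0) ->
    \prod_(w <- s) cmod (1 - param w * t) =
    \prod_(w <- s) cmod (1 - z / w) * cmod (1 - k%:C%C * t) ^+ size s.
    elim: s => [|w s ih] hs; first by rewrite !big_nil expr0 mulr1.
    rewrite !big_cons ih; last by move=> x xs; apply: hs; rewrite inE xs orbT.
    rewrite one_sub_param//; last by apply: hs; rewrite inE eqxx.
    by rewrite cmodM exprS -/z; ring.
  have m0 w : w \in [seq mirror w | w <- zs] -> w != 0.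
    by move=> /mapP[x xz ->]; rewrite /mirror invr_eq0 conjc_eq0 zs0.
  rewrite fac//.
  have -> : \prod_(w <- zs) cmod (1 - param (mirror w) * t) =
      \prod_(w <- [seq mirror w | w <- zs]) cmod (1 - param w * t).
    by rewrite big_map.
  rewrite fac// size_map.
  have -> : \prod_(u <- [:: 1; 1; 1; 1]) cmod (1 - u * t) =
     cmod (1 - z) ^+ 4 * cmod (1 - k%:C%C * t) ^+ 4.
    have E : 1 - t = (1 - z) * (1 - k%:C%C * t).
      rewrite mulrBl /z divfK//.
      have kb1 : b%:C%C = 1 - k%:C%C :> C.
        rewrite -(rmorph1 (real_complex R)) -rmorphB/=; congr (_%:C)%C.
        by rewrite /k /b; field.
      by rewrite kb1; ring.
    by rewrite !big_cons big_nil !mul1r mulr1 E cmodM; ring.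
  rewrite !size_cat !size_map size_nseq !exprD eL.
  set P1 := \prod_(w <- zs) _; set P2 := \prod_(w <- map _ _) _.
  set c := cmod (1 - k%:C%C * t).
  have -> : P1 * c ^+ size zs * (P2 * c ^+ size zs * (cmod (1 - z) ^+ 4 * c ^+ 4)) =
     P1 * P2 * cmod (1 - z) ^+ 4 * (c ^+ size zs * (c ^+ size zs * c ^+ 4)) by ring.
  apply: ler_wpM2r; first by rewrite !(mulr_ge0, exprn_ge0, cmod_ge0).
  have y0 : 0 < 1 - cmod z by rewrite subr_gt0.
  have h1 := gM _ z1; have h2 := gM' _ z1.
  have P10 : 0 <= P1 by apply: prodr_ge0 => *; exact: cmod_ge0.
  have P20 : 0 <= P2 by apply: prodr_ge0 => *; exact: cmod_ge0.
  have h4 : cmod (1 - z) ^+ 4 <= 400 * (1 - cmod z) ^+ 2.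
    have -> : cmod (1 - z) ^+ 4 = (cmod (1 - z) ^+ 2) ^+ 2 by rewrite -exprM.
    have -> : 400 * (1 - cmod z) ^+ 2 = (20 * (1 - cmod z)) ^+ 2 by ring.
    rewrite ler_pXn2r ?nnegrE ?sqr_ge0//; first by move: hz; rewrite /k; lra.
    by rewrite mulr_ge0// ltW.
  apply: (@le_trans _ _ (M / (1 - cmod z) * (M' / (1 - cmod z)) *
      (400 * (1 - cmod z) ^+ 2))).
    by apply: ler_pM => //; [exact: mulr_ge0|rewrite exprn_ge0 ?cmod_ge0|exact: ler_pM].
  rewrite le_eqVlt; apply/orP; left; apply/eqP; field.
  by rewrite gt_eqF.
move: H; rewrite !big_cat/= !big_map.
rewrite !big_cons big_nil addr0 /reflect_out cmod1 lexx /penalty cmod1 ltxx mulr0.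
rewrite addr0 contribution1// -/(reflect_out _).
have c1 : 0 <= 2 * atan (D / (D + 11 / 10)).
  by rewrite mulr_ge0// atan_ge0// divr_ge0//; lra.
rewrite addrA -big_split/= => H.
have : \sum_(w <- zs) (pi - carg w - offset D) <= \sum_(w <- zs)
   ((contribution D (reflect_out (param w)) + 6 * D / b * penalty (param w)) +
   (contribution D (reflect_out (param (mirror w))) +
      6 * D / b * penalty (param (mirror w)))).
  rewrite big_seq [leRHS]big_seq; apply: ler_sum => w wz.
  by apply: pair_lower => //; exact: zs0.
have cst : \sum_(w <- zs) offset D = (size zs)%:R * offset D.
  by rewrite big_const_seq count_predT iter_addr_0 mulr_natl.
rewrite sumrB cst.
have [_ /(ler_wpM2l (ler0n R (size zs)))] := offset_bounds D0.
have -> : 20 / 3 * D * Lam = 6 * D / b * Lam by rewrite /b; field.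
move: H; rewrite /reflect_out /penalty; lra.
Qed.

Lemma growth_rotate zs M (c : C) : cmod c = 1 -> growth zs M ->
  growth [seq c * w | w <- zs] M.
Proof.
move=> c1 g z z1; rewrite big_map.
have c0 : c != 0 by rewrite -cmod_gt0 c1.
have := g (z / c); rewrite cmodM cmodV c1 invr1 mulr1 => /(_ z1).
apply: le_trans; rewrite le_eqVlt; apply/orP; left; apply/eqP.
by apply: eq_bigr => w _; rewrite invfM mulrA.
Qed.

Lemma growth_conj zs M : growth zs M -> growth [seq conjc w | w <- zs] M.
Proof.
move=> g z z1; rewrite big_map.
have := g (conjc z); rewrite cmodJ => /(_ z1).
apply: le_trans; rewrite le_eqVlt; apply/orP; left; apply/eqP.
apply: eq_bigr => w _; rewrite -cmodJ rmorphB rmorph1 rmorphM fmorphV/=.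
by rewrite conjcK.
Qed.

Lemma mirror_rotate zs (c : C) : cmod c = 1 ->
  [seq mirror w | w <- [seq c * w | w <- zs]] =
  [seq c * w | w <- [seq mirror w | w <- zs]].
Proof.
move=> c1; rewrite -!map_comp; apply: eq_map => w /=.
have c0 : c != 0 by rewrite -cmod_gt0 c1.
rewrite /mirror rmorphM invfM; congr (_ * _).
have nz : conjc c != 0 by rewrite conjc_eq0.
apply: (mulIf nz); rewrite mulVf//.
move: (congr1 (fun x => x ^+ 2) c1); rewrite sqr_cmod expr1n; case: (c) => x y /= e.
by apply/eqP; rewrite eq_complex/= -e; apply/andP; split; apply/eqP; ring.
Qed.

Lemma mirror_conj zs :
  [seq mirror w | w <- [seq conjc w | w <- zs]] =
  [seq conjc w | w <- [seq mirror w | w <- zs]].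
Proof.
rewrite -!map_comp; apply: eq_map => w /=.
by rewrite /mirror -conjc_inv.
Qed.

(** Equality holds except on the positive half-line, where both arguments
    vanish. *)
Lemma carg_conj w : w != 0 -> - (pi - carg w) <= pi - carg (conjc w).
Proof.
move=> w0; have cw0 : conjc w != 0 by rewrite conjc_eq0.
have [a0 a2 e] := cargP w0; have [b0 b2 _] := cargP cw0.
have [c0|c0] := eqVneq (carg w) 0.
  suff -> : carg (conjc w) = 0 by rewrite c0; have := pi_gt0 R; lra.
  have p := polar_carg cw0.
  apply: (polar_inj p); last by rewrite subr0 ger0_norm.
  exists (cmod w); first by rewrite cmod_gt0.
  rewrite {1}e c0 cos0 sin0 expi0 mulr0 mulr1.
  by apply/eqP; rewrite eq_complex/=; apply/andP; split; apply/eqP; ring.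
suff -> : carg (conjc w) = 2 * pi - carg w by lra.
have p := polar_carg cw0; apply: (polar_inj p).
  exists (cmod w); first by rewrite cmod_gt0.
  rewrite {1}e /expi mulr_natl addrC cosD2pi sinD2pi cosN sinN.
  by apply/eqP; rewrite eq_complex/=; apply/andP; split; apply/eqP; ring.
have : 0 < carg w by rewrite lt_neqAle eq_sym c0.
by move=> ?; rewrite ltr_norml; apply/andP; split; lra.
Qed.

(** The lower bound is the upper bound for the conjugate zeros. *)
Theorem sum_carg_bound zs M M' D : 7 / 4 <= D -> (forall w, w \in zs -> w != 0) ->
    growth zs M -> growth [seq mirror w | w <- zs] M' ->
  `|\sum_(w <- zs) (pi - carg w)| <=
    (size zs)%:R * (11 / 5 / D) + 20 / 3 * D * (ln M + ln M' + 2 * ln 20).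
Proof.
move=> D74 zs0 g g'; rewrite ler_norml; apply/andP; split; last exact: sum_carg_le.
have c0 w : w \in [seq conjc w | w <- zs] -> w != 0.
  by move=> /mapP[x xz ->]; rewrite conjc_eq0 zs0.
have := @sum_carg_le [seq conjc w | w <- zs] M M' D D74 c0 (growth_conj g).
rewrite mirror_conj => /(_ (growth_conj g')); rewrite size_map big_map lerNl.
apply: le_trans; rewrite -sumrN big_seq [leRHS]big_seq; apply: ler_sum => w wz.
by apply: carg_conj; exact: zs0.
Qed.

Lemma carg_rotate w (a : R) : w != 0 -> 0 <= a -> a < 2 * pi ->
  carg (expi (- a) * w) = if a <= carg w then carg w - a else carg w - a + 2 * pi.
Proof.
move=> w0 a0 a2; have e1 : cmod (expi (- a)) = 1.
  by rewrite cmodE/= cos2Dsin2 sqrtr1.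
have ew0 : expi (- a) * w != 0 by rewrite -cmod_gt0 cmodM e1 mul1r cmod_gt0.
have [c0 c2 _] := cargP w0; have [d0 d2 _] := cargP ew0.
have pa : polar (expi (- a) * w) (- a + carg w).
  apply: polarM; last exact: polar_carg.
  by exists 1 => //; rewrite mul1r.
have p := polar_carg ew0; case: ifPn => [h|]; last rewrite -ltNge => h.
  rewrite addrC; apply: (polar_inj p) => //.
  by rewrite ltr_norml; apply/andP; split; lra.
apply: (polar_inj p).
  have -> : carg w - a + 2 * pi = (- a + carg w) + 2 * pi by ring.
  case: pa => r r0 ->; exists r => //.
  by rewrite /expi mulr_natl cosD2pi sinD2pi.
by rewrite ltr_norml; apply/andP; split; lra.
Qed.

(** Subtracting the sums of arguments measured from the two sides of a sector
    counts the zeros in it. *)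
Theorem sector_count_bound zs M M' D (alpha beta : R) :
    7 / 4 <= D -> (forall w, w \in zs -> w != 0) ->
    growth zs M -> growth [seq mirror w | w <- zs] M' ->
    0 <= alpha -> alpha < beta -> beta < 2 * pi ->
  `|2 * pi * (count (fun w => alpha <= carg w < beta) zs)%:R
      - (size zs)%:R * (beta - alpha)| <=
    2 * ((size zs)%:R * (11 / 5 / D) + 20 / 3 * D * (ln M + ln M' + 2 * ln 20)).
Proof.
move=> D74 zs0 g g' a0 ab b2.
have rot (a : R) : 0 <= a -> a < 2 * pi ->
  `|\sum_(w <- zs) (pi - carg (expi (- a) * w))| <=
    (size zs)%:R * (11 / 5 / D) + 20 / 3 * D * (ln M + ln M' + 2 * ln 20).
  move=> a0' a2'; have e1 : cmod (expi (- a)) = 1.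
    by rewrite cmodE/= cos2Dsin2 sqrtr1.
  have c0 w : w \in [seq expi (- a) * w | w <- zs] -> w != 0.
    by move=> /mapP[x xz ->]; rewrite -cmod_gt0 cmodM e1 mul1r cmod_gt0 zs0.
  have := @sum_carg_bound [seq expi (- a) * w | w <- zs] M M' D D74 c0 (growth_rotate e1 g).
  rewrite mirror_rotate// => /(_ (growth_rotate e1 g')).
  by rewrite size_map big_map.
have ha := rot alpha a0 (lt_trans ab b2).
have hb := rot beta (le_trans a0 (ltW ab)) b2.
have -> : 2 * pi * (count (fun w => alpha <= carg w < beta) zs)%:R
      - (size zs)%:R * (beta - alpha) =
   \sum_(w <- zs) (pi - carg (expi (- alpha) * w)) -
   \sum_(w <- zs) (pi - carg (expi (- beta) * w)).
  rewrite -sumrB -sum1_count natr_sum mulr_sumr big_mkcond/=.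
  have -> : (size zs)%:R * (beta - alpha) = \sum_(w <- zs) (beta - alpha).
    by rewrite big_const_seq count_predT iter_addr_0 mulr_natl.
  rewrite -sumrB big_seq [RHS]big_seq; apply: eq_bigr => w wz.
  rewrite !carg_rotate ?zs0//; [|lra|lra].
  have [h1|h1] := leP alpha (carg w); have [h2|h2] := leP beta (carg w) => /=;
    lra.
rewrite (le_trans (ler_normB _ _))//; lra.
Qed.

End Growth.

(** * The equidistribution theorem for polynomials with bounded coefficients *)

Section Constants.
Variable R : realType.

Lemma atan_sub_ge (x y : R) : 0 <= y <= x ->
  (x - y) / (1 + x ^+ 2) <= atan x - atan y.
Proof.
move=> /andP[y0]; rewrite le_eqVlt => /predU1P[->|yx].
  by rewrite !subrr mul0r.
have datan z : z \in `]y, x[ -> is_derive z 1 (@atan R) (1 + z ^+ 2)^-1.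
  by move=> _; exact: is_derive1_atan.
have catan : {within `[y, x], continuous (@atan R)}.
  by apply: derivable_within_continuous => z _; exact: ex_derive.
have [c /[!in_itv]/= /andP[yc cx] ->] := MVT yx datan catan.
rewrite mulrC ler_wpM2r ?subr_ge0 ?(ltW yx)// lef_pV2 ?posrE ?ltr_pwDl ?sqr_ge0//.
have c0 : 0 <= c by rewrite (le_trans y0)// ltW.
by rewrite lerD2l ler_pXn2r ?nnegrE ?(ltW cx)// (le_trans c0)// ltW.
Qed.

Lemma pi_ge : 288 / 100 <= pi :> R.
Proof.
have a1 : 4 * atan 1 = pi :> R by rewrite atan1; field.
have h1 := @atan_sub_ge (1 / 4) 0 ltac:(by apply/andP; split; lra).
have h2 := @atan_sub_ge (2 / 4) (1 / 4) ltac:(by apply/andP; split; lra).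
have h3 := @atan_sub_ge (3 / 4) (2 / 4) ltac:(by apply/andP; split; lra).
have h4 := @atan_sub_ge 1 (3 / 4) ltac:(by apply/andP; split; lra).
have e1 : (1 / 4 - 0) / (1 + (1 / 4) ^+ 2) = 4 / 17 :> R by field.
have e2 : (2 / 4 - 1 / 4) / (1 + (2 / 4) ^+ 2) = 1 / 5 :> R by field.
have e3 : (3 / 4 - 2 / 4) / (1 + (3 / 4) ^+ 2) = 4 / 25 :> R by field.
have e4 : (1 - 3 / 4) / (1 + 1 ^+ 2) = 1 / 8 :> R by field.
rewrite e1 atan0 in h1; rewrite e2 in h2; rewrite e3 in h3; rewrite e4 in h4.
lra.
Qed.

Lemma alternating_sum_bound (d : nat -> R) (n : nat) :
  (forall k, 0 <= d k.+1 <= d k) ->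
  0 <= \sum_(0 <= k < n) (-1) ^+ k * d k <= d 0%N.
Proof.
elim: n d => [|n ih] d hd.
  by rewrite big_geq// lexx; have /andP[h1 h2] := hd 0%N; rewrite (le_trans h1).
rewrite big_nat_recl// expr0 mul1r.
have -> : \sum_(0 <= k < n) (-1) ^+ k.+1 * d k.+1 =
    - \sum_(0 <= k < n) (-1) ^+ k * d k.+1.
  by rewrite -sumrN; apply: eq_bigr => i _; rewrite exprS; ring.
have /andP[h1 h2] := ih (fun k => d k.+1) (fun k => hd k.+1).
have /andP[h3 h4] := hd 0%N.
by apply/andP; split; lra.
Qed.

Lemma catalan_bounds : 0 < catalan R /\ catalan R <= 1.
Proof.
pose d (k : nat) : R := ((2 * k + 1)%:R ^+ 2)^-1.
pose u (k : nat) : R := (-1) ^+ k / (2 * k + 1)%:R ^+ 2.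
have dpos k : 0 < (2 * k + 1)%:R ^+ 2 :> R by rewrite exprn_gt0// ltr0n addn1.
have dd k : 0 <= d k.+1 <= d k.
  rewrite /d invr_ge0 ltW//= lef_pV2 ?posrE// ler_pXn2r ?nnegrE//.
  by rewrite ler_nat; lia.
have cu : cvgn (series u).
  apply: normed_cvg; apply: nondecreasing_is_cvgn.
    apply/nondecreasing_seqP => n; rewrite /= /series/= big_nat_recr//=.
    by rewrite lerDl.
  exists 2 => _ [n _ <-]; rewrite /= /series/=.
  suff h : \sum_(0 <= k < n) `|u k| <= 2 - 2 / n.+1%:R.
    by rewrite (le_trans h)// lerBlDr lerDl divr_ge0.
  elim: n => [|n ih]; first by rewrite big_geq// divr1 subrr.
  rewrite big_nat_recr//= (le_trans (lerD ih (lexx _)))//.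
  have -> : `|u n| = ((2 * n + 1)%:R ^+ 2)^-1.
    by rewrite /u normrM normrX normrN1 expr1n mul1r ger0_norm// invr_ge0 ltW.
  rewrite -lerBrDl.
  have -> : 2 - 2 / n.+2%:R - (2 - 2 / n.+1%:R) = 2 / (n.+1%:R * n.+2%:R) :> R.
    by field; rewrite !gt_eqF// ltr_pwDl.
  rewrite -[leLHS]mul1r ler_pdivrMr// mulrAC ler_pdivlMr ?mulr_gt0 ?ltr0n//.
  rewrite mul1r -natrM -natrX -natrM ler_nat; nia.
have cl : catalan R = limn (series u) by [].
have S n : 8 / 9 <= series u n.+1 <= 1.
  rewrite /series/= big_nat_recl// /u expr0 muln0 add0n expr1n divr1.
  have -> : \sum_(0 <= k < n) ((-1) ^+ k.+1 / (2 * k.+1 + 1)%:R ^+ 2 : R) =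
    - \sum_(0 <= k < n) (-1) ^+ k * d k.+1.
    by rewrite -sumrN; apply: eq_bigr => i _; rewrite exprS /d mulN1r mulNr.
  have /andP[h1 h2] := @alternating_sum_bound (fun k => d k.+1) n (fun k => dd k.+1).
  have d1 : d 1%N = 1 / 9.
    by rewrite /d -natrX; field.
  by rewrite d1 in h2; apply/andP; split; lra.
have h8 : 8 / 9 <= catalan R.
  rewrite cl; apply: limr_ge => //.
  by exists 1%N => // n /= n1; rewrite -(prednK n1); have /andP[] := S n.-1.
split; first lra.
rewrite cl; apply: limr_le => //.
by exists 1%N => // n /= n1; rewrite -(prednK n1); have /andP[] := S n.-1.
Qed.

(** [2 * pi / catalan R >= 2 * 2.88 = (24 / 10) ^+ 2]. *)
Lemma sector_const_ge (r : R) : 24 / 10 + 2 / (1 - r) <= sector_const r.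
Proof.
rewrite /sector_const lerD2r; have [c0 c1] := catalan_bounds.
rewrite -[leLHS]ger0_norm; last lra.
rewrite -sqrtr_sqr ler_sqrt; last by rewrite divr_ge0 ?ltW// mulr_gt0// pi_gt0.
rewrite ler_pdivlMr//; have := pi_ge => p.
apply: (@le_trans _ _ ((24 / 10) ^+ 2)); last lra.
by rewrite ler_piMr ?sqr_ge0.
Qed.

End Constants.

Section Deterministic.
Variable R : realType.
Local Notation C := R[i].
Implicit Types (zs : seq C) (M D r : R) (w z : C).

(** Jensen's inequality in the disc of radius [rho]: this is the nonnegativity
    of the bound in [reflected_power_sum_bound], with [kap = 0]. *)
Lemma count_small_zeros zs M r rho : growth zs M -> (forall w, w \in zs -> w != 0) ->
    0 < r -> r < rho -> rho < 1 ->
  (count (fun w => cmod w <= r) zs)%:R * ln (rho / r) <= ln (M / (1 - rho)).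
Proof.
move=> g zs0 r0 rrho rho1; have rho0 : 0 < rho by rewrite (lt_trans r0).
have M1 := growth_ge1 g; have d0 : 0 < 1 - rho by rewrite subr_gt0.
have Md : 0 < M / (1 - rho) by rewrite divr_gt0// (lt_le_trans ltr01).
have [|t t1|] := @reflected_power_sum_bound R [seq rho%:C%C / w | w <- zs] 0 0
    (ln (M / (1 - rho))).
- by rewrite cmod0.
- rewrite big_map expr0 mulr1 lnK ?posrE//.
  have rt : cmod (rho%:C%C * t) <= rho.
    by rewrite cmodM cmod_real gtr0_norm// ler_piMr ?ltW.
  have rt1 : cmod (rho%:C%C * t) < 1 by rewrite (le_lt_trans rt).
  have -> : \prod_(w <- zs) cmod (1 - rho%:C%C / w * t) =
      \prod_(w <- zs) cmod (1 - (rho%:C%C * t) / w).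
    by apply: eq_bigr => w _; rewrite mulrAC.
  rewrite (le_trans (g _ rt1))// ler_wpM2l ?(le_trans ler01)//.
  by rewrite lef_pV2 ?posrE// ?subr_gt0// lerD2l lerN2.
rewrite subr_ge0 big_map => h _; rewrite (le_trans _ h)//.
rewrite -sum1_count natr_sum mulr_suml big_mkcond [leRHS]big_mkcond/=.
rewrite big_seq [leRHS]big_seq; apply: ler_sum => w wz.
have w0 : 0 < cmod w by rewrite cmod_gt0 zs0.
have cE : cmod (rho%:C%C / w) = rho / cmod w.
  by rewrite cmodM cmodV cmod_real gtr0_norm.
rewrite cE; case: ifPn => [wr|_].
  have h1 : rho / r <= rho / cmod w.
    by rewrite ler_pM2l// lef_pV2 ?posrE.
  have h2 : 1 < rho / r by rewrite ltr_pdivlMr// mul1r.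
  rewrite (lt_le_trans h2 h1) mul1r ler_ln ?posrE//.
    by rewrite (lt_trans ltr01).
  by rewrite divr_gt0.
by case: ifPn => // h1; rewrite ln_ge0// ltW.
Qed.

(** The radius in the unit disc used to count the zeros outside the annulus;
    it satisfies [ln (jensen_radius r / r) = 1 - r]. *)
Definition jensen_radius r : R := r * expR (1 - r).

Lemma jensen_radius_bounds r : 0 < r -> r < 1 ->
  [/\ r < jensen_radius r, jensen_radius r < 1 & ln (jensen_radius r / r) = 1 - r].
Proof.
move=> r0 r1; split.
- rewrite /jensen_radius -[ltLHS]mulr1 ltr_pM2l//.
  by rewrite expR_gt1 subr_gt0.
- have : 1 + (r - 1) < expR (r - 1) by rewrite expR_gt1Dx// subr_eq0 lt_eqF.
  rewrite addrCA subrr addr0 => h.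
  rewrite /jensen_radius -ltr_pdivlMr ?expR_gt0// div1r -expRN opprB//.
- by rewrite /jensen_radius mulrAC divff ?gt_eqF// mul1r expRK.
Qed.

(** The additive constant left by the tangent disc, [ln 20], and by the count
    of the zeros outside the annulus. *)
Definition height_offset r : R := ln 20 - ln (1 - jensen_radius r).

Lemma ln_one_sub_jensen r : 0 < r -> r < 1 -> ln (1 - jensen_radius r) <= 0.
Proof.
move=> r0 r1; have [h1 h2 _] := jensen_radius_bounds r0 r1.
by rewrite ln_le0// gerBl (le_trans _ (ltW h1))// ltW.
Qed.

Lemma height_offset_gt0 r : 0 < r -> r < 1 -> 0 < height_offset r.
Proof.
move=> r0 r1; have := ln_one_sub_jensen r0 r1.
have : 0 < ln (20 : R) by rewrite ln_gt0//; lra.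
by rewrite /height_offset; lra.
Qed.

Definition in_sector r (alpha beta : R) w : bool :=
  (r < cmod w < r^-1) && (alpha <= carg w < beta).

(** Equidistribution with a constant strictly smaller than [sector_const r],
    at the price of the additive term [height_offset r]. The distance [D] of
    the sample points is chosen to balance the two terms of
    [sector_count_bound]. *)
Theorem growth_equidistribution zs M M' r (alpha beta : R) :
    (0 < size zs)%N -> (forall w, w \in zs -> w != 0) ->
    growth zs M -> growth [seq mirror w | w <- zs] M' ->
    0 < r -> r < 1 -> 0 <= alpha -> alpha < beta -> beta < 2 * pi ->
  `|(count (in_sector r alpha beta) zs)%:R / (size zs)%:R
      - (beta - alpha) / (2 * pi)|
  <= (23 / 10 + 2 / (1 - r)) *
     Num.sqrt (((ln M + ln M') / 2 + height_offset r) / (size zs)%:R).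
Proof.
move=> n0 zs0 g g' r0 r1 a0 ab b2.
have p0 := pi_gt0 R; have p28 := pi_ge R.
set n := (size zs)%:R : R; have npos : 0 < n by rewrite ltr0n.
set q := 2 / (1 - r).
have q2 : 2 <= q by rewrite ler_pdivlMr ?subr_gt0//; lra.
have M1 := growth_ge1 g; have M'1 := growth_ge1 g'.
have lM : 0 <= ln M by rewrite ln_ge0.
have lM' : 0 <= ln M' by rewrite ln_ge0.
have h0 := height_offset_gt0 r0 r1.
set L := (ln M + ln M') / 2 + height_offset r.
have L0 : 0 < L by rewrite /L; lra.
set s := Num.sqrt (L / n).
have s0 : 0 < s by rewrite sqrtr_gt0 divr_gt0.
have s2 : s ^+ 2 = L / n by rewrite sqr_sqrtr// divr_ge0// ltW.
set N := count (in_sector r alpha beta) zs.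
set Ns := count (fun w => alpha <= carg w < beta) zs.
pose Ni := count (fun w => cmod w <= r) zs.
pose No := count (fun w => r^-1 <= cmod w) zs.
have x0 : 0 <= (beta - alpha) / (2 * pi).
  by rewrite divr_ge0 ?mulr_ge0 ?(ltW p0)//; lra.
have x1 : (beta - alpha) / (2 * pi) <= 1.
  by rewrite ler_pdivrMr ?mulr_gt0//; lra.
have y0 : 0 <= N%:R / n by rewrite divr_ge0// ltW.
have y1 : N%:R / n <= 1.
  by rewrite ler_pdivrMr// mul1r ler_nat count_size.
have [s24|s24] := leP (24 / 100) s.
  apply: (@le_trans _ _ 1); first by rewrite ler_norml; apply/andP; split; lra.
  nra.
pose D := 42 / 100 / s.
have D74 : 7 / 4 <= D by rewrite ler_pdivlMr//; lra.
have := @sector_count_bound R zs M M' D alpha beta D74 zs0 g g' a0 ab b2.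
rewrite -/n -/Ns => hs.
have [rj1 rj2 rj3] := jensen_radius_bounds r0 r1.
set rho := jensen_radius r in rj1 rj2 rj3.
have d0 : 0 < 1 - rho by rewrite subr_gt0.
have Md (X : R) : 1 <= X -> ln (X / (1 - rho)) = ln X - ln (1 - rho).
  by move=> X1; rewrite ln_div ?posrE// (lt_le_trans ltr01).
have hi : Ni%:R * (1 - r) <= ln M - ln (1 - rho).
  by rewrite -rj3 -Md//; exact: count_small_zeros.
have ho : No%:R * (1 - r) <= ln M' - ln (1 - rho).
  rewrite -rj3 -Md//.
  have -> : No = count (fun w => cmod w <= r) [seq mirror w | w <- zs].
    rewrite count_map /No; apply: eq_in_count => w wz /=.
    rewrite /mirror cmodV cmodJ -[in RHS](invrK r) lef_pV2 ?posrE ?invr_gt0//.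
    by rewrite cmod_gt0 zs0.
  apply: count_small_zeros => // w /mapP[x xz ->].
  by rewrite /mirror invr_eq0 conjc_eq0 zs0.
have hsplit : (Ns <= N + Ni + No)%N.
  rewrite /Ns /N /Ni /No; elim: (zs) => [//|w t ih] /=.
  have : ((alpha <= carg w < beta)%R <= in_sector r alpha beta w +
     (cmod w <= r)%R + (r^-1 <= cmod w)%R)%N.
    rewrite /in_sector; case: (alpha <= carg w < beta); rewrite ?andbF// andbT.
    by case: (ltP r (cmod w)) => _ /=; case: (ltP (cmod w) r^-1).
  move=> h; rewrite (leq_trans (leq_add h ih))//.
  by rewrite addnACA [X in (X + _)%N]addnACA.
have hle : (N <= Ns)%N by apply: sub_count => w /andP[].
clear zs0 g g' M1 M'1 Md rj1 rj2 rj3 d0.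
have out : Ni%:R + No%:R <= q * L.
  have : (Ni%:R + No%:R) * (1 - r) <= 2 * L.
    rewrite /L /height_offset -/rho.
    have : 0 < ln (20 : R) by rewrite ln_gt0//; lra.
    lra.
  by rewrite -ler_pdivlMr ?subr_gt0// /q [leRHS]mulrAC.
have outn : (Ni%:R + No%:R) / n <= q * s ^+ 2.
  by rewrite s2 mulrA ler_pM2r ?invr_gt0.
clear hi ho out.
have {}hs : `|Ns%:R / n - (beta - alpha) / (2 * pi)| <= 377 / 100 * s.
  have -> : Ns%:R / n - (beta - alpha) / (2 * pi) =
     (2 * pi * Ns%:R - n * (beta - alpha)) / (2 * pi * n).
    have aux (x y c e : R) : y != 0 -> e != 0 ->
        x / y - c / (2 * e) = (2 * e * x - y * c) / (2 * e * y).
      by move=> hy he; field; rewrite hy he.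
    by apply: aux; rewrite gt_eqF.
  rewrite normrM [X in _ * X]ger0_norm; last by rewrite invr_ge0 !mulr_ge0 ?ltW.
  rewrite ler_pdivrMr; last by rewrite !mulr_gt0.
  rewrite (le_trans hs)//.
  have e1 : ln M + ln M' + 2 * ln 20 <= 2 * L.
    by rewrite /L /height_offset; have := ln_one_sub_jensen r0 r1; lra.
  have LE : L = n * s ^+ 2 by rewrite s2 mulrCA divff ?gt_eqF// mulr1.
  have e2 : 20 / 3 * D * (ln M + ln M' + 2 * ln 20) <= 56 / 10 * (n * s).
    apply: (@le_trans _ _ (20 / 3 * D * (2 * L))).
      by rewrite ler_wpM2l// mulr_ge0//; lra.
    by rewrite LE /D le_eqVlt; apply/orP; left; apply/eqP; field; rewrite gt_eqF.
  have e3 : n * (11 / 5 / D) = 110 / 21 * (n * s).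
    by rewrite /D; field; rewrite gt_eqF.
  have ns : 0 < n * s by rewrite mulr_gt0.
  have : pi * (n * s) >= 288 / 100 * (n * s) by rewrite ler_wpM2r// ltW.
  rewrite e3; lra.
have hN : `|N%:R / n - Ns%:R / n| <= q * s ^+ 2.
  rewrite -mulrBl normrM [X in _ * X]ger0_norm ?invr_ge0 ?(ltW npos)//.
  rewrite (le_trans _ outn)// ler_pM2r ?invr_gt0//.
  rewrite distrC ger0_norm ?subr_ge0 ?ler_nat//.
  by rewrite lerBlDl addrA -!natrD ler_nat.
have -> : N%:R / n - (beta - alpha) / (2 * pi) =
  (N%:R / n - Ns%:R / n) + (Ns%:R / n - (beta - alpha) / (2 * pi)) by ring.
rewrite (le_trans (ler_normD _ _))//.
have : q * s ^+ 2 <= q * (24 / 100 * s).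
  by rewrite ler_wpM2l//; [lra|rewrite expr2 ler_wpM2r// ltW].
have : (q - 2) * s >= 0 by rewrite mulr_ge0 ?(ltW s0)//; lra.
lra.
Qed.

End Deterministic.

Section Polynomials.
Variable R : realType.
Local Notation C := R[i].
Implicit Types (p : {poly C}) (H : R) (z : C).

Lemma zeros_neq0 p w : p`_0 != 0 -> w \in zeros p -> w != 0.
Proof.
move=> p0; apply: contraTneq => -> {w}.
apply/negP => z0; move/eqP: p0; apply.
rewrite -horner_coef0 (zerosE p) hornerZ horner_prod.
by rewrite (big_rem 0)//= hornerXsubC subrr mul0r mulr0.
Qed.

Lemma horner_zeros p z : p.[z] = lead_coef p * \prod_(w <- zeros p) (z - w).
Proof.
rewrite {1}(zerosE p) hornerZ horner_prod; congr (_ * _).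
by apply: eq_bigr => w _; rewrite hornerXsubC.
Qed.

Lemma poly_growth p H : p`_0 != 0 -> (forall i, cmod p`_i <= H) ->
  growth (zeros p) (H / cmod p`_0).
Proof.
move=> p0 hH z z1; have H0 : 0 <= H := le_trans (cmod_ge0 _) (hH 0%N).
have c0 : 0 < cmod p`_0 by rewrite cmod_gt0.
have d : 0 < 1 - cmod z by rewrite subr_gt0.
have -> : \prod_(w <- zeros p) cmod (1 - z / w) = cmod p.[z] / cmod p`_0.
  rewrite -horner_coef0 !horner_zeros !cmodM invfM mulrACA.
  rewrite divff ?mul1r; last first.
    rewrite cmod_eq0 lead_coef_eq0; apply: contraNneq p0 => ->.
    by rewrite coef0.
  rewrite !cmod_prod -prodfV -big_split/= big_seq [RHS]big_seq.
  apply: eq_bigr => w /(zeros_neq0 p0) w0.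
  rewrite -cmodV -cmodM sub0r invrN mulrN mulrBl divff//.
  by rewrite opprB.
rewrite [leRHS]mulrAC ler_pM2r ?invr_gt0//.
rewrite horner_coef (le_trans (cmod_sum _ _ _))//.
apply: (@le_trans _ _ (\sum_(i < size p) H * cmod z ^+ i)).
  apply: ler_sum => i _; rewrite cmodM cmodX ler_wpM2r//.
  by rewrite exprn_ge0// cmod_ge0.
by rewrite -mulr_sumr ler_wpM2l// geometric_sum_le// cmod_ge0.
Qed.

(** [1 - z * conjc w] is, up to a power of [z], the factor of [w] at the point
    [(conjc z)^-1]: the reversed polynomial has the same coefficients. *)
Lemma poly_growth_mirror p H : p`_0 != 0 -> (forall i, cmod p`_i <= H) ->
  growth [seq mirror w | w <- zeros p] (H / cmod (lead_coef p)).
Proof.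
move=> p0 hH z z1; have H0 : 0 <= H := le_trans (cmod_ge0 _) (hH 0%N).
have pn0 : p != 0 by apply: contraNneq p0 => ->; rewrite coef0.
have c0 : 0 < cmod (lead_coef p) by rewrite cmod_gt0 lead_coef_eq0.
have d : 0 < 1 - cmod z by rewrite subr_gt0.
rewrite big_map.
have -> : \prod_(w <- zeros p) cmod (1 - z / mirror w) =
   \prod_(w <- zeros p) cmod (1 - z * conjc w).
  by apply: eq_bigr => w _; rewrite /mirror invrK.
have [->|z0] := eqVneq z 0.
  rewrite big1 => [|w _]; last by rewrite mul0r subr0 cmod1.
  by rewrite cmod0 subr0 divr1 ler_pdivlMr// mul1r lead_coefE hH.
pose y := (conjc z)^-1.
have cz0 : 0 < cmod z by rewrite cmod_gt0.
have -> : \prod_(w <- zeros p) cmod (1 - z * conjc w) =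
   cmod z ^+ (size p).-1 * cmod p.[y] / cmod (lead_coef p).
  rewrite horner_zeros cmodM mulrCA mulrAC divff ?gt_eqF// mul1r.
  rewrite -size_zeros// cmod_prod.
  have -> : cmod z ^+ size (zeros p) = \prod_(w <- zeros p) cmod z.
    by rewrite big_const_seq count_predT iter_mulr_1.
  rewrite -big_split/=; apply: eq_bigr => w _.
  rewrite -[cmod z]cmodJ -cmodM /y mulrBr divff ?conjc_eq0//.
  by rewrite -cmodJ rmorphB rmorph1 rmorphM/= conjcK.
rewrite [leRHS]mulrAC ler_pM2r ?invr_gt0//.
have cy : cmod y = (cmod z)^-1 by rewrite /y cmodV cmodJ.
rewrite horner_coef (le_trans (ler_wpM2l _ (cmod_sum _ _ _))) ?exprn_ge0 ?cmod_ge0//.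
apply: (@le_trans _ _ (\sum_(i < size p) H * cmod z ^+ i)); last first.
  by rewrite -mulr_sumr ler_wpM2l// geometric_sum_le// cmod_ge0.
rewrite mulr_sumr (reindex_inj rev_ord_inj)/=; apply: ler_sum => i _.
rewrite cmodM cmodX cy mulrCA exprVn -expfB_cond; last first.
  by rewrite gt_eqF// ?add0n; case: (size p) i => [[]//|m] i /=; lia.
rewrite ler_pM ?cmod_ge0 ?exprn_ge0 ?cmod_ge0//.
have -> // : ((size p).-1 - (size p - i.+1) = i)%N.
by case: (size p) i => [[]//|m] i /=; have := ltn_ord i; lia.
Qed.

End Polynomials.

(** * A bound that is linear in the coefficient functionals *)

Section LinearBound.
Variable R : realType.
Local Notation C := (R[i]).
Implicit Types p : {poly C}.

Lemma poly_equidistribution p (n : nat) (H r alpha beta : R) :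
  size p = n.+1 -> (0 < n)%N -> p`_0 != 0 -> (forall i, cmod p`_i <= H) ->
  0 < r -> r < 1 -> 0 <= alpha -> alpha < beta -> beta < 2 * pi ->
  `|(count (in_sector r alpha beta) (zeros p))%:R / n%:R
    - (beta - alpha) / (2 * pi)| <=
  (23 / 10 + 2 / (1 - r)) * Num.sqrt
    ((ln H - (ln (cmod p`_0) + ln (cmod p`_n)) / 2 + height_offset r) / n%:R).
Proof.
move=> sp n0 p0 hH r0 r1 a0 ab b2.
have pn0 : p != 0 by rewrite -size_poly_eq0 sp.
have sz : size (zeros p) = n by rewrite size_zeros// sp.
have lc : lead_coef p = p`_n by rewrite lead_coefE sp.
have c0 : 0 < cmod p`_0 by rewrite cmod_gt0.
have cn : 0 < cmod p`_n by rewrite cmod_gt0 -lc lead_coef_eq0.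
have H0 : 0 < H by rewrite (lt_le_trans c0).
have g2 := poly_growth_mirror p0 hH; rewrite lc in g2.
have := growth_equidistribution _ (@zeros_neq0 _ p ^~ p0) (poly_growth p0 hH)
  g2 r0 r1 a0 ab b2.
rewrite sz => /(_ n0) h; apply: (le_trans h).
rewrite !lnM ?posrE ?invr_gt0// !lnV ?posrE//.
rewrite le_eqVlt; apply/orP; left; apply/eqP; congr (_ * Num.sqrt _).
by field; rewrite pnatr_eq0 -lt0n.
Qed.

Lemma sqrt_div_le_linear (x B n : R) : 0 <= x -> 0 < B -> 0 < n ->
  Num.sqrt (x / n) <= (x + B) / (2 * Num.sqrt (n * B)).
Proof.
move=> x0 B0 n0.
rewrite sqrtrM// sqrtrV ?(ltW n0)// sqrtrM ?(ltW n0)//.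
have s0 : 0 < Num.sqrt n by rewrite sqrtr_gt0.
have v0 : 0 < Num.sqrt B by rewrite sqrtr_gt0.
rewrite -{2}(sqr_sqrtr x0) -{1}(sqr_sqrtr (ltW B0)).
move: s0 v0 (Num.sqrt x) => s0 v0 u.
move: (Num.sqrt n) (Num.sqrt B) s0 v0 => s v s0 v0.
rewrite ler_pdivlMr ?mulr_gt0//.
have -> : u / s * (2 * (s * v)) = 2 * u * v by field; rewrite gt_eqF.
have := sqr_ge0 (u - v); rewrite sqrrB; lra.
Qed.

Lemma ln_le_tangent (x m : R) : 0 < x -> 0 < m -> ln x <= ln m + x / m - 1.
Proof.
move=> x0 m0.
have q : 0 < x / m by rewrite divr_gt0.
have := @le_ln1Dx R (x / m - 1); rewrite ltrBrDr addNr => /(_ q).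
by rewrite addrC subrK lnM ?posrE ?invr_gt0// lnV ?posrE//; lra.
Qed.

(** Every square root and logarithm is replaced by a tangent, at the points [B]
    and [m] that will be the mean values: the bound becomes affine in [S],
    [ln (cmod p`_0)] and [ln (cmod p`_n)], and its expectation follows by
    linearity. *)
Lemma discrepancy_le_linear p (n : nat) (t m B r alpha beta : R) :
  size p = n.+1 -> (0 < n)%N -> p`_0 != 0 -> 0 < t -> 0 < m -> 0 < B ->
  0 < r -> r < 1 -> 0 <= alpha -> alpha < beta -> beta < 2 * pi ->
  `|(count (in_sector r alpha beta) (zeros p))%:R / n%:R
    - (beta - alpha) / (2 * pi)| <=
  (23 / 10 + 2 / (1 - r)) / (2 * Num.sqrt (n%:R * B)) *
    (t^-1 * (ln m + (\sum_(k < n.+1) cmod p`_k `^ t) / m - 1)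
     - (ln (cmod p`_0) + ln (cmod p`_n)) / 2
     + height_offset r + B).
Proof.
move=> sp n0 p0 t0 m0 B0 r0 r1 a0 ab b2.
set S := \sum_(k < _) _.
have pn0 : p != 0 by rewrite -size_poly_eq0 sp.
have c0 : 0 < cmod p`_0 by rewrite cmod_gt0.
have cn : 0 < cmod p`_n.
  by rewrite cmod_gt0; move: pn0; rewrite -lead_coef_eq0 lead_coefE sp.
have nn k : 0 <= cmod p`_k `^ t by exact: powR_ge0.
have Sk i : (i <= n)%N -> cmod p`_i `^ t <= S.
  move=> hi; rewrite /S (bigD1 (inord i : 'I_n.+1))//= inordK//.
  by rewrite lerDl sumr_ge0.
have S0 : 0 < S by rewrite (lt_le_trans _ (Sk 0%N _))// powR_gt0.
pose H := S `^ t^-1.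
have H0 : 0 < H by rewrite powR_gt0.
have hH i : cmod p`_i <= H.
  have [hi|hi] := leqP i n; last first.
    by rewrite nth_default ?sp// cmod0 ltW.
  have -> : cmod p`_i = (cmod p`_i `^ t) `^ t^-1.
    by rewrite -powRrM divff ?gt_eqF// powRr1// cmod_ge0.
  by apply: ge0_ler_powR; rewrite ?nnegrE ?invr_ge0 ?(ltW t0) ?(ltW S0)// Sk.
have l0 : ln (cmod p`_0) <= ln H by rewrite ler_ln ?posrE.
have ln_ : ln (cmod p`_n) <= ln H by rewrite ler_ln ?posrE.
have ho := height_offset_gt0 r0 r1.
have K0 : 0 <= 23 / 10 + 2 / (1 - r).
  by rewrite addr_ge0 ?divr_ge0// subr_ge0 ltW.
apply: (le_trans (poly_equidistribution sp n0 p0 hH r0 r1 a0 ab b2)).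
have n0' : 0 < n%:R :> R by rewrite ltr0n.
have x0 : 0 <= ln H - (ln (cmod p`_0) + ln (cmod p`_n)) / 2 + height_offset r.
  lra.
apply: (le_trans (ler_wpM2l K0 (sqrt_div_le_linear x0 B0 n0'))).
rewrite -mulrA ler_wpM2l// mulrC ler_wpM2l ?invr_ge0 ?mulr_ge0 ?sqrtr_ge0//.
rewrite !lerD2r /H ln_powR ler_wpM2l ?invr_ge0 ?(ltW t0)//.
exact: ln_le_tangent.
Qed.

End LinearBound.

(** * Measurability and integrals of the coefficient functionals *)

Section CountingMeasure.
Variable R : realType.
Local Notation C := (R[i]).

Lemma zero_counting_measure_sector (p : {poly C}) (n : nat) (r alpha beta : R) :
  size p = n.+1 ->
  zero_counting_measure p (annular_sector r alpha beta) =
  ((count (in_sector r alpha beta) (zeros p))%:R / n%:R)%:E.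
Proof.
move=> sp; have pn0 : p != 0 by rewrite -size_poly_eq0 sp.
have sz : size (zeros p) = n by rewrite size_zeros// sp.
rewrite /zero_counting_measure/= /mscale/= /msum/= sp/=.
rewrite [X in (_ * X)%E](_ : _ = (count (in_sector r alpha beta) (zeros p))%:R%:E).
  by rewrite -EFinM mulrC.
rewrite -sum1_count big_mkcond/= (big_nth 0) sz big_mkord natr_sum -sumEFin.
set S := annular_sector r alpha beta.
have dE k : dirac (k : borelC R) S = (nat_of_bool (in_sector r alpha beta k))%:R%:E :> \bar R.
  rewrite /dirac indicE; congr (_%:R%:E); congr nat_of_bool.
  by apply/idP/idP => [/set_mem[a b]|/andP[a b]]; [apply/andP|apply/mem_set].
under eq_bigr do rewrite dE.
by rewrite [RHS]big_mkcond; apply: eq_bigr => k _; case: ifP.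
Qed.

End CountingMeasure.

Section Measurability.
Variables (R : realType).

Lemma measurable_cmod : measurable_fun setT (@cmod R : borelC R -> R).
Proof.
apply: (measurability _ (RGenOInfty.measurableE R)).
move=> _ [_ [a ->] <-]; rewrite setTI; apply: sub_sigma_algebra.
rewrite openE => z /=; rewrite in_itv/= andbT => az.
apply/(@nbhs_ballP R[i] (R[i]^o)).
exists (cmod z - a)%:C%C; first by rewrite /= ltcR subr_gt0.
move=> y; rewrite /ball/= ltcR in_itv/= andbT => zy.
have := cmodB_ge z y; have : cmod (z - y) < cmod z - a by exact: zy.
lra.
Qed.

Lemma measurable_lne d (T : measurableType d) (f : T -> R) :
  measurable_fun setT f -> measurable_fun setT (fun x => lne (f x)%:E).
Proof.
move=> mf; apply: (@measurable_fun_ifT _ _ _ _ (fun _ => -oo%E)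
  (fun x => (ln (f x))%:E) (fun x => f x <= 0)) => //.
- exact: measurable_fun_ler.
- apply/measurable_EFinP; apply: (measurableT_comp _ mf).
  exact: measurable_ln.
Qed.

End Measurability.

Section Expectations.
Variables (R : realType) (d : measure_display) (T : measurableType d).
Variable P : probability T R.

(** The discrepancy of the zeros enters as [f], without a proof that it is
    measurable: monotonicity is that of a supremum over simple minorants. *)
Lemma ge0_le_integral_minorants (f g : T -> \bar R) :
  (forall w, 0 <= f w)%E -> (forall w, f w <= g w)%E ->
  (\int[P]_w f w <= \int[P]_w g w)%E.
Proof.
move=> f0 fg; have g0 w : (0 <= g w)%E by rewrite (le_trans (f0 w)).
rewrite !ge0_integralTE//; apply: ereal_sup_le => _ [h hf <-].
by exists h => // w; rewrite (le_trans (hf w)).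
Qed.

(** An integral that is not [-oo] and an integrable majorant bound the negative
    and the positive part. *)
Lemma integrable_le (f g : T -> \bar R) : measurable_fun setT f ->
  P.-integrable setT g -> (forall w, f w <= g w)%E ->
  (-oo < \int[P]_w f w)%E -> P.-integrable setT f.
Proof.
move=> mf ig fg lf.
have ifp : P.-integrable setT f^\+%E.
  apply: (le_integrable measurableT _ _ ig); first exact: measurable_funepos.
  move=> w _; rewrite gee0_abs ?funepos_ge0//.
  by rewrite unlock ge_max abse_ge0 (le_trans (fg w)) ?lee_abs.
have fpfin : (\int[P]_w f^\+ w)%E \is a fin_num.
  exact: integrable_fin_num ifp.
have fnlt : (\int[P]_w f^\- w < +oo)%E.
  move: lf; rewrite integralE; move: fpfin.
  case: (\int[P]_w f^\+ w)%E => // a _.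
  by case: (\int[P]_w f^\- w)%E => // b _; rewrite ltry.
apply/integrableP; split => //.
rewrite (_ : (fun w => `|f w|)%E = (f^\+ \+ f^\-)%E); last exact: fune_abse.
rewrite ge0_integralD//; [|exact: measurable_funepos|exact: measurable_funeneg].
move: fpfin fnlt; case: (\int[P]_w f^\+ w)%E => // a _.
by case: (\int[P]_w f^\- w)%E => // b _; rewrite ltry.
Qed.

Lemma integrable_affine (f : T -> \bar R) (a b : R) : P.-integrable setT f ->
  P.-integrable setT (fun w => a%:E + b%:E * f w)%E.
Proof.
move=> hf; apply: integrableD => //; last exact: integrableZl.
exact: finite_measure_integrable_cst.
Qed.

Lemma integral_affine (f : T -> \bar R) (a b : R) : P.-integrable setT f ->
  (\int[P]_w (a%:E + b%:E * f w) = a%:E + b%:E * \int[P]_w f w)%E.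
Proof.
move=> hf; rewrite integralD//; last exact: integrableZl.
  have P1 := probability_setT P.
  by rewrite integral_cst// integralZl//= P1 mule1.
exact: finite_measure_integrable_cst.
Qed.

End Expectations.

Section LogModulus.
Variables (R : realType).
Local Notation C := (R[i]).

Lemma elogmodE (z : C) : z != 0 -> elogmod z = (ln (cmod z))%:E.
Proof. by move=> z0; rewrite /elogmod lne_EFin// cmod_gt0. Qed.

Lemma elogmod0 : elogmod (0 : C) = -oo%E.
Proof. by rewrite /elogmod cmod0 le0_lneNy. Qed.

Lemma elogmodM (x y : C) : elogmod (x * y) = (elogmod x + elogmod y)%E.
Proof.
have [->|x0] := eqVneq x 0; first by rewrite mul0r elogmod0 addNye.
have [->|y0] := eqVneq y 0.
  by rewrite mulr0 elogmod0 addeNy.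
by rewrite !elogmodE ?mulf_neq0// cmodM lnM ?posrE ?cmod_gt0.
Qed.

(** The logarithm is below its tangent at [m], applied to [cmod z `^ t]. *)
Lemma elogmod_le (z : C) (t m : R) : 0 < t -> 0 < m ->
  (elogmod z <= (t^-1 * (ln m - 1))%:E + (t^-1 / m)%:E * (cmod z `^ t)%:E)%E.
Proof.
move=> t0 m0; have [->|z0] := eqVneq z 0; first by rewrite elogmod0 leNye.
rewrite elogmodE// -EFinM -EFinD lee_fin.
have c0 : 0 < cmod z by rewrite cmod_gt0.
have := ln_le_tangent (powR_gt0 t c0) m0; rewrite ln_powR => h.
have : t^-1 * (t * ln (cmod z)) <= t^-1 * (ln m + cmod z `^ t / m - 1).
  by rewrite ler_wpM2l// invr_ge0 ltW.
rewrite mulrA mulVf ?gt_eqF// mul1r => /le_trans; apply.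
by rewrite le_eqVlt; apply/orP; left; apply/eqP; field; rewrite !gt_eqF.
Qed.

End LogModulus.

(** * Divergence of the normalized height *)

Section Height.
Variable R : realType.

Lemma sum_first_gt0 (a : nat -> R) (n : nat) : (forall k, 0 <= a k) ->
  0 < a 0%N -> 0 < \sum_(k < n.+1) a k.
Proof.
by move=> a0 a00; rewrite big_ord_recl ltr_pwDl// sumr_ge0.
Qed.

(** The hypotheses on [F0] and [Fn] are the inequalities of [elogmod_le] in the
    mean; at the optimal [m] they say [F0 <= t^-1 * ln (a 0)], and likewise for
    [Fn]. If the sums of [a] are unbounded then half of [ln (\sum_k a k)]
    survives the subtraction of [Fn / 2]; if they are bounded then [a n] tends
    to [0], and [Fn] to [-oo]. *)
Lemma height_diverges (a : nat -> R) (t F0 D : R) : 0 < t ->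
  (forall k, 0 <= a k) ->
  (forall m, 0 < m -> F0 <= t^-1 * (ln m - 1) + t^-1 / m * a 0%N) ->
  0 < a 0%N /\
  exists N : nat, forall n, (N <= n)%N -> forall Fn,
    (forall m, 0 < m -> Fn <= t^-1 * (ln m - 1) + t^-1 / m * a n) ->
    D <= t^-1 * ln (\sum_(k < n.+1) a k) - (F0 + Fn) / 2.
Proof.
move=> t0 a0 hF0.
have ti : 0 < t^-1 by rewrite invr_gt0.
have a00 : 0 < a 0%N.
  rewrite lt_neqAle a0 andbT; apply/eqP => e.
  have := hF0 _ (expR_gt0 (t * F0)); rewrite -e mulr0 addr0 expRK.
  rewrite mulrBr mulrA mulVf ?gt_eqF// mul1r mulr1; lra.
split => //.
have SE n : \sum_(k < n.+1) a k = series a n.+1 by rewrite seriesEord.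
have ndS : {homo series a : n m / (n <= m)%N >-> n <= m}.
  by apply/nondecreasing_seqP => n; rewrite seriesSr lerDl.
have s0 : series a 0%N = 0 by rewrite /series/= big_nil.
have S0 n : a 0%N <= series a n.+1.
  by rewrite (le_trans _ (ndS _ _ (ltn0Sn n)))// seriesSr s0 add0r.
have aS n : a n <= series a n.+1.
  rewrite seriesSr lerDr; apply: (le_trans _ (ndS 0%N n _)) => //.
  by rewrite s0.
have upper n Fn m : 0 < m -> a n <= m ->
    (forall m, 0 < m -> Fn <= t^-1 * (ln m - 1) + t^-1 / m * a n) ->
    Fn <= t^-1 * ln m.
  move=> m0 am /(_ m m0) /le_trans; apply.
  have : t^-1 / m * a n <= t^-1.
    by rewrite -mulrA ler_piMr ?(ltW ti)// mulrC ler_pdivrMr// mul1r.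
  rewrite mulrBr mulr1; lra.
have [[N hN]|bS] :=
    pselect (exists N, expR (2 * (t * (D + F0 / 2))) <= series a N).
  exists N => n Nn Fn hFn; rewrite SE.
  have Sp : 0 < series a n.+1 by rewrite (lt_le_trans a00).
  have h1 := upper _ _ _ Sp (aS n) hFn.
  have : t^-1 * (2 * (t * (D + F0 / 2))) <= t^-1 * ln (series a n.+1).
    rewrite ler_wpM2l ?(ltW ti)// -ler_expR lnK ?posrE//.
    by rewrite (le_trans hN)// ndS// ltnW.
  rewrite [_ * (2 * _)](_ : _ = 2 * (D + F0 / 2)); last by field; rewrite gt_eqF.
  lra.
have cS : cvgn (series a).
  apply: nondecreasing_is_cvgn => //.
  exists (expR (2 * (t * (D + F0 / 2)))) => _ [n _ <-].
  by rewrite leNgt; apply/negP => /ltW h; apply: bS; exists n.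
pose m := expR (2 * ln (a 0%N) - t * F0 - 2 * t * D).
have m0 : 0 < m by exact: expR_gt0.
have /cvgrPdist_le/(_ _ m0)[N _ hN] := cvg_series_cvg_0 cS.
exists N => n Nn Fn hFn; rewrite SE.
have am : a n <= m.
  by have := hN n Nn; rewrite /= sub0r normrN ger0_norm.
have := upper _ _ _ m0 am hFn; rewrite /m expRK.
have : t^-1 * ln (a 0%N) <= t^-1 * ln (series a n.+1).
  by rewrite ler_wpM2l ?(ltW ti)// ler_ln ?posrE// (lt_le_trans a00).
rewrite [t^-1 * (_ - _)](_ : _ = 2 * (t^-1 * ln (a 0%N)) - F0 - 2 * D);
  last by field; rewrite gt_eqF.
lra.
Qed.

End Height.

(** * Random polynomials *)

Section RandomPolynomials.
Variables (R : realType) (d : measure_display) (T : measurableType d).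
Variables (P : probability T R) (A : nat -> {RV P >-> borelC R}).
Local Notation C := (R[i]).
Variables (t : R) (t0 : 0 < t).

Local Notation X k := (fun w => (cmod (A k w) `^ t)%:E).
Local Notation f k := (fun w => elogmod (A k w)).
Local Notation E k := (fine (\int[P]_w (cmod (A k w) `^ t)%R%:E)%E).
Local Notation F k := (fine (\int[P]_w elogmod (A k w))%E).

Lemma measurable_cmod_RV k : measurable_fun setT (fun w => cmod (A k w)).
Proof. exact: (measurableT_comp (@measurable_cmod R)). Qed.

Lemma integrable_moment k : ('E_P[fun w => (cmod (A k w) `^ t)%R] < +oo)%E ->
  P.-integrable setT (X k).
Proof.
rewrite unlock => h; apply/integrableP; split.
  apply/measurable_EFinP.
  exact: (measurableT_comp (@measurable_powR R t) (measurable_cmod_RV k)).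
by under eq_integral do rewrite gee0_abs ?lee_fin ?powR_ge0//.
Qed.

Lemma integrable_elogmod k : P.-integrable setT (X k) ->
  (-oo < \int[P]_w elogmod (A k w))%E -> P.-integrable setT (f k).
Proof.
move=> iX; apply: (integrable_le _ (integrable_affine _ _ iX)).
  exact: measurable_lne (measurable_cmod_RV k).
by move=> w; exact: (elogmod_le _ t0 ltr01).
Qed.

Lemma mean_elogmod_le k m : P.-integrable setT (X k) ->
  P.-integrable setT (f k) -> 0 < m ->
  F k <= t^-1 * (ln m - 1) + t^-1 / m * E k.
Proof.
move=> iX ifk m0.
rewrite -lee_fin EFinD (EFinM (t^-1 / m)) !fineK; try exact: integrable_fin_num.
rewrite -integral_affine//; apply: le_integral => //.
  exact: integrable_affine.
by move=> w _; exact: elogmod_le.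
Qed.

Lemma size_random_poly n w : (A n w : C) != 0 ->
  size (random_poly A n w) = n.+1.
Proof. by move=> An; rewrite size_poly_eq. Qed.

Lemma coef_random_poly n w k : (k <= n)%N -> (random_poly A n w)`_k = A k w.
Proof. by move=> kn; rewrite coef_poly ltnS kn. Qed.

(** On the event that [A 0 * A n] vanishes the right-hand side of
    [discrepancy_le_linear], read with [elogmod], is [+oo]: the pointwise bound
    holds everywhere, and only its right-hand side has to be integrated. *)
Lemma mean_discrepancy_le_linear n (m B r alpha beta : R) :
  (0 < n)%N -> (forall k, (k <= n)%N -> P.-integrable setT (X k)) ->
  P.-integrable setT (f 0%N) -> P.-integrable setT (f n) ->
  0 < m -> 0 < B ->
  0 < r -> r < 1 -> 0 <= alpha -> alpha < beta -> beta < 2 * pi ->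
  (\int[P]_w `| zero_counting_measure (random_poly A n w)
       (annular_sector r alpha beta) - ((beta - alpha) / (2 * pi))%:E |
   <= ((23 / 10 + 2 / (1 - r)) / (2 * Num.sqrt (n%:R * B)) *
    (t^-1 * (ln m + (\sum_(k < n.+1) E k) / m - 1)
     - (F 0%N + F n) / 2 + height_offset r + B))%:E)%E.
Proof.
move=> n0 iX i0 in_ m0 B0 r0 r1 al0 ab b2.
set K := (23 / 10 + _) / _.
have K0 : 0 < K.
  have r10 : 0 < 1 - r by rewrite subr_gt0.
  by rewrite divr_gt0 ?addr_gt0 ?divr_gt0// mulr_gt0 ?sqrtr_gt0 ?mulr_gt0 ?ltr0n.
pose S w := (\sum_(k < n.+1) (cmod (A k w) `^ t)%R%:E)%E.
pose L w := (elogmod (A 0%N w) + elogmod (A n w))%E.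
pose a := t^-1 * (ln m - 1) + height_offset r + B.
pose h w := ((t^-1 / m)%:E * S w + (- 2^-1)%:E * L w)%E.
have iS : P.-integrable setT S.
  by apply: integrable_sum => // k _; apply: iX; rewrite -ltnS.
have iL : P.-integrable setT L by exact: integrableD.
have ih : P.-integrable setT h.
  by apply: integrableD => //; exact: integrableZl.
have intS : (\int[P]_w S w = (\sum_(k < n.+1) E k)%:E)%E.
  rewrite integral_sum//; last by move=> k; apply: iX; rewrite -ltnS.
  rewrite -sumEFin; apply: eq_bigr => k _; rewrite fineK//.
  by apply: integrable_fin_num => //; apply: iX; rewrite -ltnS.
have intL : (\int[P]_w L w = (F 0%N + F n)%:E)%E.
  by rewrite integralD// EFinD !fineK//; exact: integrable_fin_num.
have inth : (\int[P]_w h w =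
    (t^-1 / m * (\sum_(k < n.+1) E k) - 2^-1 * (F 0%N + F n))%:E)%E.
  rewrite integralD//; [|exact: integrableZl|exact: integrableZl].
  by rewrite !integralZl// intS intL -!EFinM -EFinD mulNr.
have -> : ((K * (t^-1 * (ln m + (\sum_(k < n.+1) E k) / m - 1)
     - (F 0%N + F n) / 2 + height_offset r + B))%:E =
   \int[P]_w ((K * a)%:E + K%:E * h w))%E.
  rewrite integral_affine// inth -EFinM -EFinD; congr (_ %:E).
  by rewrite /a; field; rewrite !gt_eqF.
apply: ge0_le_integral_minorants => w; first exact: abse_ge0.
have [z|/norP[z1 z2]] := boolP (((A 0%N w : C) == 0) || ((A n w : C) == 0)).
  have -> : h w = +oo%E.
    rewrite /h; have -> : L w = -oo%E.
      rewrite /L; case/orP: z => /eqP ->; first by rewrite elogmod0 addNye.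
      by rewrite elogmod0 addeNy.
    rewrite mulrNy sgrN gtr0_sg ?invr_gt0// mulN1e/= addey//.
    rewrite /S -EFin_sum_fine//.
  by rewrite mulry gtr0_sg// mul1e addey// leey.
have sp := size_random_poly z2.
have p0 : (random_poly A n w)`_0 != 0 by rewrite coef_random_poly.
have := discrepancy_le_linear sp n0 p0 t0 m0 B0 r0 r1 al0 ab b2.
rewrite (zero_counting_measure_sector _ _ _ sp) -EFinB abse_EFin -/K => hd.
rewrite /h /S /L !elogmodE// sumEFin !(=^~ EFinD, =^~ EFinM) lee_fin.
apply: (le_trans hd); rewrite !coef_random_poly//.
under eq_bigr => k _ do rewrite coef_random_poly -1?ltnS//.
rewrite le_eqVlt; apply/orP; left; apply/eqP.
by rewrite /a; field; rewrite !gt_eqF.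
Qed.

(** With the mean values as points of tangency the bound is
    [K * (1 + c / (2 * B)) * sqrt (B / n)], [c] being the height offset; as
    [5 * K * c <= B] this is at most [(K + 1 / 10) * sqrt (B / n)]. *)
Lemma mean_discrepancy_le n (r alpha beta : R) :
  (0 < n)%N -> (forall k, (k <= n)%N -> P.-integrable setT (X k)) ->
  P.-integrable setT (f 0%N) -> P.-integrable setT (f n) ->
  0 < E 0%N ->
  0 < r -> r < 1 -> 0 <= alpha -> alpha < beta -> beta < 2 * pi ->
  5 * (23 / 10 + 2 / (1 - r)) * height_offset r <=
    t^-1 * ln (\sum_(k < n.+1) E k) - (F 0%N + F n) / 2 ->
  (\int[P]_w `| zero_counting_measure (random_poly A n w)
       (annular_sector r alpha beta) - ((beta - alpha) / (2 * pi))%:E |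
   <= (sector_const r * Num.sqrt
     (n%:R^-1 * (t^-1 * ln (\sum_(k < n.+1) E k) - (F 0%N + F n) / 2)))%:E)%E.
Proof.
move=> n0 iX i0 in_ E0 r0 r1 al0 ab b2.
set m := \sum_(k < _) _; set B := t^-1 * _ - _; set K := 23 / 10 + _ => hB.
have r10 : 0 < 1 - r by rewrite subr_gt0.
have K0 : 0 < K by rewrite addr_gt0 ?divr_gt0.
have c0 := height_offset_gt0 r0 r1.
have B0 : 0 < B by rewrite (lt_le_trans _ hB)// !mulr_gt0.
have Ek k : 0 <= E k.
  by apply: fine_ge0; apply: integral_ge0 => w _; rewrite lee_fin powR_ge0.
have m0 : 0 < m by exact: (@sum_first_gt0 _ (fun k => E k)).
apply: (le_trans (mean_discrepancy_le_linear n0 iX i0 in_ m0 B0 r0 r1 al0 ab b2)).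
rewrite lee_fin -/m -/K divff ?gt_eqF// addrK.
rewrite [Z in Z + B](_ : _ = B + height_offset r); last by rewrite /B; ring.
have n0' : 0 < n%:R :> R by rewrite ltr0n.
have Cr := sector_const_ge r; have s0 : 0 < Num.sqrt (n%:R^-1 * B).
  by rewrite sqrtr_gt0 mulr_gt0 ?invr_gt0.
apply: (@le_trans _ _ ((K + 1 / 10) * Num.sqrt (n%:R^-1 * B))); last first.
  by rewrite ler_wpM2r ?(ltW s0)// (le_trans _ Cr)// /K; lra.
have -> : Num.sqrt (n%:R * B) = B / Num.sqrt (n%:R^-1 * B).
  have v0 : 0 < Num.sqrt B by rewrite sqrtr_gt0.
  have w0 : 0 < Num.sqrt (n%:R : R) by rewrite sqrtr_gt0.
  rewrite !sqrtrM ?invr_ge0 ?(ltW n0')// sqrtrV ?(ltW n0')//.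
  rewrite -{2}(sqr_sqrtr (ltW B0)); field.
  by rewrite !gt_eqF.
set s := Num.sqrt _ in s0 *.
rewrite [leLHS](_ : _ = s * (K * (2 * B + height_offset r) / (2 * B))); last first.
  by field; rewrite !gt_eqF.
rewrite mulrC ler_wpM2r ?(ltW s0)// ler_pdivrMr ?mulr_gt0//.
move: hB; rewrite -mulrA; set Kc := K * _.
rewrite mulrDr mulrDl -/Kc; lra.
Qed.

End RandomPolynomials.

Local Open Scope ereal_scope.

Theorem theorem2p1 (R : realType) (d : measure_display) (T : measurableType d)
  (P : probability T R) (A : nat -> {RV P >-> borelC R}) (t : R)
  (t_gt0 : (0 < t)%R) (r alpha beta : R) (r_gt0 : (0 < r)%R) (r_lt1 : (r < 1)%R)
  (alpha_ge0 : (0 <= alpha)%R) (alpha_lt_beta : (alpha < beta)%R)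
  (beta_lt2pi : (beta < 2 * pi)%R) :
  exists N : nat, forall n : nat, (N <= n)%N ->
    (forall k : nat, (k <= n)%N -> 'E_P[fun w => (cmod (A k w) `^ t)%R] < +oo) ->
    -oo < \int[P]_w elogmod (A 0%N w) ->
    -oo < \int[P]_w elogmod (A n w) ->
    \int[P]_w `| zero_counting_measure (random_poly A n w)
                   (annular_sector r alpha beta)
                 - ((beta - alpha) / (2 * pi))%:E |
    <= (sector_const r)%:E *
       sqrte (n%:R^-1%:E *
         (t^-1%:E * lne (\sum_(k < n.+1) 'E_P[fun w => (cmod (A k w) `^ t)%R])
          - 2^-1%:E * \int[P]_w elogmod ((A 0%N w : R[i]) * (A n w : R[i]))%R)).
Proof.
pose X k := fun w => (cmod (A k w) `^ t)%R.
pose E k := fine (\int[P]_w (cmod (A k w) `^ t)%R%:E).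
pose F k := fine (\int[P]_w elogmod (A k w)).
(* If a moment or the mean of [elogmod (A 0)] is infinite then the hypotheses
   fail for all large [n]. *)
have [allE|] := pselect (forall k, 'E_P[X k] < +oo); last first.
  by move=> /existsNP[k hk]; exists k => n kn /(_ k kn) /hk.
have [F0|hF0] := pselect (-oo < \int[P]_w elogmod (A 0%N w)); last first.
  by exists 0%N => n _ _ /hF0.
have iX k : P.-integrable setT (EFin \o X k) by exact: integrable_moment (allE k).
have i0 := integrable_elogmod t_gt0 (iX 0%N) F0.
have Ege0 k : (0 <= E k)%R.
  by apply: fine_ge0; apply: integral_ge0 => w _; rewrite lee_fin powR_ge0.
have [E0 [N hN]] := height_diverges (5 * (23 / 10 + 2 / (1 - r)) * height_offset r)
  t_gt0 Ege0 (fun m => mean_elogmod_le t_gt0 (iX 0%N) i0).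
exists N.+1 => n Nn _ _ Fn.
have n0 : (0 < n)%N by exact: leq_trans Nn.
have in_ := integrable_elogmod t_gt0 (iX n) Fn.
have hB := hN n (ltnW Nn) (F n) (fun m => mean_elogmod_le t_gt0 (iX n) in_).
have := mean_discrepancy_le t_gt0 n0 (fun k _ => iX k) i0 in_ E0 r_gt0 r_lt1
  alpha_ge0 alpha_lt_beta beta_lt2pi hB.
move=> /le_trans; apply; rewrite le_eqVlt; apply/orP; left; apply/eqP.
have -> : \sum_(k < n.+1) 'E_P[X k] = (\sum_(k < n.+1) E k)%:E.
  rewrite -sumEFin; apply: eq_bigr => k _.
  by rewrite unlock /E fineK//; exact: integrable_fin_num (iX k).
have m0 : (0 < \sum_(k < n.+1) E k)%R by exact: sum_first_gt0.
have -> : \int[P]_w elogmod ((A 0%N w : R[i]) * (A n w : R[i]))%R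
    = (F 0%N + F n)%:E.
  under eq_integral do rewrite elogmodM.
  by rewrite integralD// EFinD !fineK//; exact: integrable_fin_num.
by rewrite lne_EFin// -!EFinM [(2^-1 * _)%R]mulrC.
Qed.
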